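(* Let $X$ be a separable metric space, $F$ a finite set, $\phi:X\to\mathcal{P}(F)$ a continuous discretization, and let $\mu\in I_d(X)$ be a typical process. Then for every integer $k\ge0$ the process $\nu=\phi*\mu\in I_d(F)$ satisfies $$\mathbb{H}_\nu(B_k(C))-\frac d2\,\mathbb{H}_\nu(B_k(e))\ \ge\ \mathbb{E}_{x\sim\mu_o}\big(\mathbb{H}(\phi(x))\big).$$
   Context: $d\ge3$; $T_d$ is the infinite $d$-regular tree with vertex set $V_d$ and root $o$; $B_k(S)$ is the set of vertices within distance $k$ of $S\subseteq V_d$, $C=B_1(o)$, and $e$ is a fixed edge (set of two vertices). $I_d(Y)$ is the set of Borel probability measures on $Y^{V_d}$ invariant under all automorphisms of $T_d$; $\mu_o$ is the marginal at $o$. $\mathcal{P}(F)$ is the set of probability distributions on $F$ with the total variation topology; a continuous discretization is a continuous map $\phi:X\to\mathcal{P}(F)$. For $\alpha\in X^{V}$, $\phi*\alpha$ is the law on $F^V$ obtained by choosing independently for each $v$ an element with law $\phi(\alpha(v))$; for a law $\mu$ on $X^{V}$, $\phi*\mu$ is obtained by first sampling $\alpha\sim\mu$ and then $\phi*\alpha$. For $\nu\in I_d(F)$ and finite $S\subseteq V_d$, $\mathbb{H}_\nu(S)$ is the Shannon entropy of the marginal of $\nu$ on $F^S$; $\mathbb{H}(\phi(x))$ is the Shannon entropy of the distribution $\phi(x)$. Typical process: $\mu$ on $X^{V_d}$ is typical if there is an increasing sequence $(n_i)$ such that, for independent uniformly random $d$-regular graphs $G_i$ on $n_i$ vertices, almost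 surely there are $f_i:V(G_i)\to X$ with $\mathrm{distr}^*(f_i,G_i)\to\mu$ weakly, where $\mathrm{distr}^*(f,G)$ is the law of $f\circ\phi$ for a random covering map $\phi:V_d\to V(G)$ (neighbors of each vertex mapped bijectively onto neighbors of its image; image of $o$ uniform, then extended uniformly at random ball by ball). *)

(* Defs.v *)
From HB Require Import structures.
From mathcomp Require Import all_boot all_order all_algebra.
From mathcomp Require Import all_classical all_reals all_analysis.
Set Implicit Arguments. Unset Strict Implicit. Unset Printing Implicit Defensive.
Import Order.TTheory GRing.Theory Num.Theory.
Import numFieldNormedType.Exports.
Local Open Scope classical_set_scope.
Local Open Scope ring_scope.

Definition reduced (d : nat) (s : seq 'I_d) : bool := sorted (fun a b => a != b) s.
Definition Vd (d : nat) := {s : seq 'I_d | reduced s}.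
Definition root_ (d : nat) : Vd d := exist _ [::] (erefl true).
Definition parent_word (d : nat) (s : seq 'I_d) := take (size s).-1 s.
Definition adj (d : nat) (u v : Vd d) : bool :=
  ((val u != [::]) && (parent_word (val u) == val v)) ||
  ((val v != [::]) && (parent_word (val v) == val u)).
Definition within (d : nat) (k : nat) (S : seq (Vd d)) (v : Vd d) : Prop :=
  exists2 s, s \in S & exists p : seq (Vd d), [/\ size p <= k, path (@adj d) s p & last s p = v]%N.
Definition allwords (d : nat) (L : nat) : seq (Vd d) :=
  pmap insub (flatten [seq [seq val t | t <- enum {: l.-tuple 'I_d}] | l <- iota 0 L.+1]).
Definition tball (d : nat) (k : nat) (S : seq (Vd d)) : seq (Vd d) :=
  [seq v <- allwords d (k + \max_(s <- S) size (val s)) | `[< within k S v >]].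


Definition tree_automorphism (d : nat) (g : Vd d -> Vd d) : Prop :=
  bijective g /\ forall u v, adj (g u) (g v) = adj u v.

Definition borel_sets (X : ptopologicalType) : set (set X) := <<s [set A | open A] >>.
Definition cyl_gen (V : Type) (X : ptopologicalType) : set (set (V -> X)) :=
  [set E | exists v A, borel_sets A /\ E = (fun x : V -> X => x v) @^-1` A].
Definition conf (d : nat) (X : ptopologicalType) :=
  g_sigma_algebraType (@cyl_gen (Vd d) X).

Definition invariant_process (R : realType) (d : nat) (X : ptopologicalType)
  (mu : probability (conf d X) R) : Prop :=
  forall g, tree_automorphism g ->
  forall A : set (conf d X), measurable A ->
    mu ((fun x : conf d X => (x \o g : conf d X)) @^-1` A) = mu A.

Definition weak_conv (R : realType) (d : nat) (X : ptopologicalType)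
  (m : nat -> probability (conf d X) R) (mu : probability (conf d X) R) : Prop :=
  forall h : conf d X -> R,
    (exists M : R, forall x, `|h x| <= M) ->
    continuous (h : {ptws Vd d -> X} -> R) ->
    (fun i => Rintegral (m i) setT h) @ \oo --> Rintegral mu setT h.

Definition graph (n : nat) := {ffun 'I_n -> {set 'I_n}}.
Definition regular (d n : nat) (G : graph n) : bool :=
  [forall u, (u \notin G u) && (#|G u| == d)] &&
  [forall u, forall v, (v \in G u) ==> (u \in G v)].

(* restrictions to B_r(o) of covering maps V_d -> V(G): psi j is the image of
   the j-th vertex of the ball; local bijectivity at every vertex of B_{r-1}(o) *)
Definition ball_root (d r : nat) : seq (Vd d) := tball r [:: root_ d].
Definition partial_cover (d r n : nat) (G : graph n)
  (psi : {ffun 'I_(size (ball_root d r)) -> 'I_n}) : Prop :=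
  forall j : 'I_(size (ball_root d r)),
    (0 < r)%N -> within r.-1 [:: root_ d] (nth (root_ d) (ball_root d r) j) ->
    perm_eq (map psi [seq j' : 'I_(size (ball_root d r)) <- enum 'I_(size (ball_root d r)) |
                 adj (nth (root_ d) (ball_root d r) j) (nth (root_ d) (ball_root d r) j')])
            (enum (G (psi j))).
Definition covers (d r n : nat) (G : graph n) :=
  [set psi : {ffun 'I_(size (ball_root d r)) -> 'I_n} | `[< @partial_cover d r n G psi >]].

(* m is distr^*(f,G): the law of f o phi, phi a random covering map whose
   restriction to each ball B_r(o) is uniform among the partial covering maps;
   m is determined by its values on rectangles over balls *)
Definition is_distr_star (R : realType) (d n : nat) (X : ptopologicalType)
  (f : 'I_n -> X) (G : graph n) (m : probability (conf d X) R) : Prop :=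
  forall (r : nat) (A : 'I_(size (ball_root d r)) -> set X),
    (forall j, borel_sets (A j)) ->
    m [set x : conf d X | forall j, A j (x (nth (root_ d) (ball_root d r) j))] =
    ((#|@covers d r n G|%:R)^-1 *
       \sum_(psi in @covers d r n G) \prod_(j < size (ball_root d r)) \1_(A j) (f (psi j)))%:E.

Definition typical (R : realType) (d : nat) (X : ptopologicalType)
  (mu : probability (conf d X) R) : Prop :=
  exists ns : nat -> nat, (forall i, (ns i < ns i.+1)%N) /\
  exists (dO : measure_display) (Omega : measurableType dO) (P : probability Omega R)
         (G : forall i, Omega -> graph (ns i)),
    (forall i g, measurable [set w | G i w = g]) /\
    (forall i g, P [set w | G i w = g] =
        ((regular d g)%:R / (#|[set g' : graph (ns i) | regular d g']|)%:R)%:E) /\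
    (forall (I : seq nat) (g : forall i, graph (ns i)), uniq I ->
        P (\bigcap_(i in [set` I]) [set w | G i w = g i]) =
        (\prod_(i <- I) P [set w | G i w = g i])%E) /\
    {ae P, forall w, exists (f : forall i, 'I_(ns i) -> X)
                            (m : nat -> probability (conf d X) R),
        (forall i, is_distr_star (f i) (G i w) (m i)) /\ weak_conv m mu}.

Definition distribution (R : realType) (F : finType) (p : {ffun F -> R}) : Prop :=
  (forall a, 0 <= p a) /\ \sum_a p a = 1.
Definition tv_dist (R : realType) (F : finType) (p q : {ffun F -> R}) : R :=
  2^-1 * \sum_a `|p a - q a|.
Definition continuous_discretization (R : realType) (X : pseudoPMetricType R)
  (F : finType) (phi : X -> {ffun F -> R}) : Prop :=
  (forall x, distribution (phi x)) /\
  forall (x : X) (eps : R), 0 < eps -> exists2 delta : R, 0 < delta &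
    forall y, ball x delta y -> tv_dist (phi x) (phi y) < eps.

Definition shannon (R : realType) (F : finType) (p : {ffun F -> R}) : R :=
  - \sum_a p a * ln (p a).

(* marginal of nu = phi * mu on F^S (S listed without repetition) *)
Definition phistar_marg (R : realType) (d : nat) (X : ptopologicalType) (F : finType)
  (phi : X -> {ffun F -> R}) (mu : probability (conf d X) R) (S : seq (Vd d))
  (a : {ffun 'I_(size S) -> F}) : R :=
  Rintegral mu setT (fun x : conf d X => \prod_(i < size S) phi (x (nth (root_ d) S i)) (a i)).
Definition entropy_phistar (R : realType) (d : nat) (X : ptopologicalType) (F : finType)
  (phi : X -> {ffun F -> R}) (mu : probability (conf d X) R) (S : seq (Vd d)) : R :=
  - \sum_(a : {ffun 'I_(size S) -> F})
      phistar_marg phi mu a * ln (phistar_marg phi mu a).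

(* Main.v *)
Require Import Defs.
From HB Require Import structures.
From mathcomp Require Import all_boot all_order all_algebra all_fingroup.
From mathcomp Require Import all_classical all_reals all_analysis.
From mathcomp Require Import zify ring lra.
Set Implicit Arguments. Unset Strict Implicit. Unset Printing Implicit Defensive.
Import Order.TTheory GRing.Theory Num.Theory.
Import numFieldNormedType.Exports.
Local Open Scope classical_set_scope.
Local Open Scope ring_scope.

(** Count the pairs (G, g) where G is a d-regular graph on n vertices and g : V(G) -> F
    is a colouring whose statistics of radius k+1 balls are close to the marginal of nu.

    For a typical G there is f : V(G) -> X whose covering law is close to mu.  Colouring each
    vertex v independently with law phi(f v) gives such a colouring with high probability, by
    Chebyshev's inequality and because regular graphs have few short cycles on average (edge
    switching); hence a positive proportion of the regular graphs have at least
    exp(n (E H(phi(x)) - o(1))) of them.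

    Conversely, (G, g) is determined by the star of each vertex (its colour, and the unlabelled
    types of the branches at both ends of each of its half-edges) together with a matching of
    half-edges of mutually reversed types.  Stirling's formula and the configuration-model lower
    bound on the number of regular graphs bound the number of pairs by
    |regular graphs| * exp(n (H(star) - d/2 H(edge) + o(1))), where star and edge are the laws
    of the types at a vertex and at an edge.

    Under nu, a coloured ball has the probability of its type times one automorphism factor per
    branch; these factors contribute equally to H_nu(B_k(C)) and to d/2 H_nu(B_k(e)), so that
    H(star) - d/2 H(edge) = H_nu(B_k(C)) - d/2 H_nu(B_k(e)). *)

(** * The regular tree as a Cayley graph *)

(** Branch types follow non-backtracking walks in an arbitrary regular graph, and sums over covering
    maps factor exactly along the tree; so the frequencies of coloured balls, stars and edges
    satisfy exact linear identities in every coloured regular graph. Short cycles only spoil the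
    independence of the colours seen by a covering map.

    The limit marginal [nu] inherits these identities because they are linear: this gives the
    symmetry of its edge law and the product formula for the probability of a coloured ball.

    Types forget the labels of half-edges because a graph has no preferred labelling. Labels are put
    back for counting matchings, with equally many choices for every regular graph, and the surplus
    cancels against the same factor in the number of regular graphs.

    Typicality yields arbitrarily large n for which at least half of the regular graphs carry
    suitable vertex laws, and at least a quarter survive the restriction on short cycles; constant
    proportions vanish on the exponential scale. *)

Section Words.
Variable d : nat.
Implicit Types (s : seq 'I_d) (p q : Vd d) (c : 'I_d).

(** Right multiplication by the involution [c] in the free product of [d] copies of Z/2, whose
    elements are the reduced words. *)
Definition step_word s c : seq 'I_d :=
  if (s != [::]) && (last c s == c) then parent_word s else rcons s c.

Lemma parent_word_rcons s c : parent_word (rcons s c) = s.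
Proof. by rewrite /parent_word size_rcons /= -cats1 take_size_cat. Qed.

Lemma reduced_rcons s c : reduced (rcons s c) = reduced s && ((s == [::]) || (last c s != c)).
Proof. by case: s => [|x s] //=; rewrite /reduced /= rcons_path. Qed.

Lemma step_word_rcons s x c : step_word (rcons s x) c = if x == c then s else rcons (rcons s x) c.
Proof.
by rewrite /step_word last_rcons parent_word_rcons -size_eq0 size_rcons.
Qed.

Lemma reduced_step s c : reduced s -> reduced (step_word s c).
Proof.
case/lastP: s => [|s x] // rs; rewrite step_word_rcons; case: eqP => [_|/eqP xc].
  by move: rs; rewrite reduced_rcons => /andP[].
by rewrite reduced_rcons rs last_rcons xc orbT.
Qed.

Definition step p c : Vd d := exist _ (step_word (val p) c) (reduced_step c (valP p)).

Lemma stepK c : cancel (step^~ c) (step^~ c).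
Proof.
move=> [s rs]; apply: val_inj => /=; case/lastP: s rs => [|s x] rs.
  by rewrite /step_word /= eqxx.
rewrite step_word_rcons; case: eqP => [<-|/eqP xc]; last first.
  by rewrite step_word_rcons eqxx.
move: rs; rewrite reduced_rcons /step_word => /andP[_].
by case: (s =P [::]) => [-> //|_] /= /negbTE ->.
Qed.

Lemma val_step p c : val (step p c) = step_word (val p) c. Proof. by []. Qed.

Lemma step_inj p : injective (step p).
Proof.
move=> a b /(congr1 val); rewrite !val_step; case/lastP: (val p) => [|s x].
  by rewrite /step_word /= => -[].
rewrite !step_word_rcons; case: eqP => [<-|_]; case: eqP => [<-|_] //.
- by move/(congr1 size); rewrite !size_rcons => /eqP; rewrite eqn_leq !ltnNge; lia.
- by move/(congr1 size); rewrite !size_rcons; lia.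
- by move/rcons_inj => [].
Qed.

(** Singles out the letter that leads from [p] towards the root; at the root there is none. *)
Definition back p c : bool := (val p != [::]) && (last c (val p) == c).

Lemma back_step p c : ~~ back p c -> back (step p c) c.
Proof.
rewrite /back val_step /step_word => /negbTE ->.
by rewrite -size_eq0 size_rcons last_rcons eqxx.
Qed.

Lemma back_uniq p c c' : back p c -> back p c' = (c' == c).
Proof.
by rewrite /back; case/lastP: (val p) => [|s x]; rewrite ?last_rcons // => /andP[-> /eqP ->]; rewrite eq_sym.
Qed.

Lemma val_step_fwd p c : ~~ back p c -> val (step p c) = rcons (val p) c.
Proof. by rewrite val_step /step_word /back => /negbTE ->. Qed.

Lemma size_step_fwd p c : ~~ back p c -> size (val (step p c)) = (size (val p)).+1.
Proof. by move/val_step_fwd ->; rewrite size_rcons. Qed.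

Lemma size_step_back p c : back p c -> size (val p) = (size (val (step p c))).+1.
Proof.
rewrite val_step /step_word /back; case/lastP: (val p) => [|s x] //.
by rewrite last_rcons parent_word_rcons size_rcons => ->.
Qed.

Lemma size_step_le p c : (size (val (step p c)) <= (size (val p)).+1)%N.
Proof.
case: (boolP (back p c)) => [/size_step_back ->|/size_step_fwd -> //].
by rewrite ltnW // ltnS.
Qed.

Lemma back_ex p : val p != [::] -> exists c, back p c.
Proof.
by rewrite /back; case/lastP: (val p) => [|s x] // _; exists x; rewrite -size_eq0 size_rcons last_rcons eqxx.
Qed.

Lemma adjP p q : reflect (exists c, q = step p c) (adj p q).
Proof.
rewrite /adj; apply: (iffP orP) => [[]/andP[]|[c ->]].
- move=> np /eqP pq; have [c bc] := back_ex np; exists c; apply: val_inj.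
  by rewrite val_step /step_word; move: bc; rewrite /back => ->.
- move=> nq /eqP pq; have [c bc] := back_ex nq; exists c.
  have -> : p = step q c by apply: val_inj; rewrite val_step /step_word; move: bc; rewrite /back => ->.
  by rewrite stepK.
case: (boolP (back p c)) => bc.
  by left; rewrite val_step /step_word; move: (bc); rewrite /back => ->; move: bc => /andP[-> _]/=.
by right; rewrite val_step_fwd // parent_word_rcons eqxx -size_eq0 size_rcons.
Qed.

Lemma adj_step p c : adj p (step p c). Proof. by apply/adjP; exists c. Qed.

Lemma adj_sym : symmetric (@adj d).
Proof. by move=> p q; rewrite /adj orbC. Qed.

Lemma within_root k q : Defs.within k [:: root_ d] q <-> (size (val q) <= k)%N.
Proof.
split=> [[s]|].
  rewrite inE => /eqP -> [l [lk pl <-]]; apply: leq_trans lk.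
  have: (size (val (last (root_ d) l)) <= size (val (root_ d)) + size l)%N; last by [].
  elim: l (root_ d) pl => [|x l IH] p /=; first by rewrite addn0.
  move=> /andP[/adjP[c ->] /IH H]; apply: leq_trans H _.
  by rewrite addnS -addSn leq_add2r size_step_le.
elim: k q => [|k IH] q.
  rewrite leqn0 size_eq0 => /eqP q0; exists (root_ d); rewrite ?inE //.
  by exists [::]; split=> //; apply: val_inj.
case: (posnP (size (val q))) => [q0 _|q0 qk].
  by exists (root_ d); rewrite ?inE //; exists [::]; split=> //; apply: val_inj; apply/esym/eqP; rewrite -size_eq0 q0.
have [|c bc] := @back_ex q; first by rewrite -size_eq0 -lt0n.
have := size_step_back bc => sq.
have [|s] := IH (step q c); first by rewrite -ltnS -sq.
rewrite inE => /eqP -> [l [lk pl lq]]; exists (root_ d); first by rewrite inE.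
exists (rcons l q); split.
- by rewrite size_rcons.
- by rewrite rcons_path pl lq adj_sym adj_step.
- by rewrite last_rcons.
Qed.

Lemma mem_allwords L q : (q \in allwords d L) = (size (val q) <= L)%N.
Proof.
rewrite /allwords mem_pmap; apply/mapP/idP => [[x]|qL].
  move/flattenP=> [y /mapP[l]]; rewrite mem_iota add0n => /andP[_ lL] -> /mapP[t _ ->].
  move/esym; case: insubP => // u _ vu [<-]; by rewrite vu size_tuple -ltnS.
exists (val q); last by rewrite valK.
apply/flattenP; exists [seq val t | t <- enum {: (size (val q)).-tuple 'I_d}].
  by apply/mapP; exists (size (val q)) => //; rewrite mem_iota.
by apply/mapP; exists (in_tuple (val q)) => //; rewrite mem_enum.
Qed.

Lemma uniq_allwords L : uniq (allwords d L).
Proof.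
rewrite /allwords; apply: (pmap_uniq (g := val)).
  by move=> x /=; case: insubP => //= u _ ->.
elim: L.+1 0%N => [|l IH] m //=.
rewrite cat_uniq IH andbT map_inj_uniq ?enum_uniq; last exact: val_inj.
apply/hasPn => x /flattenP[y /mapP[l']]; rewrite mem_iota => /andP[ml' _] -> /mapP[t _ ->].
apply/mapP => -[t' _ /(congr1 size)]; rewrite !size_tuple => H; move: ml'; rewrite H ltnn //.
Qed.

Lemma mem_tball k (S : seq (Vd d)) q : (q \in tball k S) = `[< Defs.within k S q >].
Proof.
rewrite mem_filter; case: asboolP => //= -[s sS [l [lk pl <-]]].
rewrite mem_allwords.
have H : (size (val (last s l)) <= size (val s) + size l)%N.
  elim: l s pl {sS lk} => [|x l IH] p /=; first by rewrite addn0.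
  move=> /andP[/adjP[c ->] /IH H]; apply: leq_trans H _.
  by rewrite addnS -addSn leq_add2r size_step_le.
apply: leq_trans H _; rewrite addnC; apply: leq_add => //.
by rewrite (big_rem s) //= leq_maxl.
Qed.

Lemma uniq_tball k (S : seq (Vd d)) : uniq (tball k S).
Proof. exact/filter_uniq/uniq_allwords. Qed.

Lemma mem_ball_root r q : (q \in ball_root d r) = (size (val q) <= r)%N.
Proof. by rewrite mem_tball; apply/asboolP/idP => /within_root. Qed.

Lemma uniq_ball_root r : uniq (ball_root d r). Proof. exact: uniq_tball. Qed.

End Words.

(** * Random covering maps *)

Section Look.
Variables (d : nat) (A : Type) (a0 : A) (S : seq (Vd d)).

(** Extending tables on finite balls to all of [Vd] by a default value lets maps on balls of
    different radii be compared as functions on one domain. *)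
Definition look (x : {ffun 'I_(size S) -> A}) (q : Vd d) : A :=
  if insub (index q S) is Some j then x j else a0.

Definition rst (f : Vd d -> A) : {ffun 'I_(size S) -> A} :=
  [ffun j => f (nth (root_ d) S (nat_of_ord j))].

Lemma look_rst f q : q \in S -> look (rst f) q = f q.
Proof.
move=> qS; rewrite /look; case: insubP => [j _ vj|]; last by rewrite index_mem qS.
by rewrite ffunE vj nth_index.
Qed.

Lemma look_nth x (j : 'I_(size S)) : uniq S -> look x (nth (root_ d) S j) = x j.
Proof.
move=> uS; rewrite /look index_uniq //; case: insubP => [i _ vi|]; last by rewrite ltn_ord.
by congr (x _); apply: val_inj.
Qed.

Lemma rst_look x : uniq S -> rst (look x) = x.
Proof. by move=> uS; apply/ffunP => j; rewrite ffunE look_nth. Qed.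

Lemma eq_rst f f' : {in S, f =1 f'} -> rst f = rst f'.
Proof. by move=> H; apply/ffunP => j; rewrite !ffunE H // mem_nth. Qed.

Lemma big_look (R : Type) (idx : R) (op : Monoid.com_law idx) (h : Vd d -> R) :
  \big[op/idx]_(j < size S) h (nth (root_ d) S j) = \big[op/idx]_(q <- S) h q.
Proof. by rewrite (big_nth (root_ d)) big_mkord. Qed.

End Look.

Section Covers.
Variables (d n : nat) (G : graph n).

(** The orderings of the neighbours of [w] by ['I_d], that is, the labellings of the half-edges at
    [w]. *)
Definition Theta (w : 'I_n) : {set {ffun 'I_d -> 'I_n}} :=
  [set th : {ffun 'I_d -> 'I_n} | perm_eq (map th (enum 'I_d)) (enum (G w))]%SET.

Definition local_cover (psi : Vd d -> 'I_n) (p : Vd d) : bool :=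
  [ffun c => psi (step p c)] \in Theta (psi p).

Variable n0 : 'I_n.

Lemma in_covers r (psi : {ffun 'I_(size (ball_root d r)) -> 'I_n}) :
  (psi \in @covers d r n G) <->
  (forall p, (size (val p) < r)%N -> local_cover (look n0 psi) p).
Proof.
have nbrs (j : 'I_(size (ball_root d r))) :
    (size (val (nth (root_ d) (ball_root d r) j)) < r)%N ->
    perm_eq (map psi [seq j' : 'I_(size (ball_root d r)) <- enum 'I_(size (ball_root d r)) |
       adj (nth (root_ d) (ball_root d r) j) (nth (root_ d) (ball_root d r) j')])
     (map [ffun c => look n0 psi (step (nth (root_ d) (ball_root d r) j) c)] (enum 'I_d)).
  move=> jr; set p := nth _ _ _ in jr *.
  have e1 : map psi [seq j' : 'I_(size (ball_root d r)) <- enum 'I_(size (ball_root d r)) |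
       adj p (nth (root_ d) (ball_root d r) j')] =
    map (look n0 psi) (map (fun j' : 'I_(size (ball_root d r)) => nth (root_ d) (ball_root d r) j') 
       [seq j' : 'I_(size (ball_root d r)) <- enum 'I_(size (ball_root d r)) |
       adj p (nth (root_ d) (ball_root d r) j')]).
    by rewrite -map_comp; apply: eq_map => i /=; rewrite look_nth // uniq_ball_root.
  have e2 : map [ffun c => look n0 psi (step p c)] (enum 'I_d) = map (look n0 psi) (map (step p) (enum 'I_d)).
    by rewrite -map_comp; apply: eq_map => i /=; rewrite ffunE.
  rewrite e1 e2; apply: perm_map; apply: uniq_perm.
  - rewrite map_inj_in_uniq; first exact/filter_uniq/enum_uniq.
    move=> i i' _ _ /eqP; rewrite nth_uniq ?uniq_ball_root // => /eqP; exact: val_inj.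
  - by rewrite map_inj_uniq ?enum_uniq //; exact: step_inj.
  move=> q; apply/mapP/mapP => [[i]|[c _ ->]].
    by rewrite mem_filter => /andP[/adjP[c ->] _] ->; exists c; rewrite ?mem_enum.
  have qb : step p c \in ball_root d r.
    by rewrite mem_ball_root; apply: leq_trans (size_step_le _ _) _.
  have ib : (index (step p c) (ball_root d r) < size (ball_root d r))%N by rewrite index_mem.
  exists (Ordinal ib); last by rewrite /= nth_index.
  by rewrite mem_filter /= nth_index // adj_step mem_enum.
rewrite inE /=; split => [/asboolP H p pr|H].
  have pb : p \in ball_root d r by rewrite mem_ball_root ltnW.
  have ip : (index p (ball_root d r) < size (ball_root d r))%N by rewrite index_mem.
  have r0 : (0 < r)%N by case: r pr {psi nbrs H pb ip}.
  have H1 := nbrs (Ordinal ip); rewrite /= nth_index // in H1.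
  have H2 := H (Ordinal ip) r0; rewrite /= nth_index // in H2.
  have H3 : Defs.within r.-1 [:: root_ d] p by apply/within_root; rewrite -ltnS prednK.
  have e : look n0 psi p = psi (Ordinal ip).
    by rewrite -{1}(nth_index (root_ d) pb) (look_nth _ _ (Ordinal ip)) // uniq_ball_root.
  rewrite /local_cover inE e; apply: perm_trans (H2 H3).
  by rewrite perm_sym; exact: H1 pr.
apply/asboolP => j r0 /within_root; rewrite -ltnS prednK // => jr.
apply: perm_trans (nbrs j jr) _.
by have := H _ jr; rewrite /local_cover inE look_nth // uniq_ball_root.
Qed.

Lemma local_coverE (psi psi' : Vd d -> 'I_n) p : psi p = psi' p ->
  (forall c, psi (step p c) = psi' (step p c)) -> local_cover psi p = local_cover psi' p.
Proof.
move=> e e'; rewrite /local_cover e.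
suff -> : [ffun c => psi (step p c)] = [ffun c => psi' (step p c)] :> {ffun 'I_d -> 'I_n} by [].
by apply/ffunP => c; rewrite !ffunE.
Qed.

(** The choices that extend a cover by one layer: at each vertex of the sphere an ordering of the
    neighbours of its image that agrees with [psi] towards the root. Off the sphere the choice is
    frozen to a constant, so that each extension is counted once. *)
Definition star_ext r (psi : Vd d -> 'I_n) (j : 'I_(size (ball_root d r))) : pred {ffun 'I_d -> 'I_n} :=
  fun th => let q := nth (root_ d) (ball_root d r) j in
  if size (val q) == r then (th \in Theta (psi q)) && [forall c, back q c ==> (th c == psi (step q c))]
  else th == [ffun=> n0].

Definition extend r (psi : Vd d -> 'I_n) (T : {ffun 'I_(size (ball_root d r)) -> {ffun 'I_d -> 'I_n}})
  (q : Vd d) : 'I_n :=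
  if (size (val q) <= r)%N then psi q else
  if [pick c | back q c] is Some c then look [ffun=> n0] T (step q c) c else n0.

Arguments extend : clear implicits.

Lemma extend_step r psi T p c : size (val p) = r -> ~~ back p c ->
  extend r psi T (step p c) = look [ffun=> n0] (T : {ffun 'I_(size (ball_root d r)) -> _}) p c.
Proof.
move=> pr bpc; rewrite /extend size_step_fwd // pr ltnn.
case: pickP => [c' bc'|/(_ c)]; last by rewrite back_step.
have := back_uniq c' (back_step bpc); rewrite bc' => /esym/eqP ->.
by rewrite stepK.
Qed.

Definition stars r (psi : Vd d -> 'I_n) : {ffun 'I_(size (ball_root d r)) -> {ffun 'I_d -> 'I_n}} :=
  rst (ball_root d r) (fun q => if size (val q) == r then [ffun c => psi (step q c)] else [ffun=> n0]).

Lemma extend_stars r psi psi' q : (size (val q) <= r.+1)%N ->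
  (forall p, (size (val p) <= r)%N -> psi' p = psi p) ->
  extend r psi' (stars r psi) q = psi q.
Proof.
move=> qr H; rewrite /extend; case: leqP => [/H -> //|rq].
have sq : size (val q) = r.+1 by apply/eqP; rewrite eqn_leq qr.
case: pickP => [c bc|H0]; last first.
  by have [|c] := @back_ex d q; [rewrite -size_eq0 sq|rewrite H0].
have := size_step_back bc; rewrite sq => -[/esym sr].
by rewrite look_rst ?mem_ball_root ?sr // eqxx ffunE stepK.
Qed.

(** Restriction to the smaller ball and the stars read off on the sphere of radius [r] are inverse
    to gluing ([extend]); the choices at different sphere vertices are independent. *)
Lemma sum_covers_S (R : nmodType) r (Phi : (Vd d -> 'I_n) -> R) :
  (forall psi psi', (forall q, (size (val q) <= r.+1)%N -> psi q = psi' q) -> Phi psi = Phi psi') ->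
  \sum_(psi in @covers d r.+1 n G) Phi (look n0 psi) =
  \sum_(psi in @covers d r n G) \sum_(T in family (star_ext (look n0 psi)))
     Phi (extend r (look n0 psi) T).
Proof.
move=> ePhi.
rewrite pair_big_dep /=.
pose h (x : {ffun 'I_(size (ball_root d r)) -> 'I_n} *
            {ffun 'I_(size (ball_root d r)) -> {ffun 'I_d -> 'I_n}}) :=
  rst (ball_root d r.+1) (extend r (look n0 x.1) x.2).
pose h' (psi : {ffun 'I_(size (ball_root d r.+1)) -> 'I_n}) :=
  (rst (ball_root d r) (look n0 psi), stars r (look n0 psi)).
have hE x q : (size (val q) <= r.+1)%N -> look n0 (h x) q = extend r (look n0 x.1) x.2 q.
  by move=> qr; rewrite look_rst // mem_ball_root.
have h'E psi q : (size (val q) <= r)%N -> look n0 (h' psi).1 q = look n0 psi q.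
  by move=> qr; rewrite look_rst // mem_ball_root.
rewrite (reindex_onto h h') /=; last first.
  move=> psi _; rewrite -[RHS](rst_look n0 psi (@uniq_ball_root d r.+1)).
  apply: eq_rst => q; rewrite mem_ball_root => qr.
  by rewrite extend_stars // => p pr; rewrite h'E.
apply: eq_big => [x|x _]; last by apply: ePhi => q /(hE x).
have hlow p : (size (val p) <= r)%N -> look n0 (h x) p = look n0 x.1 p.
  by move=> pr; rewrite hE 1?ltnW // /extend pr.
apply/andP/andP => [[/(in_covers _) H /eqP e]|[/(in_covers _) H1 H2]].
  have xE : x = h' (h x) by [].
  have Hlow p : (size (val p) < r)%N -> local_cover (look n0 x.1) p.
    move=> pr; have := H p (ltnW pr); rewrite (@local_coverE _ (look n0 x.1)) // ?hlow // 1?ltnW //.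
    by move=> c; rewrite hlow //; apply: leq_trans (size_step_le _ _) _.
  split; first exact/(in_covers _).
  apply/familyP => j. have e2 : x.2 = stars r (look n0 (h x)) by rewrite {1}xE.
  rewrite -topredE /= /star_ext e2.
  set q := nth _ _ _.
  rewrite /stars /rst ffunE -/q; case: ifP => [/eqP sq|->]; last by rewrite eqxx.
  rewrite sq eqxx.
  have := H q; rewrite sq => /(_ (leqnn _)); rewrite /local_cover hlow ?sq // => -> /=.
  apply/forallP => c; apply/implyP => bc; rewrite ffunE hlow //.
  by have := size_step_back bc; rewrite sq => ->.
have H2' p : size (val p) = r -> (look [ffun=> n0] x.2 p \in Theta (look n0 x.1 p)) /\
     forall c, back p c -> look [ffun=> n0] x.2 p c = look n0 x.1 (step p c).
  move=> sp; have pb : p \in ball_root d r by rewrite mem_ball_root sp.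
  have ip : (index p (ball_root d r) < size (ball_root d r))%N by rewrite index_mem.
  have /familyP/(_ (Ordinal ip)) := H2; rewrite -topredE /= /star_ext nth_index // sp eqxx.
  move=> /andP[T1 /forallP T2].
  have -> : look [ffun=> n0] x.2 p = x.2 (Ordinal ip).
    by rewrite -{1}(nth_index (root_ d) pb) (look_nth _ _ (Ordinal ip)) // uniq_ball_root.
  by split=> // c bc; have := T2 c; rewrite bc => /eqP.
have hstep p c : size (val p) = r -> look n0 (h x) (step p c) = look [ffun=> n0] x.2 p c.
  move=> sp; rewrite hE; last by apply: leq_trans (size_step_le _ _) _; rewrite sp.
  case: (boolP (back p c)) => bc; last by rewrite extend_step.
  rewrite (H2' p sp).2 // /extend.
  have -> // : (size (val (step p c)) <= r)%N.
  by rewrite -sp (size_step_back bc).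
split; [apply/(in_covers _) => p|].
  rewrite ltnS leq_eqVlt => /orP[/eqP sp|pr].
    rewrite /local_cover hlow ?sp //.
    have -> : [ffun c => look n0 (h x) (step p c)] = look [ffun=> n0] x.2 p.
      by apply/ffunP => c; rewrite ffunE hstep.
    by have [] := H2' p sp.
  rewrite (@local_coverE _ (look n0 x.1)) ?hlow // 1?ltnW //; first exact: H1.
  by move=> c; rewrite hlow //; apply: leq_trans (size_step_le _ _) _.
case: x hE hlow H1 H2 H2' hstep => x1 x2 /= hE hlow H1 H2 H2' hstep.
apply/eqP; congr (_, _).
  rewrite -[RHS](rst_look n0 x1 (@uniq_ball_root d r)).
  by apply: eq_rst => q; rewrite mem_ball_root; exact: hlow.
apply/ffunP => j; rewrite ffunE; set q := nth _ _ _.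
case: ifP => [/eqP sq|sq].
  apply/ffunP => c; rewrite ffunE hstep //.
  by rewrite look_nth // uniq_ball_root.
by have /familyP/(_ j) := H2; rewrite -topredE /= /star_ext -/q sq => /eqP.
Qed.

End Covers.

(** * Transfer recursion for weighted sums over covering maps *)

Section CoverSum.
Variables (d n : nat) (G : graph n) (n0 : 'I_n) (R : comNzRingType) (Hr : 'I_n -> R).
Implicit Type H : Vd d -> 'I_n -> 'I_n -> R.

Definition cover_weight H r (psi : Vd d -> 'I_n) : R :=
  Hr (psi (root_ d)) * \prod_(p <- ball_root d r | (size (val p) < r)%N)
    \prod_(c | ~~ back p c) H (step p c) (psi p) (psi (step p c)).

(** The total weight of the covers of the branch that hangs at [p], when [p] goes to [w] and its
    neighbour in direction [c0] goes to [v]. *)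
Fixpoint branch_sum H k (p : Vd d) (c0 : 'I_d) (v w : 'I_n) : R :=
  H p v w * if k is k'.+1 then
    \sum_(th in Theta d G w | th c0 == v) \prod_(c | c != c0) branch_sum H k' (step p c) c w (th c)
  else 1.

Lemma perm_ball_rootS r :
  perm_eq [seq p <- ball_root d r.+1 | (size (val p) < r.+1)%N] (ball_root d r).
Proof.
apply: uniq_perm => [||q]; [exact/filter_uniq/uniq_ball_root|exact: uniq_ball_root|].
rewrite mem_filter !mem_ball_root ltnS; case: leqP => //= qr; exact: ltnW.
Qed.

Lemma prod_ball_rootS (X : Vd d -> R) r :
  \prod_(p <- ball_root d r.+1 | (size (val p) < r.+1)%N) X p =
  \prod_(p <- ball_root d r | (size (val p) < r)%N) X p *
  \prod_(p <- ball_root d r | size (val p) == r) X p.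
Proof.
rewrite -big_filter (perm_big _ (perm_ball_rootS r)) /=.
rewrite (bigID (fun p => (size (val p) < r)%N)) /=; congr (_ * _).
rewrite big_seq_cond [RHS]big_seq_cond; apply: eq_bigl => p.
by rewrite mem_ball_root -leqNgt [in RHS]eqn_leq andbA andbb.
Qed.

Lemma prod_sphereS (Y : Vd d -> R) r :
  \prod_(q <- ball_root d r.+1 | size (val q) == r.+1) Y q =
  \prod_(p <- ball_root d r | size (val p) == r) \prod_(c | ~~ back p c) Y (step p c).
Proof.
transitivity (\prod_(p <- [seq p <- ball_root d r | size (val p) == r])
   \prod_(c <- [seq c <- enum 'I_d | ~~ back p c]) Y (step p c)); last first.
  by rewrite big_filter; apply: eq_bigr => p _; rewrite big_filter big_enum_cond.
rewrite -(big_allpairs_dep (idx := 1) (op := *%R) (h := fun p c => step p c)) -[LHS]big_filter.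
apply: perm_big; apply: uniq_perm.
- exact/filter_uniq/uniq_ball_root.
- apply: allpairs_uniq_dep.
  + exact/filter_uniq/uniq_ball_root.
  + by move=> p _; exact/filter_uniq/enum_uniq.
  move=> _ _ /allpairsPdep[p [c [_ cc ->]]] /allpairsPdep[p' [c' [_ cc' ->]]] /= e.
  move: cc cc'; rewrite !mem_filter => /andP[bc _] /andP[bc' _].
  have := back_uniq c' (back_step bc); rewrite e back_step // => /esym/eqP ec; subst c'.
  by move: e => /(congr1 (fun q => step q c)); rewrite !stepK => ->.
move=> q; rewrite mem_filter mem_ball_root; apply/idP/allpairsPdep.
  move=> /andP[/eqP sq _].
  have [|c bc] := @back_ex d q; first by rewrite -size_eq0 sq.
  have := size_step_back bc; rewrite sq => -[sr].
  exists (step q c), c; split; rewrite ?stepK // mem_filter.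
    by rewrite -sr eqxx mem_ball_root -sr leqnn.
  rewrite mem_enum inE andbT; apply/negP => /size_step_back; rewrite stepK sq -sr => /eqP.
  by lia.
move=> [p [c [pp cc ->]]]; move: pp cc; rewrite !mem_filter => /andP[/eqP sp _] /andP[bc _].
by rewrite size_step_fwd // sp eqxx leqnn.
Qed.

Lemma sum_covers_layer H r :
  \sum_(psi in @covers d r.+1 n G) cover_weight H r.+1 (look n0 psi) =
  \sum_(psi in @covers d r n G) cover_weight H r (look n0 psi) *
    \prod_(p <- ball_root d r | size (val p) == r)
      \sum_(th in Theta d G (look n0 psi p) |
          [forall c, back p c ==> (th c == look n0 psi (step p c))])
         \prod_(c | ~~ back p c) H (step p c) (look n0 psi p) (th c).
Proof.
rewrite sum_covers_S; last first.
  move=> psi psi' e; rewrite /cover_weight e //; congr (_ * _).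
  apply: eq_bigr => p pr; apply: eq_bigr => c _; rewrite (e p) 1?ltnW // (e (step p c)) //.
  by apply: leq_trans (size_step_le _ _) _.
apply: eq_bigr => psi _.
pose J := ball_root d r.
pose Q (j : 'I_(size J)) := size (val (nth (root_ d) J j)) == r.
pose X p (th : {ffun 'I_d -> 'I_n}) := \prod_(c | ~~ back p c) H (step p c) (look n0 psi p) (th c).
transitivity (\sum_(T in family (star_ext G n0 (look n0 psi)))
   cover_weight H r (look n0 psi) * \prod_(j < size J) if Q j then X (nth (root_ d) J j) (T j) else 1).
  apply: eq_bigr => T _; rewrite /cover_weight prod_ball_rootS mulrA; congr (_ * _ * _).
  + apply: eq_bigr => p pr; apply: eq_bigr => c _; rewrite /extend (ltnW pr).
    have -> // : (size (val (step p c)) <= r)%N.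
    by apply: leq_trans (size_step_le _ _) _.
  + rewrite [LHS]big_mkcond (big_nth (root_ d)) big_mkord; apply: eq_bigr => j _.
    rewrite /Q /J; case: ifP => // /eqP sj; apply: eq_bigr => c bc.
    rewrite extend_step // /extend sj leqnn.
    by rewrite (look_nth _ T j) ?uniq_ball_root.
rewrite -big_distrr /=; congr (_ * _).
rewrite -(bigA_distr_big_dep (@star_ext d n G n0 r (look n0 psi))
  (fun j th => if Q j then X (nth (root_ d) J j) th else 1)).
rewrite [RHS]big_mkcond (big_nth (root_ d)) big_mkord; apply: eq_bigr => j _.
rewrite /star_ext /Q /J; case: eqP => _ //.
by rewrite big_pred1_eq.
Qed.

(** Absorbs the sum over the outermost layer into the weights on the sphere, so that an induction on
    the radius can change the weights instead of the tree. *)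
Definition layer_weight H r p (v w : 'I_n) : R :=
  H p v w * if size (val p) == r then
    \sum_(th in Theta d G w | [forall c, back p c ==> (th c == v)])
      \prod_(c | ~~ back p c) H (step p c) w (th c) else 1.

Lemma branch_sum_layer H r k p c0 v w : (size (val p) + k)%N = r -> back p c0 ->
  branch_sum H k.+1 p c0 v w = branch_sum (layer_weight H r) k p c0 v w.
Proof.
elim: k p c0 v w => [|k IH] p c0 v w pr bp.
  rewrite /= /layer_weight -pr addn0 eqxx mulr1; congr (_ * _).
  apply: eq_big => [th|th _].
    congr (_ && _); apply/eqP/forallP => [e c|/(_ c0)]; last by rewrite bp => /eqP.
    by rewrite (back_uniq c bp); apply/implyP => /eqP ->; rewrite e.
  by apply: eq_big => [c|c _]; rewrite ?(back_uniq c bp) // mulr1.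
rewrite [LHS]/= [RHS]/= {1}/layer_weight ifN ?mulr1; last by rewrite -pr; lia.
congr (_ * _); apply: eq_bigr => th _; apply: eq_bigr => c cc0.
have bc : ~~ back p c by rewrite (back_uniq c bp).
rewrite -IH ?back_step //.
by rewrite size_step_fwd // addSnnS.
Qed.

Lemma ball_root0 : ball_root d 0 = [:: root_ d].
Proof.
apply: perm_small_eq => //; apply: uniq_perm; rewrite ?uniq_ball_root // => q.
rewrite mem_ball_root inE leqn0 size_eq0.
by apply/eqP/eqP => [e|-> //]; apply: val_inj.
Qed.

Lemma sum_covers0 (Phi : (Vd d -> 'I_n) -> R) :
  (forall psi psi', psi (root_ d) = psi' (root_ d) -> Phi psi = Phi psi') ->
  \sum_(psi in @covers d 0 n G) Phi (look n0 psi) = \sum_v Phi (fun=> v).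
Proof.
move=> ePhi.
rewrite (reindex_onto (fun v => rst (ball_root d 0) (fun=> v)) (fun psi => look n0 psi (root_ d))) /=.
  apply: eq_big => [v|v _]; last first.
    by apply: ePhi; rewrite look_rst // mem_ball_root.
  rewrite look_rst ?mem_ball_root // eqxx andbT; apply/(in_covers _ n0).
  by move=> p; rewrite ltn0.
move=> psi _; rewrite -[RHS](rst_look n0 psi (@uniq_ball_root d 0)).
apply: eq_rst => q; rewrite mem_ball_root leqn0 size_eq0 => /eqP e; congr look.
exact: val_inj.
Qed.

(** Induction on the radius with [H] generalised: given a cover of the inner ball, the sum over the
    outer layer factors over the sphere, and [layer_weight] turns it into a modification of [H]. *)
Lemma sum_covers H k :
  \sum_(psi in @covers d k.+1 n G) cover_weight H k.+1 (look n0 psi) =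
  \sum_v Hr v * \sum_(th in Theta d G v)
     \prod_c branch_sum H k (step (root_ d) c) c v (th c).
Proof.
elim: k H => [|k IH] H.
  rewrite sum_covers_layer (sum_covers0 (Phi := fun psi => cover_weight H 0 psi *
    \prod_(p <- ball_root d 0 | size (val p) == 0%N)
      \sum_(th in Theta d G (psi p) |
          [forall c, back p c ==> (th c == psi (step p c))])
         \prod_(c | ~~ back p c) H (step p c) (psi p) (th c))).
    apply: eq_bigr => v _; rewrite /cover_weight big_pred0 // mulr1; congr (_ * _).
    rewrite ball_root0 big_mkcond big_seq1 /=; apply: eq_big => [th|th _].
      by rewrite [X in _ && X](_ : _ = true) ?andbT //; apply/forallP.
    by apply: eq_bigr => c _; rewrite /= mulr1.
  move=> psi psi' e; rewrite /cover_weight ball_root0 [\prod_(p <- _ | size _ == _) _]big_mkcond.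
  rewrite [\prod_(p <- _ | size _ == _) _ in RHS]big_mkcond !big_seq1 /= !e.
  by congr (_ * _ * _); rewrite !big_pred0.
rewrite sum_covers_layer.
transitivity (\sum_(psi in @covers d k.+1 n G) cover_weight (layer_weight H k.+1) k.+1 (look n0 psi)).
  apply: eq_bigr => psi _; rewrite /cover_weight -mulrA; congr (_ * _).
  rewrite prod_sphereS !prod_ball_rootS -mulrA; congr (_ * _).
    apply: eq_bigr => p pk; apply: eq_bigr => c bc.
    by rewrite /layer_weight size_step_fwd // ifN ?mulr1 // eqSS ltn_eqF.
  rewrite -big_split /=; apply: eq_bigr => p /eqP sp.
  rewrite -big_split /=; apply: eq_bigr => c bc.
  rewrite /layer_weight size_step_fwd // sp eqxx; congr (_ * _).
  apply: eq_bigl => th; congr (_ && _).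
  apply/forallP/forallP => e c'; have := e c'; case: (boolP (back _ c')) => // bc' /=.
    by move: bc'; rewrite (back_uniq _ (back_step bc)) => /eqP ->; rewrite stepK.
  by move: bc'; rewrite (back_uniq _ (back_step bc)) => /eqP ->; rewrite stepK.
rewrite IH; apply: eq_bigr => v _; congr (_ * _); apply: eq_bigr => th _; apply: eq_bigr => c _.
rewrite -branch_sum_layer ?back_step //.
Qed.

End CoverSum.

(** * Permutations carrying one colouring of a finite set to another *)

Section Young.
Variables (I T : finType).
Implicit Types (x y : I -> T).

Definition fibre x t : {set I} := [set i | x i == t]%SET.

Definition glue x (f : {ffun T -> {perm I}}) : I -> I := fun i => f (x i) i.

Lemma glue_inj x (f : {ffun T -> {perm I}}) : (forall t, f t \in perm_on (fibre x t)) ->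
  injective (glue x f).
Proof.
move=> H i j; rewrite /glue => e.
have Hx k : x (f (x k) k) = x k.
  by apply/eqP; have := perm_closed k (H (x k)); rewrite !inE eqxx => ->.
by have := congr1 x e; rewrite !Hx => ex; move: e; rewrite ex => /perm_inj.
Qed.

(** The stabiliser of a colouring is a Young subgroup: a permutation preserving [x] is the same as
    one permutation of each fibre, glued together. *)
Lemma card_stab_coloring x :
  #|[set s : {perm I} | [forall i, x (s i) == x i]]%SET| = (\prod_t (#|fibre x t|)`!)%N.
Proof.
pose A := [set s : {perm I} | [forall i, x (s i) == x i]]%SET.
pose h (s : {perm I}) : {ffun T -> {perm I}} := [ffun t => restr_perm (fibre x t) s].
have sA s i : s \in A -> x (s i) = x i by rewrite inE => /forallP/(_ i)/eqP.
have sN s t : s \in A -> s \in ('N(fibre x t | 'P))%g.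
  by move=> sA'; apply/astabsP => i; rewrite [LHS]inE [RHS]inE /= apermE sA.
have hE s i : s \in A -> h s (x i) i = s i.
  by move=> sA'; rewrite ffunE restr_permE ?sN // inE.
have hinj : {in A &, injective h}.
  by move=> s s' sA' sA'' e; apply/permP => i; rewrite -(hE s) // -(hE s') // e.
rewrite -(card_in_imset hinj).
transitivity #|[set f | f \in family (fun t => perm_on (fibre x t))]%SET|; last first.
  rewrite cardsE card_family foldrE big_map big_enum /=.
  by apply: eq_bigr => t _; rewrite card_perm.
congr #|pred_of_set _|; apply/setP => f; rewrite inE; apply/imsetP/familyP => [[s sA' ->] t|H].
  by rewrite ffunE; exact: restr_perm_on.
pose s := perm (glue_inj H).
have sA' : s \in A.
  rewrite inE; apply/forallP => i; rewrite permE /glue.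
  by have := perm_closed i (H (x i)); rewrite !inE eqxx.
exists s => //; apply/ffunP => t; apply/permP => i; rewrite ffunE.
case: (boolP (i \in fibre x t)) => it.
  rewrite restr_permE ?sN // permE /glue.
  by move: it; rewrite inE => /eqP ->.
by rewrite (out_perm (H t) it) (out_perm (restr_perm_on _ _) it).
Qed.

Lemma ex_perm_coloring x y : (forall t, #|fibre x t| = #|fibre y t|) ->
  exists s : {perm I}, forall i, y (s i) = x i.
Proof.
move=> H.
have pe : perm_eq (map x (enum I)) (map y (enum I)).
  apply/allP => t _ /=; rewrite !enumT !count_map; apply/eqP.
  have E z : #|fibre z t| = count (fun i => z i == t) (Finite.enum I).
    by rewrite /fibre cardE /enum_mem size_filter; apply: eq_count => i; rewrite !inE.
  by have := H t; rewrite !E.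
have sx : size (map x (enum I)) == #|I| by rewrite size_map -cardE.
have sy : size (map y (enum I)) == #|I| by rewrite size_map -cardE.
have /tuple_permP[p ep] : perm_eq (Tuple sx) (Tuple sy) by [].
pose f i := enum_val (p (enum_rank i)).
have fi : injective f by move=> i j /enum_val_inj /perm_inj /enum_rank_inj.
exists (perm fi) => i; rewrite permE /f.
have tE (z : I -> T) (sz : size (map z (enum I)) == #|I|) (j : 'I_#|I|) : tnth (Tuple sz) j = z (enum_val j).
  rewrite (tnth_nth (z (enum_val j))) /= (nth_map (enum_val j)) -?cardE ?ltn_ord //.
  by rewrite -enum_val_nth.
rewrite -(tE y sy) -[in RHS](enum_rankK i) -(tE x sx).
have -> : Tuple sx = [tuple tnth (Tuple sy) (p i) | i < #|I|] by exact/val_inj/ep.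
by rewrite tnth_mktuple.
Qed.

(** These permutations form a coset of the stabiliser of [x], or the empty set when some fibres
    differ in size. *)
Lemma card_perm_coloring x y :
  #|[set s : {perm I} | [forall i, y (s i) == x i]]%SET| =
  if [forall t, #|fibre x t| == #|fibre y t|] then (\prod_t (#|fibre x t|)`!)%N else 0%N.
Proof.
case: ifP => [/forallP H|/negbT/negP H].
  have [s0 es0] := @ex_perm_coloring x y (fun t => eqP (H t)).
  rewrite -card_stab_coloring.
  have -> : [set s : {perm I} | [forall i, y (s i) == x i]]%SET =
     [set (s * s0)%g | s in [set s : {perm I} | [forall i, x (s i) == x i]]%SET]%SET; last first.
    by rewrite card_imset //; exact: mulIg.
  apply/setP => s; apply/idP/imsetP => [|[s' s'P ->]].
    rewrite inE => /forallP e; exists (s * s0^-1)%g; last by rewrite mulgKV.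
    by rewrite inE; apply/forallP => i; rewrite -es0 permM permKV.
  have /forallP e : [forall i, x (s' i) == x i] by move: s'P; rewrite inE.
  by rewrite inE; apply/forallP => i; rewrite permM es0.
apply/eqP; rewrite cards_eq0; apply/eqP/setP => s; rewrite !inE.
apply/negP => /forallP e; apply: H; apply/forallP => t.
have -> : fibre y t = [set s i | i in fibre x t]%SET; last first.
  by rewrite card_imset //; exact: perm_inj.
apply/esym/setP => i.
apply/imsetP/idP => [[j jP ->]|].
  have /eqP et : x j == t by move: jP; rewrite inE.
  by rewrite inE (eqP (e j)) et.
rewrite inE => /eqP et.
by exists ((s^-1)%g i); rewrite ?permKV // inE -(eqP (e _)) permKV et.
Qed.

End Young.

(** * Unlabelled branch types *)

Section Theta.
Variables (d n : nat) (G : graph n).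
Hypothesis Greg : regular d G.

Lemma regular_card w : #|G w| = d.
Proof. by have /andP[/forallP/(_ w)/andP[_ /eqP]] := Greg. Qed.

Lemma regular_irr w : w \notin G w.
Proof. by have /andP[/forallP/(_ w)/andP[]] := Greg. Qed.

Lemma regular_sym v w : (v \in G w) = (w \in G v).
Proof.
have /andP[_ /forallP H] := Greg.
by apply/idP/idP => h; [have /forallP/(_ v) := H w|have /forallP/(_ w) := H v]; rewrite h.
Qed.

Lemma ThetaP w (th : {ffun 'I_d -> 'I_n}) :
  reflect (injective th /\ forall u, (u \in G w) = (u \in codom th)) (th \in Theta d G w).
Proof.
rewrite inE; apply: (iffP idP) => [pe|[inj e]].
  have u1 : uniq (map th (enum 'I_d)) by rewrite (perm_uniq pe) enum_uniq.
  split; first by apply/injectiveP; rewrite /injectiveb /dinjectiveb.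
  move=> u; rewrite -[LHS]mem_enum -(perm_mem pe); apply/mapP/codomP => [[c _ ->]|[c ->]];
    by exists c; rewrite ?mem_enum.
apply: uniq_perm => [||u]; [by rewrite map_inj_uniq // enum_uniq|exact: enum_uniq|].
by rewrite mem_enum e; apply/mapP/codomP => [[c _ ->]|[c ->]]; exists c; rewrite ?mem_enum.
Qed.

Lemma Theta_mem w th c : th \in Theta d G w -> th c \in G w.
Proof. by move/ThetaP => [_ ->]; exact: codom_f. Qed.

Lemma Theta_surj w th u : th \in Theta d G w -> u \in G w -> exists c, th c = u.
Proof. by move/ThetaP => [_ ->] /codomP[c ->]; exists c. Qed.

Definition perm_th (th : {ffun 'I_d -> 'I_n}) (s : 'S_d) : {ffun 'I_d -> 'I_n} := [ffun c => th (s c)].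

Lemma perm_th_Theta w th s : th \in Theta d G w -> perm_th th s \in Theta d G w.
Proof.
move/ThetaP => [inj e]; apply/ThetaP; split=> [c c'|u].
  by rewrite !ffunE => /inj /perm_inj.
rewrite e; apply/codomP/codomP => [[c ->]|[c ->]]; last by exists (s c); rewrite ffunE.
by exists ((s^-1)%g c); rewrite ffunE permKV.
Qed.

Lemma Theta_ex w : exists th, th \in Theta d G w.
Proof.
have sw : size (enum (G w)) = d by rewrite -cardE regular_card.
exists [ffun c : 'I_d => nth w (enum (G w)) c]; rewrite inE.
rewrite (_ : map _ _ = enum (G w)) //; apply: (@eq_from_nth _ w).
  by rewrite size_map -cardE card_ord.
move=> i; rewrite size_map -cardE card_ord => id.
by rewrite (nth_map (Ordinal id)) -?cardE ?card_ord // ffunE nth_enum_ord.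
Qed.

(** The orderings of the neighbours of [w] form a single free orbit of the symmetric group, which
    reduces counting them to counting permutations. *)
Lemma Theta_imset w th0 : th0 \in Theta d G w ->
  injective (perm_th th0) /\ Theta d G w = [set perm_th th0 s | s : 'S_d]%SET.
Proof.
move=> t0; have [inj0 e0] := ThetaP _ _ t0; split.
  by move=> s s' /ffunP e; apply/permP => c; apply: inj0; have := e c; rewrite !ffunE.
apply/setP => th; apply/idP/imsetP => [t|[s _ ->]]; last exact: perm_th_Theta.
have [inj e] := ThetaP _ _ t.
pose f c := iinv (etrans (esym (e0 (th c))) (Theta_mem c t)).
have fE c : th0 (f c) = th c by rewrite /f f_iinv.
have fi : injective f by move=> c c' /(congr1 th0); rewrite !fE => /inj.
by exists (perm fi) => //; apply/ffunP => c; rewrite ffunE permE fE.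
Qed.

Lemma card_Theta w : #|Theta d G w| = d`!.
Proof.
have [th0 t0] := Theta_ex w; have [inj ->] := Theta_imset t0.
by rewrite card_imset // card_Sn.
Qed.

End Theta.

Section BranchTypes.
Variables (d : nat) (F : finType).

(* Types of depth k branches: the colour of the top vertex and the number of child branches of
   each type.  Children are unordered, so a coloured graph determines its types without any
   labelling of the half-edges. *)
Fixpoint bt k : finType := if k is k'.+1 then (F * {ffun bt k' -> 'I_d.+1})%type else F.

(** Values are bounded by [d] to keep the types finite; [val_mult] shows that [inord] truncates
    nothing when [P] has at most [d] elements. *)
Definition mult (I T : finType) (P : pred I) (h : I -> T) : {ffun T -> 'I_d.+1} :=
  [ffun t => inord #|[pred i | P i && (h i == t)]|].

Lemma val_mult (I T : finType) (P : pred I) (h : I -> T) t : (#|P| <= d)%N ->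
  mult P h t = #|[pred i | P i && (h i == t)]| :> nat.
Proof.
move=> Pd; rewrite ffunE inordK // ltnS; apply: leq_trans Pd.
by apply/subset_leq_card/fintype.subsetP => i /andP[].
Qed.

Fixpoint tree_type k (a : Vd d -> F) p c : bt k :=
  if k is k'.+1 then (a p, mult (predC1 c) (fun c' => tree_type k' a (step p c') c')) else a p.

(* The order of the automorphism group of a branch. *)
Fixpoint zeta k : bt k -> nat :=
  if k is k'.+1 then fun t => (\prod_(u : bt k') (zeta u ^ (t.2 u) * (t.2 u : nat)`!))%N else fun=> 1%N.

Variables (n : nat) (G : graph n).

(** The branch entered from [v] through [w]. Its children are the neighbours of [w] other than [v],
    so this is the type of a branch of the universal cover even if the walks close up in [G]. *)
Fixpoint graph_type k (g : 'I_n -> F) v w : bt k :=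
  if k is k'.+1 then (g w, mult [pred u | (u \in G w) && (u != v)] (graph_type k' g w)) else g w.

Hypothesis Greg : regular d G.

(** Giving [c0] and [v] an extra colour [None] turns the condition [th c0 = v] into part of a
    colour-matching condition, so [card_perm_coloring] applies. *)
Lemma card_matching_stars (T : finType) (x : 'I_d -> T) (y : 'I_n -> T) c0 v w : v \in G w ->
  #|[set th in Theta d G w | (th c0 == v) && [forall c, (c != c0) ==> (y (th c) == x c)]]%SET| =
  if mult (predC1 c0) x == mult [pred u | (u \in G w) && (u != v)] y
  then (\prod_t (mult (predC1 c0) x t : nat)`!)%N else 0%N.
Proof.
move=> vw.
have [th0 t0] := Theta_ex Greg w; have [inj eT] := Theta_imset t0.
have [inj0 e0] := ThetaP _ _ _ t0.
pose x' c := if c == c0 then None else Some (x c).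
pose y' c := if th0 c == v then None else Some (y (th0 c)).
have -> : #|[set th in Theta d G w | (th c0 == v) && [forall c, (c != c0) ==> (y (th c) == x c)]]%SET| =
   #|[set s : 'S_d | [forall c, y' (s c) == x' c]]%SET|.
  rewrite -(card_imset _ inj); congr #|pred_of_set _|; apply/setP => th.
  rewrite inE eT; apply/andP/imsetP => [[/imsetP[s _ ->] /andP[/eqP sv /forallP H]]|[s sP ->]].
    exists s => //; rewrite inE; apply/forallP => c; rewrite /x' /y'.
    have := H c; move: sv; rewrite !ffunE => sv; case: eqP => [->|/eqP cc0 /= /eqP ->].
      by rewrite sv eqxx.
    case: (_ =P v) => [e|_]; last by rewrite eqxx.
    move: cc0; rewrite -sv in e.
    by rewrite (perm_inj (inj0 _ _ e)) eqxx.
  have /forallP H : [forall c, y' (s c) == x' c] by move: sP; rewrite inE.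
  split; first by apply/imsetP; exists s.
  rewrite ffunE; apply/andP; split.
    by have := H c0; rewrite /x' /y' eqxx; case: (_ =P v).
  apply/forallP => c; rewrite ffunE; apply/implyP => cc0.
  by have := H c; rewrite /x' /y' (negbTE cc0); case: (_ =P v) => // _ /eqP[->].
rewrite card_perm_coloring.
have cN : fibre x' None = [set c0]%SET.
  by apply/setP => c; rewrite !inE /x'; case: (c =P c0).
have [cv ecv] := Theta_surj t0 vw.
have cyN : fibre y' None = [set cv]%SET.
  apply/setP => c; rewrite !inE /y' -ecv; case: (th0 c =P th0 cv) => [/inj0 ->|ne]; first by rewrite !eqxx.
  by apply/esym/eqP => e; apply: ne; rewrite e.
have d1 : (#|predC1 c0| <= d)%N by rewrite -[X in (_ <= X)%N]card_ord max_card.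
have d2 : (#|[pred u | (u \in G w) && (u != v)]| <= d)%N.
  rewrite -(regular_card Greg w); apply/subset_leq_card/fintype.subsetP => u /andP[] //.
have mx t : mult (predC1 c0) x t = #|fibre x' (Some t)| :> nat.
  rewrite val_mult //; apply: eq_card => c; rewrite !inE /x' /=.
  by case: (c =P c0).
have my t : mult [pred u | (u \in G w) && (u != v)] y t = #|fibre y' (Some t)| :> nat.
  rewrite val_mult // -(card_imset _ inj0); apply: eq_card => u; rewrite !inE /=.
  apply/andP/imsetP => [[/andP[uw uv] /eqP yu]|[c cP ->]].
    have [c ec] := Theta_surj t0 uw; exists c => //.
    by rewrite inE /y' ec (negbTE uv) yu.
  move: cP; rewrite inE /y'; case: (_ =P v) => // /eqP ne /eqP[->].
  by split=> //; apply/andP; split=> //; exact: Theta_mem t0.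
have -> : [forall t, #|fibre x' t| == #|fibre y' t|] =
   (mult (predC1 c0) x == mult [pred u | (u \in G w) && (u != v)] y).
  apply/forallP/eqP => [H|/ffunP H [t|]]; last by rewrite cN cyN !cards1.
    by apply/ffunP => t; apply: val_inj; rewrite /= mx my (eqP (H (Some t))).
  by rewrite -mx -my H.
case: ifP => // _.
rewrite (bigD1 None) //= cN cards1 mul1n.
rewrite (reindex_onto (fun t : T => Some t) (fun o => odflt (x c0) o)) /=; last by case.
by apply: eq_big => [t|t _]; rewrite ?eqxx // mx.
Qed.

Lemma prod_zeta k c0 (x : 'I_d -> bt k) :
  (\prod_(c | c != c0) zeta (x c) = \prod_(u : bt k) zeta u ^ (mult (predC1 c0) x u))%N.
Proof.
have d1 : (#|predC1 c0| <= d)%N by rewrite -[X in (_ <= X)%N]card_ord max_card.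
rewrite (partition_big x predT) //=; apply: eq_bigr => u _.
rewrite val_mult // -prod_nat_const; apply: eq_big => [c|c /andP[_ /eqP ->] //].
by rewrite !inE.
Qed.

Variable R : comNzRingType.

(** The sum counts isomorphisms between two coloured branches: none if the types differ, otherwise
    as many as there are automorphisms. The factorials of [zeta] come from matching children of
    equal type, its powers from the recursion. *)
Lemma branch_sum_coloring k (g : 'I_n -> F) (a : Vd d -> F) p c0 v w : v \in G w ->
  branch_sum (R := R) G (fun p _ w => (g w == a p)%:R) k p c0 v w =
  ((tree_type k a p c0 == graph_type k g v w) * zeta (tree_type k a p c0))%:R.
Proof.
elim: k p c0 v w => [|k IH] p c0 v w vw; first by rewrite /= mulr1 muln1 eq_sym.
set x := fun c => tree_type k a (step p c) c.
transitivity ((g w == a p)%:R * \sum_(th in Theta d G w | th c0 == v)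
    (\prod_(c | c != c0) ((x c == graph_type k g w (th c)) * zeta (x c))%N)%:R : R).
  rewrite /=; congr (_ * _); apply: eq_bigr => th /andP[t0 _].
  rewrite natr_prod; apply: eq_bigr => c _; apply: IH.
  by rewrite (regular_sym Greg) (Theta_mem _ t0).
rewrite -natr_sum -natrM; congr (_ %:R).
under eq_bigr => th _ do rewrite big_split /=.
rewrite -big_distrl /=.
have -> : (\sum_(th in Theta d G w | th c0 == v) \prod_(c | c != c0) (x c == graph_type k g w (th c)) =
   #|[set th in Theta d G w | (th c0 == v) && [forall c, (c != c0) ==> (graph_type k g w (th c) == x c)]]%SET|)%N.
  rewrite -sum1_card [RHS](eq_bigl (fun th => (th \in Theta d G w) && (th c0 == v) &&
     [forall c, (c != c0) ==> (graph_type k g w (th c) == x c)])); last first.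
    by move=> th; rewrite !inE andbA.
  rewrite [RHS]big_mkcondr /=; apply: eq_bigr => th _.
  case: ifP => [/forallP H|/negbT/forallPn[c]].
    by rewrite big1 // => c cc0; have := H c; rewrite cc0 eq_sym => /= ->.
  by rewrite negb_imply => /andP[cc0 /negbTE ne]; rewrite (bigD1 c) //= eq_sym ne.
rewrite card_matching_stars // prod_zeta.
rewrite [RHS]/= -/x xpair_eqE eq_sym -mulnb -[RHS]mulnA; congr (_ * _)%N.
case: eqP => [e|_] /=; last by rewrite !mul0n.
by rewrite mul1n -big_split /=; apply: eq_bigr => u _; rewrite mulnC.
Qed.

End BranchTypes.

(** * Star types and the frequency of a coloured ball *)

Section StarTypes.
Variables (d : nat) (F : finType) (n : nat) (G : graph n).
Hypothesis Greg : regular d G.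

Lemma Theta_ex_at v w c0 : v \in G w -> exists2 th, th \in Theta d G w & th c0 = v.
Proof.
move=> vw; have [th t0] := Theta_ex Greg w; have [c ec] := Theta_surj t0 vw.
by exists (perm_th th (tperm c0 c)); [exact: perm_th_Theta|rewrite ffunE tpermL].
Qed.

Lemma eq_mult_Theta (T : finType) (x : 'I_d -> T) (y : 'I_n -> T) c0 v w th :
  th \in Theta d G w -> th c0 = v -> (forall c, c != c0 -> y (th c) = x c) ->
  mult d (predC1 c0) x = mult d [pred u | (u \in G w) && (u != v)] y.
Proof.
move=> t0 tv H; apply/ffunP => t; rewrite !ffunE; congr inord.
have [inj e] := ThetaP _ _ _ t0.
rewrite -(card_imset _ inj); apply: eq_card => u; rewrite !inE /=.
apply/imsetP/andP => [[c cP ->]|[/andP[uw uv] /eqP yu]].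
  move: cP; rewrite !inE => /andP[cc0 /eqP xc].
  by rewrite (Theta_mem _ t0) H // xc; split=> //=; rewrite -tv inj_eq.
have [c ec] := Theta_surj t0 uw; exists c => //; rewrite !inE.
have cc0 : c != c0 by apply: contraNneq uv => cc; rewrite -ec cc tv.
by rewrite cc0 /= -yu -ec H.
Qed.

Lemma mult_eq_Theta (T : finType) (x : 'I_d -> T) (y : 'I_n -> T) c0 v w : v \in G w ->
  mult d (predC1 c0) x = mult d [pred u | (u \in G w) && (u != v)] y ->
  exists th, [/\ th \in Theta d G w, th c0 = v & forall c, c != c0 -> y (th c) = x c].
Proof.
move=> vw e; have := card_matching_stars Greg x y c0 vw; rewrite e eqxx => c1.
have : (0 < #|[set th in Theta d G w | (th c0 == v) && [forall c, (c != c0) ==> (y (th c) == x c)]]%SET|)%N.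
  by rewrite c1 prodn_gt0 // => t; exact: fact_gt0.
rewrite card_gt0 => /set0Pn[th]; rewrite inE => /and3P[t0 /eqP tv /forallP H].
by exists th; split=> // c cc0; have := H c; rewrite cc0 => /eqP.
Qed.

(** Equal multiplicities of children yield an ordering that matches the children one by one, and the
    induction hypothesis applies to each pair. *)
Lemma type_lower k (g : 'I_n -> F) (a : Vd d -> F) p c v w : v \in G w ->
  tree_type k.+1 a p c = graph_type d G k.+1 g v w -> tree_type k a p c = graph_type d G k g v w.
Proof.
elim: k p c v w => [|k IH] p c v w vw; first by case.
move=> e; have e1 : a p = g w by case: e.
have e2 := congr1 snd e.
have [th [t0 tv H]] := mult_eq_Theta vw e2.
rewrite [LHS]/= [RHS]/= e1; congr (_, _).
apply: (eq_mult_Theta t0 tv) => c' cc'; symmetry; apply: IH; last exact/esym/H.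
by rewrite (regular_sym Greg) (Theta_mem _ t0).
Qed.

Definition star_type k : finType := (F * {ffun 'I_d -> bt d F k * bt d F k})%type.

Definition tree_star k (a : Vd d -> F) : star_type k :=
  (a (root_ d), [ffun c => (tree_type k a (step (root_ d) c) c, tree_type k a (root_ d) c)]).

Definition graph_star k (g : 'I_n -> F) v (th : {ffun 'I_d -> 'I_n}) : star_type k :=
  (g v, [ffun c => (graph_type d G k g v (th c), graph_type d G k g (th c) v)]).

(** The second components carry no further condition: the branch of the centre seen from a neighbour
    needs the other branches only to depth one less, and the first components determine these by
    [type_lower]. *)
Lemma graph_star_eq k (g : 'I_n -> F) (a : Vd d -> F) v th : th \in Theta d G v ->
  (graph_star k g v th == tree_star k a) = (g v == a (root_ d)) &&
    [forall c, tree_type k a (step (root_ d) c) c == graph_type d G k g v (th c)].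
Proof.
move=> t0; rewrite /graph_star /tree_star xpair_eqE; case: eqP => //= gv.
apply/eqP/forallP => [/ffunP H c|H].
  by have := H c; rewrite !ffunE => -[-> _].
apply/ffunP => c; rewrite !ffunE; congr (_, _); first by rewrite (eqP (H c)).
case: k H => [|k] H; first by rewrite /=.
rewrite [LHS]/= [RHS]/= gv; congr (_, _); symmetry.
apply: (eq_mult_Theta t0) => // c' _; symmetry; apply: type_lower (eqP (H c')).
by rewrite (regular_sym Greg) (Theta_mem _ t0).
Qed.

Definition star_count k (g : 'I_n -> F) (s : star_type k) : nat :=
  (\sum_v #|[set th in Theta d G v | graph_star k g v th == s]%SET|)%N.

(** The number of covers of a branch once the images of its top edge are fixed, as [branch_sum1]
    shows. *)
Fixpoint branch_covers (d k : nat) : nat :=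
  if k is k'.+1 then ((d.-1)`! * branch_covers d k' ^ d.-1)%N else 1%N.

Lemma branch_covers_gt0 k : (0 < branch_covers d k)%N.
Proof. by elim: k => //= k IH; rewrite muln_gt0 fact_gt0 expn_gt0 IH. Qed.

Lemma card_Theta_at v w (c0 : 'I_d) : v \in G w ->
  #|[pred th in Theta d G w | th c0 == v]| = (d.-1)`!.
Proof.
move=> vw; have := card_matching_stars Greg (fun=> tt) (fun=> tt) c0 vw.
have [th t0 tv] := Theta_ex_at c0 vw.
rewrite -(@eq_mult_Theta _ (fun=> tt) (fun=> tt) c0 v w th t0 tv) // [mult _ _ _ == _]eqxx.
rewrite (big_pred1 tt) => [|[]//]; rewrite val_mult; last first.
  by rewrite -[X in (_ <= X)%N]card_ord max_card.
have -> : #|[pred i | predC1 c0 i && (tt == tt)]| = d.-1.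
  rewrite (eq_card (B := predC1 c0)) => [|c]; last by rewrite !inE andbT.
  by rewrite cardC1 card_ord.
move <-; apply: eq_card => th'; rewrite !inE; congr (_ && _).
rewrite [X in _ = _ && X](_ : _ = true) ?andbT //; apply/forallP => c.
by rewrite eqxx implybT.
Qed.

Variable R : realFieldType.

Lemma branch_sum1 k p (c0 : 'I_d) v w : v \in G w ->
  branch_sum (R := R) G (fun _ _ _ => 1) k p c0 v w = (branch_covers d k)%:R.
Proof.
elim: k p c0 v w => [|k IH] p c0 v w vw; first by rewrite /= mulr1.
rewrite /= mul1r (eq_bigr (fun=> (branch_covers d k)%:R ^+ d.-1)) => [|th /andP[t0 _]]; last first.
  rewrite -[X in _ ^+ X.-1]card_ord -(cardC1 c0) -prodr_const; apply: eq_bigr => c _.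
  by rewrite IH // (regular_sym Greg) (Theta_mem _ t0).
by rewrite sumr_const card_Theta_at // natrM natrX mulr_natl.
Qed.

Lemma prod_ball_root (Y : Vd d -> R) r :
  \prod_(q <- ball_root d r) Y q = Y (root_ d) *
    \prod_(p <- ball_root d r | (size (val p) < r)%N) \prod_(c | ~~ back p c) Y (step p c).
Proof.
elim: r => [|r IH].
  by rewrite ball_root0 big_seq1 big_pred0 // mulr1.
rewrite prod_ball_rootS mulrA -IH -prod_sphereS.
rewrite (bigID (fun q => (size (val q) < r.+1)%N)) /= -big_filter.
rewrite (perm_big _ (perm_ball_rootS d r)) /=; congr (_ * _).
rewrite big_seq_cond [RHS]big_seq_cond; apply: eq_bigl => q; rewrite mem_ball_root.
by rewrite -leqNgt [in RHS]eqn_leq andbA andbb.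
Qed.

Variable n0 : 'I_n.

Lemma card_covers k :
  #|@covers d k.+1 n G|%:R = (n * d`! * branch_covers d k ^ d)%:R :> R.
Proof.
have := sum_covers G n0 (fun=> 1) (fun (_ : Vd d) (_ _ : 'I_n) => 1 : R) k.
rewrite (eq_bigr (fun=> 1)) => [|psi _]; last first.
  by rewrite /cover_weight mul1r big1 // => p _; rewrite big1.
rewrite sumr_const => ->.
transitivity (\sum_(v < n) (d`! * branch_covers d k ^ d)%:R : R).
  apply: eq_bigr => v _; rewrite mul1r.
  rewrite (eq_bigr (fun=> (branch_covers d k)%:R ^+ d)) => [|th t0]; last first.
    rewrite -[X in _ ^+ X]card_ord -prodr_const; apply: eq_bigr => c _.
    by rewrite branch_sum1 // (regular_sym Greg) (Theta_mem _ t0).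
  by rewrite sumr_const (card_Theta Greg) natrM natrX mulr_natl.
by rewrite sumr_const card_ord -mulnA [RHS]natrM mulr_natl.
Qed.

(** Covers that pull [g] back to [a] are sorted by the star they show at the root; each star of the
    right type is completed by isomorphisms of the [d] branches. *)
Lemma cover_ball_sum k (g : 'I_n -> F) (a : Vd d -> F) :
  \sum_(psi in @covers d k.+1 n G) \prod_(q <- ball_root d k.+1) (g (look n0 psi q) == a q)%:R =
  (star_count g (tree_star k a) * \prod_c zeta (tree_type k a (step (root_ d) c) c))%:R :> R.
Proof.
have := sum_covers G n0 (fun v => (g v == a (root_ d))%:R)
  (fun p _ w => (g w == a p)%:R : R) k.
rewrite (eq_bigr (fun psi => \prod_(q <- ball_root d k.+1) (g (look n0 psi q) == a q)%:R)); last first.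
  by move=> psi _; rewrite prod_ball_root.
move=> ->; rewrite /star_count big_distrl /= natr_sum; apply: eq_bigr => v _.
rewrite -sum1_card natrM natr_sum mulr_sumr mulr_suml.
rewrite [RHS](eq_bigl (fun th => (th \in Theta d G v) && (graph_star k g v th == tree_star k a))); last first.
  by move=> th; rewrite inE.
rewrite [RHS]big_mkcondr /=; apply: eq_bigr => th t0.
rewrite graph_star_eq //; case: eqP => /= _; last by rewrite mul0r.
rewrite mul1r; transitivity (\prod_c ((tree_type k a (step (root_ d) c) c == graph_type d G k g v (th c)) *
   zeta (tree_type k a (step (root_ d) c) c))%:R : R).
  by apply: eq_bigr => c _; rewrite branch_sum_coloring // (regular_sym Greg) (Theta_mem _ t0).
case: ifP => [/forallP H|/negbT/forallPn[c cP]].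
  by rewrite mul1r natr_prod; apply: eq_bigr => c _; rewrite H mul1n.
by rewrite (bigD1 c) //= (negbTE cP) mul0n mul0r.
Qed.

End StarTypes.

(** * Neighbourhoods of an edge and their coloured covers *)

Section EdgeBall.
Variables (d k : nat) (e : 'I_d).

Definition edge_ball : seq (Vd d) := tball k [:: root_ d; step (root_ d) e].

Lemma head_step_fwd (p : Vd d) c : val p != [::] -> ~~ back p c ->
  head e (val (step p c)) = head e (val p).
Proof. by move=> p0 /val_step_fwd ->; case: (val p) p0. Qed.

Lemma val_step_root (c : 'I_d) : val (step (root_ d) c) = [:: c]. Proof. by []. Qed.

(** A vertex at distance [k+1] from the root lies within [k] of the other end exactly if its
    geodesic from the root begins with [e]. The default of [head] is harmless, since such a word is
    not empty. *)
Lemma mem_edge_ball q : (q \in edge_ball) =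
  (size (val q) <= k)%N || ((size (val q) == k.+1) && (head e (val q) == e)).
Proof.
rewrite mem_tball; apply/asboolP/idP => [[s]|].
  rewrite !inE => /orP[] /eqP -> [l [lk pl <-]].
    have /within_root -> // : Defs.within k [:: root_ d] (last (root_ d) l).
    by exists (root_ d); [rewrite inE|exists l].
  have : (size (val (last (step (root_ d) e) l)) <= (size l).+1)%N /\
    (size (val (last (step (root_ d) e) l)) = (size l).+1 -> head e (val (last (step (root_ d) e) l)) = e).
    elim/last_ind: l pl {lk} => [|l x IH]; first by [].
    rewrite rcons_path last_rcons size_rcons => /andP[/IH[H1 H2] /adjP[c ->]]; split.
      by apply: leq_trans (size_step_le _ _) _.
    case: (boolP (back (last (step (root_ d) e) l) c)) => bc.
      by have := size_step_back bc; lia.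
    rewrite size_step_fwd // => -[sl]; rewrite head_step_fwd ?H2 //.
    by rewrite -size_eq0 sl.
  move=> [H1 H2]; case: leqP => // kl; rewrite orFb.
  have sl : size l = k by apply/eqP; rewrite eqn_leq lk -ltnS (leq_trans kl H1).
  have sq : size (val (last (step (root_ d) e) l)) = k.+1 by apply/eqP; rewrite eqn_leq kl andbT -sl.
  by rewrite sq eqxx H2 ?eqxx // sq sl.
move=> /orP[qk|/andP[/eqP sq /eqP hq]].
  have [s s1 H] := (within_root k q).2 qk; exists s => //.
  by move: s1; rewrite !inE => ->.
exists (step (root_ d) e); first by rewrite !inE eqxx orbT.
elim: k q sq hq => [|k' IH] q sq hq.
  exists [::]; split=> //; apply: val_inj; rewrite [LHS]val_step_root.
  by case: (val q) sq hq => [|x [|]] // _ /= ->.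
have [|c bc] := @back_ex d q; first by rewrite -size_eq0 sq.
have sb := size_step_back bc; rewrite sq in sb; case: sb => /esym sb.
have nb : ~~ back (step q c) c by apply/negP => /size_step_back; rewrite stepK sq sb; lia.
have [|l [lk pl lq]] := IH (step q c) sb.
  rewrite -(head_step_fwd _ nb) ?stepK //.
  by rewrite -size_eq0 sb.
exists (rcons l q); split.
- by rewrite size_rcons.
- by rewrite rcons_path pl lq adj_sym adj_step.
- by rewrite last_rcons.
Qed.

Lemma edge_ball_sub q : q \in edge_ball -> q \in ball_root d k.+1.
Proof. by rewrite mem_edge_ball mem_ball_root => /orP[/leqW//|/andP[/eqP-> _]]. Qed.

Lemma prod_edge_ball (R : comNzRingType) (Y : Vd d -> R) :
  \prod_(q <- edge_ball) Y q = \prod_(q <- ball_root d k.+1) (if q \in edge_ball then Y q else 1).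
Proof.
rewrite -big_mkcond -[RHS]big_filter; apply: perm_big; apply: uniq_perm.
- exact: uniq_tball.
- exact/filter_uniq/uniq_ball_root.
by move=> q; rewrite [RHS]mem_filter; case: (boolP (q \in edge_ball)) => // /edge_ball_sub ->.
Qed.

Variables (F : finType) (n : nat) (G : graph n).
Hypothesis Greg : regular d G.
Variables (R : realFieldType) (g : 'I_n -> F) (z : Vd d -> F).

Let col (p : Vd d) (_ w : 'I_n) : R := (g w == z p)%:R.
(** Vertices outside the edge ball get weight 1, so that the edge statistic becomes a sum over
    covers of the larger ball of radius [k+1]. *)
Let colE (p : Vd d) (v w : 'I_n) : R := if p \in edge_ball then col p v w else 1.

Lemma branch_sum_towards j p c0 v w : (size (val p) + j <= k.+1)%N -> back p c0 ->
  head e (val p) = e -> branch_sum G colE j p c0 v w = branch_sum G col j p c0 v w.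
Proof.
elim: j p c0 v w => [|j IH] p c0 v w pj bp hp.
  by rewrite /= /colE mem_edge_ball hp eqxx andbT orbC -leq_eqVlt -(addn0 (size _)) pj.
rewrite [LHS]/= [RHS]/= {1}/colE mem_edge_ball hp eqxx andbT orbC -leq_eqVlt.
rewrite (leq_trans _ pj) ?leq_addr //; congr (_ * _).
apply: eq_bigr => th _; apply: eq_bigr => c cc0.
have bc : ~~ back p c by rewrite (back_uniq c bp).
apply: IH; rewrite ?back_step //; first by rewrite size_step_fwd // addSnnS.
by rewrite head_step_fwd //; case/andP: bp.
Qed.

(** The number of ways to extend a cover of a branch of depth [j] by one layer. *)
Definition branch_ratio j : R := (branch_covers d j.+1)%:R / (branch_covers d j)%:R.

Lemma branch_covers_neq0 j : (branch_covers d j)%:R != 0 :> R.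
Proof. by rewrite pnatr_eq0 -lt0n branch_covers_gt0. Qed.

Lemma branch_ratioS j : branch_ratio j.+1 = branch_ratio j ^+ d.-1.
Proof.
rewrite /branch_ratio expr_div_n -!natrX /= !natrM.
rewrite -mulf_div divff ?mul1r //.
Qed.

(** A branch not passing through [e] leaves the edge ball one layer before its end; the last layer
    is unconstrained and contributes only its number of extensions. *)
Lemma branch_sum_away j p c0 v w : (size (val p) + j.+1 = k.+1)%N -> back p c0 ->
  head e (val p) != e -> v \in G w ->
  branch_sum G colE j.+1 p c0 v w = branch_sum G col j p c0 v w * branch_ratio j.
Proof.
elim: j p c0 v w => [|j IH] p c0 v w pj bp hp vw.
  have pk : (size (val p) <= k)%N by lia.
  rewrite [LHS]/= {1}/colE mem_edge_ball pk /= mulr1; congr (_ * _).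
  rewrite (eq_bigr (fun=> 1)) => [|th _]; last first.
    rewrite big1 // => c cc0; have bc : ~~ back p c by rewrite (back_uniq c bp).
    have p0 : val p != [::] by case/andP: bp.
    rewrite mulr1 /colE mem_edge_ball size_step_fwd // head_step_fwd //.
    by rewrite (negbTE hp) andbF orbF ifN // -ltnNge; lia.
  rewrite sumr_const card_Theta_at // /branch_ratio /= exp1n muln1 divr1.
  by [].
have pk : (size (val p) <= k)%N by lia.
rewrite [LHS]/= {1}/colE mem_edge_ball pk orTb [RHS]/= -[RHS]mulrA; congr (_ * _).
rewrite mulr_suml; apply: eq_bigr => th /andP[t0 _].
rewrite branch_ratioS -[X in _ ^+ X.-1]card_ord -(cardC1 c0) -prodr_const -big_split /=.
apply: eq_bigr => c cc0.
have bc : ~~ back p c by rewrite (back_uniq c bp).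
have := IH (step p c) c w (th c); rewrite /= => -> //.
- by rewrite -/(val (step p c)) size_step_fwd // addSnnS.
- exact: back_step.
- by rewrite -/(val (step p c)) head_step_fwd //; case/andP: bp.
- by rewrite (regular_sym Greg) (Theta_mem _ t0).
Qed.

Definition edge_count (b : bt d F k * bt d F k) : nat :=
  (\sum_v \sum_(w in G v) ((graph_type d G k g v w, graph_type d G k g w v) == b))%N.

Variable n0 : 'I_n.

(** Sorted by the image of the edge, the sum splits into the branch beyond [e], seen in full, and
    the remaining star at the root, which is the branch of the root seen from its neighbour with one
    free layer added. *)
Lemma cover_edge_sum :
  \sum_(psi in @covers d k.+1 n G) \prod_(q <- edge_ball) (g (look n0 psi q) == z q)%:R =
  branch_ratio k *
  (edge_count (tree_type k z (step (root_ d) e) e, tree_type k z (root_ d) e) *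
   zeta (tree_type k z (step (root_ d) e) e) * zeta (tree_type k z (root_ d) e))%:R :> R.
Proof.
have oE : root_ d \in edge_ball by rewrite mem_edge_ball.
rewrite (eq_bigr (fun psi => cover_weight (fun v => (g v == z (root_ d))%:R) colE k.+1 (look n0 psi))); last first.
  move=> psi _; rewrite prod_edge_ball prod_ball_root oE; congr (_ * _).
rewrite sum_covers.
rewrite /edge_count -mulnA big_distrl /= natr_sum mulr_sumr; apply: eq_bigr => v _.
rewrite big_distrl /= natr_sum mulr_sumr.
rewrite mulr_sumr (partition_big (fun th : {ffun 'I_d -> 'I_n} => th e) (fun w => w \in G v)) /=; last first.
  by move=> th; exact: Theta_mem.
apply: eq_bigr => w wv.
have vw : v \in G w by rewrite (regular_sym Greg).
transitivity (branch_sum G col k (step (root_ d) e) e v w * (branch_sum G col k (root_ d) e w v * branch_ratio k)).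
  transitivity (branch_sum G col k (step (root_ d) e) e v w * ((g v == z (root_ d))%:R *
     \sum_(th in Theta d G v | th e == w) \prod_(c | c != e) branch_sum G colE k (step (root_ d) c) c v (th c))).
    rewrite mulrCA -mulr_sumr; congr (_ * _); rewrite mulr_sumr.
    apply: eq_bigr => th /andP[t0 /eqP te]; rewrite (bigD1 e) //= te; congr (_ * _).
    by rewrite branch_sum_towards //; exact: back_step.
  congr (_ * _).
  have aw th (c : 'I_d) : th \in Theta d G v -> c != e ->
      branch_sum G colE k (step (root_ d) c) c v (th c) =
      (if k is k'.+1 then branch_sum G col k' (step (root_ d) c) c v (th c) * branch_ratio k' else 1).
    move=> t0 ce; case ek : k => [|k'].
      by rewrite /= mulr1 /colE mem_edge_ball ek val_step_root /= (negbTE ce).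
    have := @branch_sum_away k' (step (root_ d) c) c v (th c); rewrite ek => -> //.
    + exact: back_step.
    by rewrite (regular_sym Greg) (Theta_mem _ t0).
  case: (k) aw => [|k'] aw.
    rewrite /= mulr1; congr (_ * _); rewrite (eq_bigr (fun=> 1)) => [|th /andP[t0 _]].
      by rewrite sumr_const card_Theta_at // /branch_ratio /= exp1n muln1 divr1.
    by rewrite big1 // => c ce; rewrite -[RHS](aw _ _ t0 ce).
  rewrite branch_ratioS [branch_sum G col _.+1 _ _ _ _]/= -[RHS]mulrA; congr (_ * _).
  rewrite mulr_suml; apply: eq_bigr => th /andP[t0 _].
  rewrite -[X in _ ^+ X.-1]card_ord -(cardC1 e) -prodr_const -big_split /=.
  by apply: eq_bigr => c ce; exact: aw.
rewrite !(branch_sum_coloring Greg) // mulrA mulrC; congr (_ * _).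
rewrite -natrM; congr (_ %:R).
rewrite xpair_eqE -mulnb ![graph_type _ _ _ _ _ _ == _]eq_sym; lia.
Qed.

End EdgeBall.

Local Open Scope nat_scope.

(** * Counting regular graphs *)

Lemma leq_sum_inj (I J : finType) (P : pred I) (Q : pred J) (h : I -> J) (f : J -> nat) :
  {in P &, injective h} -> (forall i, P i -> Q (h i)) ->
  \sum_(i | P i) f (h i) <= \sum_(j | Q j) f j.
Proof.
move=> inj PQ; rewrite -(big_imset f inj) /= [leqRHS]big_mkcond [leqLHS]big_mkcond.
apply: leq_sum => j _; case: ifP => // /imsetP[i Pi ->].
by rewrite PQ.
Qed.

Section SimpleGraphs.
Variables (d n : nat).
Implicit Types (G : graph n) (u v w z x y : 'I_n).

Definition simple G := [forall u, u \notin G u] && [forall u, forall v, (v \in G u) ==> (u \in G v)].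

Lemma simpleP G : reflect ((forall u, u \notin G u) /\ (forall u v, (v \in G u) = (u \in G v))) (simple G).
Proof.
apply: (iffP andP) => [[/forallP H1 /forallP H2]|[H1 H2]]; split=> //.
- move=> u v; apply/idP/idP => h.
    by have /forallP/(_ v) := H2 u; rewrite h.
  by have /forallP/(_ u) := H2 v; rewrite h.
- exact/forallP.
by apply/forallP => u; apply/forallP => v; rewrite H2 implybb.
Qed.

Definition is_edge u v x y := ((x == u) && (y == v)) || ((x == v) && (y == u)).
Definition add_edge G u v : graph n := [ffun x => [set y | (y \in G x) || is_edge u v x y]%SET].
Definition del_edge G u v : graph n := [ffun x => [set y | (y \in G x) && ~~ is_edge u v x y]%SET].

Lemma is_edge_sym u v x y : is_edge u v x y = is_edge u v y x.
Proof. by rewrite /is_edge orbC [X in _ || X]andbC [X in X || _]andbC. Qed.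

Lemma in_add G u v x y : (y \in add_edge G u v x) = (y \in G x) || is_edge u v x y.
Proof. by rewrite ffunE inE. Qed.

Lemma in_del G u v x y : (y \in del_edge G u v x) = (y \in G x) && ~~ is_edge u v x y.
Proof. by rewrite ffunE inE. Qed.

Lemma simple_add G u v : simple G -> u != v -> simple (add_edge G u v).
Proof.
move=> /simpleP[H1 H2] uv; apply/simpleP; split=> [x|x y].
  rewrite in_add (negbTE (H1 x)) orFb /is_edge.
  by apply/negP => /orP[]/andP[/eqP -> /eqP e]; move: uv; rewrite e eqxx.
by rewrite !in_add H2 is_edge_sym.
Qed.

Lemma simple_del G u v : simple G -> simple (del_edge G u v).
Proof.
move=> /simpleP[H1 H2]; apply/simpleP; split=> [x|x y].
  by rewrite in_del (negbTE (H1 x)).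
by rewrite !in_del H2 is_edge_sym.
Qed.

Lemma add_edgeK G u v : simple G -> v \notin G u -> del_edge (add_edge G u v) u v = G.
Proof.
move=> /simpleP[H1 H2] vu; apply/ffunP => x; apply/setP => y; rewrite in_del in_add.
case: (boolP (is_edge u v x y)); rewrite ?andbT ?orbF //= andbF {1}/is_edge => /orP[]/andP[/eqP -> /eqP ->].
  by rewrite (negbTE vu).
by rewrite H2 (negbTE vu).
Qed.

Lemma del_edgeK G u v : simple G -> v \in G u -> add_edge (del_edge G u v) u v = G.
Proof.
move=> /simpleP[H1 H2] vu; apply/ffunP => x; apply/setP => y; rewrite in_add in_del.
case: (boolP (is_edge u v x y)); rewrite ?andbT ?orbF //= andbF /= {1}/is_edge => /orP[]/andP[/eqP -> /eqP ->].
  by rewrite vu.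
by rewrite H2 vu.
Qed.

Lemma deg_add G u v x : simple G -> u != v -> v \notin G u ->
  #|add_edge G u v x| = #|G x| + (x == u) + (x == v).
Proof.
move=> /simpleP[H1 H2] uv vu.
case: (x =P u) => [->|/eqP xu]; case: (_ =P v) => [e|/eqP xv].
- by move: uv; rewrite e eqxx.
- have -> : add_edge G u v u = (v |: G u)%SET.
    by apply/setP => y; rewrite in_add !inE /is_edge eqxx (negbTE uv) orbF orbC.
  by rewrite cardsU1 vu addnC addn0.
- rewrite e; have -> : add_edge G u v v = (u |: G v)%SET.
    by apply/setP => y; rewrite in_add !inE /is_edge eqxx eq_sym (negbTE uv) orbC.
  by rewrite cardsU1 H2 (negbTE vu) addnC addn0.
have -> : add_edge G u v x = G x.
  by apply/setP => y; rewrite in_add /is_edge (negbTE xu) (negbTE xv) orbF.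
by rewrite !addn0.
Qed.

Lemma deg_del G u v x : simple G -> v \in G u ->
  #|del_edge G u v x| + (x == u) + (x == v) = #|G x|.
Proof.
move=> sG vu; have /simpleP[H1 H2] := sG.
have uv : u != v by apply: contraTneq vu => ->; exact: H1.
rewrite -(@deg_add (del_edge G u v)) ?del_edgeK //; first exact: simple_del.
by rewrite in_del vu /is_edge !eqxx.
Qed.

(** Union bound: at most [c * d] arcs start in [A] and at most [c * d] end in [B]. *)
Lemma arcs_avoid G (A B : {set 'I_n}) c (E0 : {set 'I_n * 'I_n}) : simple G ->
  (forall x, #|G x| <= d) -> #|A| <= c -> #|B| <= c ->
  \sum_x #|G x| <= #|[set p : 'I_n * 'I_n | [&& p.2 \in G p.1, p.1 \notin A, p.2 \notin B & p \notin E0]]%SET|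
     + c * d + c * d + #|E0|.
Proof.
move=> /simpleP[H1 H2] Hd cA cB.
pose Ar := [set p : 'I_n * 'I_n | p.2 \in G p.1]%SET.
have eA : \sum_x #|G x| = #|Ar|.
  rewrite -sum1_card (eq_bigl (fun p => xpredT p.1 && (p.2 \in G p.1))); last by move=> p; rewrite inE.
  by rewrite -(pair_big_dep xpredT (fun x y => y \in G x) (fun _ _ => 1)) /=; apply: eq_bigr => x _; rewrite sum1_card.
have bA : #|[set p in Ar | p.1 \in A]%SET| <= c * d.
  rewrite -sum1_card (eq_bigl (fun p => (p.1 \in A) && (p.2 \in G p.1))); last by move=> p; rewrite !inE andbC.
  rewrite -(pair_big_dep (fun x => x \in A) (fun x y => y \in G x) (fun _ _ => 1)) /=.
  apply: leq_trans (_ : \sum_(x in A) d <= _); last by rewrite sum_nat_const leq_mul2r cA orbT.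
  by apply: leq_sum => x _; rewrite sum1_card.
have bB : #|[set p in Ar | p.2 \in B]%SET| <= c * d.
  have -> : #|[set p in Ar | p.2 \in B]%SET| = #|[set p in Ar | p.1 \in B]%SET|.
    pose sw (p : 'I_n * 'I_n) := (p.2, p.1).
    have swI : injective sw by move=> [? ?] [? ?] [-> ->].
    rewrite -(card_imset _ swI); apply: eq_card => p.
    apply/imsetP/idP => [[q qP ->]|].
      by move: qP; rewrite !inE /= H2.
    rewrite !inE => /andP[pA pB].
    by exists (sw p); [rewrite !inE /= H2 pA pB|case: (p)].
  rewrite -sum1_card (eq_bigl (fun p => (p.1 \in B) && (p.2 \in G p.1))); last by move=> p; rewrite !inE andbC.
  rewrite -(pair_big_dep (fun x => x \in B) (fun x y => y \in G x) (fun _ _ => 1)) /=.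
  apply: leq_trans (_ : \sum_(x in B) d <= _); last by rewrite sum_nat_const leq_mul2r cB orbT.
  by apply: leq_sum => x _; rewrite sum1_card.
rewrite eA.
set S := [set p | _]%SET.
have sub : Ar \subset (S :|: [set p in Ar | p.1 \in A] :|: [set p in Ar | p.2 \in B] :|: E0)%SET.
  apply/fintype.subsetP => p; rewrite !inE => -> /=.
  by case: (p.1 \in A) => //=; case: (p.2 \in B); rewrite ?orbT //=; case: (p \in E0); rewrite ?orbT.
apply: leq_trans (subset_leq_card sub) _.
apply: leq_trans (leq_card_setU _ _) _; rewrite leq_add2r.
apply: leq_trans (leq_card_setU _ _) _; apply: leq_add => //.
by apply: leq_trans (leq_card_setU _ _) _; apply: leq_add.
Qed.

(* [deg_weight G] counts the partial labellings of the half-edges of G by 'I_d; with it the number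
   of graphs with j half-edges grows as in the configuration model. *)
Definition degsum G := \sum_x #|G x|.
Definition subregular j G := [&& simple G, [forall x, #|G x| <= d] & degsum G == j].
Definition deg_weight G := \prod_x d ^_ #|G x|.
Definition weighted_count j := \sum_(G | subregular j G) deg_weight G.

Lemma sum_deltaE (x : 'I_n) : \sum_y (y == x) = 1.
Proof. by rewrite (bigD1 x) //= eqxx big1 ?addn0 // => y /negbTE ->. Qed.

Lemma sum_defect j G : subregular j G -> \sum_x (d - #|G x|) = d * n - j.
Proof.
move=> /and3P[_ /forallP Hd /eqP <-].
have : \sum_x (d - #|G x|) + degsum G = d * n.
  rewrite -big_split /= (eq_bigr (fun=> d)) => [|x _]; last by rewrite subnK.
  by rewrite sum_nat_const card_ord mulnC.
by move=> <-; rewrite addnK.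
Qed.

Lemma subregular_add j G u v : subregular j G -> u != v -> v \notin G u ->
  #|G u| < d -> #|G v| < d -> subregular (j + 2) (add_edge G u v).
Proof.
move=> /and3P[sG /forallP Hd /eqP ej] uv vu du dv; apply/and3P; split.
- exact: simple_add.
- apply/forallP => x; rewrite deg_add //.
  case: (x =P u) => [->|_]; last by case: (x =P v) => [->|_]; rewrite ?addn0 // addn1.
  by rewrite (negbTE uv) addn0 addn1.
rewrite /degsum (eq_bigr (fun x => #|G x| + (x == u) + (x == v))) => [|x _]; last exact: deg_add.
by rewrite !big_split /= !sum_deltaE -/(degsum G) ej -addnA.
Qed.

Lemma deg_weight_add G u v : simple G -> u != v -> v \notin G u ->
  deg_weight (add_edge G u v) = deg_weight G * ((d - #|G u|) * (d - #|G v|)).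
Proof.
move=> sG uv vu; rewrite /deg_weight (bigD1 u) //= (bigD1 v) 1?eq_sym //=.
rewrite [in RHS](bigD1 u) //= [in RHS](bigD1 v) 1?eq_sym //=.
rewrite !deg_add // !eqxx (negbTE uv) eq_sym (negbTE uv) !addn0 !addn1 !ffactnSr.
rewrite (eq_bigr (fun x => d ^_ #|G x|)) => [|x /andP[xu xv]].
  by move: (d - #|G u|) (d - #|G v|) (d ^_ _) (d ^_ _) (\prod_(_ | _) _) => a b c e f; ring.
by rewrite deg_add // (negbTE xu) (negbTE xv) !addn0.
Qed.

(** Double counting of the insertion of one ordered edge. Joining [u] to [v] multiplies the weight
    by the number of pairs of free half-edges there; for fixed [u] at most [(d+1) d] free half-edges
    are lost at [u] and its neighbours. Each result has [j + 2] ordered edges to remove. *)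
Lemma weighted_count_step j :
  (d * n - j) * (d * n - j - d.+1 * d) * weighted_count j <= (j + 2) * weighted_count (j + 2).
Proof.
pose P (x : graph n * ('I_n * 'I_n)) := [&& subregular j x.1, x.2.1 != x.2.2, x.2.2 \notin x.1 x.2.1,
   #|x.1 x.2.1| < d & #|x.1 x.2.2| < d].
pose Q (x : graph n * ('I_n * 'I_n)) := subregular (j + 2) x.1 && (x.2.2 \in x.1 x.2.1).
pose h (x : graph n * ('I_n * 'I_n)) := (add_edge x.1 x.2.1 x.2.2, x.2).
have := @leq_sum_inj _ _ P Q h (fun t => deg_weight t.1) _ _.
have hinj : {in P &, injective h}.
  move=> [G [u v]] [G' [u' v']] /and5P[/= /and3P[s1 _ _] _ nu _ _] /and5P[/= /and3P[s2 _ _] _ nu' _ _] [e eu ev].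
  subst u' v'; congr (_, _).
  by rewrite -(add_edgeK s1 nu) e (add_edgeK s2 nu').
have hPQ i : P i -> Q (h i).
  case: i => G [u v] /and5P[/= H1 H2 H3 H4 H5]; rewrite /Q /= subregular_add //=.
  by rewrite in_add /is_edge !eqxx orbT.
move=> /(_ hinj hPQ) H.
have L2 : \sum_(t | Q t) deg_weight t.1 <= (j + 2) * weighted_count (j + 2).
  rewrite -(pair_big_dep (subregular (j + 2)) (fun G p => p.2 \in G p.1) (fun G p => deg_weight G)) /=.
  rewrite /weighted_count big_distrr /=; apply: leq_sum => G /and3P[_ _ /eqP <-].
  rewrite sum_nat_const leq_mul2r; apply/orP; right.
  rewrite /degsum -sum1_card -(pair_big_dep xpredT (fun x y => y \in G x) (fun _ _ => 1)) /=.
  by apply: leq_sum => x _; rewrite sum1_card.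
apply: leq_trans (leq_trans H L2).
rewrite /weighted_count big_distrr /=.
  rewrite (eq_bigl (fun t : graph n * ('I_n * 'I_n) => subregular j t.1 && [&& t.2.1 != t.2.2, t.2.2 \notin t.1 t.2.1,
     #|t.1 t.2.1| < d & #|t.1 t.2.2| < d])); last by [].
  rewrite -(pair_big_dep (subregular j) (fun G p => [&& p.1 != p.2, p.2 \notin G p.1, #|G p.1| < d & #|G p.2| < d])
     (fun G p => deg_weight (add_edge G p.1 p.2))) /=.
  apply: leq_sum => G sr; have /and3P[sG /forallP Hd _] := sr.
  rewrite (eq_bigr (fun p => deg_weight G * ((d - #|G p.1|) * (d - #|G p.2|)))); last first.
    by move=> p /and4P[p1 p2 _ _]; rewrite deg_weight_add.
  rewrite -big_distrr /= mulnC leq_mul2l; apply/orP; right.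
  rewrite -(sum_defect sr).
  have e1 : \sum_(p : 'I_n * 'I_n | [&& p.1 != p.2, p.2 \notin G p.1, #|G p.1| < d & #|G p.2| < d])
      (d - #|G p.1|) * (d - #|G p.2|) =
     \sum_u \sum_(v | (u != v) && (v \notin G u)) (d - #|G u|) * (d - #|G v|).
    rewrite pair_big_dep /= [RHS](bigID (fun p => (#|G p.1| < d) && (#|G p.2| < d))) /=.
    rewrite [X in _ = _ + X]big1 ?addn0 => [|p]; last first.
      rewrite negb_and -!leqNgt => /andP[_ /orP[]]; rewrite -subn_eq0 => /eqP ->; first by rewrite mul0n.
      by rewrite muln0.
    by apply: eq_bigl => p; rewrite -!andbA.
  rewrite e1 big_distrl /=; apply: leq_sum => u _; rewrite -big_distrr /= leq_mul2l; apply/orP; right.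
  rewrite leq_subLR [leqLHS](bigID (fun v => (u != v) && (v \notin G u))) /= addnC leq_add2r.
  apply: leq_trans (_ : \sum_(v in (u |: G u)%SET) d <= _).
    rewrite [leqRHS]big_mkcond [leqLHS]big_mkcond; apply: leq_sum => v _.
    rewrite !inE negb_and !negbK eq_sym; case: ifP => // _; exact: leq_subr.
  rewrite sum_nat_const leq_mul2r; apply/orP; right.
  by apply: leq_trans (leq_card_setU _ _) _; rewrite cards1 add1n ltnS.
Qed.

End SimpleGraphs.

Lemma leq_ffact2l d k m : k <= m <= d -> d ^_ k <= d ^_ m.
Proof.
move=> /andP[km md]; elim: m km md => [|m IH]; first by rewrite leqn0 => /eqP ->.
rewrite leq_eqVlt => /orP[/eqP -> //|]; rewrite ltnS => km md.
apply: leq_trans (IH km (ltnW md)) _.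
by rewrite ffactnSr leq_pmulr // subn_gt0.
Qed.

(** * Edge switchings and a lower bound for the number of regular graphs *)

Section Switching.
Variables (d n : nat).
Implicit Types (G : graph n) (u v w z x y : 'I_n).

Lemma regularP G : reflect (simple G /\ forall x, #|G x| = d) (regular d G).
Proof.
apply: (iffP andP) => [[/forallP H1 H2]|[/andP[/forallP H1 H2] Hd]].
  split; last by move=> x; have /andP[_ /eqP] := H1 x.
  by apply/andP; split=> //; apply/forallP => x; have /andP[] := H1 x.
by split=> //; apply/forallP => x; rewrite H1 Hd eqxx.
Qed.

(* Used to raise the degrees of u and v by one when they cannot be joined directly. *)
Definition join_through G u v z w := add_edge (add_edge (del_edge G z w) u z) v w.

Section Join.
Variables (G : graph n) (u v z w : 'I_n).
Hypotheses (sG : simple G) (zw : w \in G z) (zu : z \notin (u |: G u)%SET) (wv : w \notin (v |: G v)%SET).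

Let zu1 : u != z. Proof. by move: zu; rewrite !inE negb_or eq_sym => /andP[]. Qed.
Let zu2 : z \notin del_edge G z w u.
Proof. by rewrite in_del negb_and; move: zu; rewrite !inE negb_or => /andP[_ ->]. Qed.
Let wv1 : v != w. Proof. by move: wv; rewrite !inE negb_or eq_sym => /andP[]. Qed.
Let wv2 : w \notin add_edge (del_edge G z w) u z v.
Proof.
have /simpleP[H1 H2] := sG.
rewrite in_add in_del negb_or negb_and; apply/andP; split.
  by move: wv; rewrite !inE negb_or => /andP[_ ->].
rewrite /is_edge; apply/negP => /orP[]/andP[/eqP e1 /eqP e2].
  by move: zw; rewrite e2 (negbTE (H1 _)).
by move: zu; rewrite !inE negb_or H2 -e2 zw andbF.
Qed.

Lemma simple_join : simple (join_through G u v z w).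
Proof. by do 2![apply: simple_add => //]; exact: simple_del. Qed.

Lemma deg_join x : #|join_through G u v z w x| = #|G x| + (x == u) + (x == v).
Proof.
rewrite deg_add //; last by apply: simple_add => //; exact: simple_del.
rewrite deg_add //; last exact: simple_del.
have := deg_del x sG zw; lia.
Qed.

Lemma join_throughK : add_edge (del_edge (del_edge (join_through G u v z w) v w) u z) z w = G.
Proof.
rewrite add_edgeK //; last by apply: simple_add => //; exact: simple_del.
by rewrite add_edgeK ?del_edgeK //; exact: simple_del.
Qed.

Lemma in_join x y : y \in G x -> ~~ is_edge z w x y -> y \in join_through G u v z w x.
Proof. by move=> h1 h2; rewrite !in_add in_del h1 h2. Qed.

Lemma join_mem : (z \in join_through G u v z w u) && (w \in join_through G u v z w v).
Proof. by rewrite !in_add /is_edge !eqxx /= ?orbT. Qed.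

End Join.

(** When few half-edges are free, [weighted_count_step] says nothing, as they may sit at one vertex
    or at adjacent vertices. Rerouting an existing edge [zw] to [uz] and [vw] still uses up two of
    them; the four vertices make the step reversible, which costs [n ^ 4]. *)
Lemma weighted_count_completion j : 2 <= d * n - j -> d.+1 * d + d.+1 * d < j ->
  weighted_count d n j <= n ^ 4 * weighted_count d n (j + 2).
Proof.
move=> m2 jd.
pose T := ('I_n * 'I_n * ('I_n * 'I_n))%type.
pose ok G (t : T) := [&& t.2.2 \in G t.2.1, t.2.1 \notin (t.1.1 |: G t.1.1)%SET,
   t.2.2 \notin (t.1.2 |: G t.1.2)%SET & [forall x, #|G x| + (x == t.1.1) + (x == t.1.2) <= d]].
pose jn (s : graph n * T) := join_through s.1 s.2.1.1 s.2.1.2 s.2.2.1 s.2.2.2.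
pose P (s : graph n * T) := subregular d j s.1 && ok s.1 s.2.
pose Q (s : graph n * T) := subregular d (j + 2) s.1 && true.
have ex G : subregular d j G -> exists t, ok G t.
  move=> sr; have /and3P[sG /forallP Hd /eqP dj] := sr.
  have [u [v uv]] : exists u v, forall x, #|G x| + (x == u) + (x == v) <= d.
    have sd := sum_defect sr.
    have [u du] : exists u, 0 < d - #|G u|.
      apply/existsP; apply: contraLR m2 => /existsPn H; rewrite -sd big1 // => x _.
      by apply/eqP; have := H x; rewrite lt0n negbK.
    (* A vertex with two free half-edges serves as both [u] and [v]; otherwise a second deficient
       vertex must exist. *)
    case: (ltnP 1 (d - #|G u|)) => du2.
      exists u, u => x; case: eqP => [->|_]; rewrite ?addn0 ?addn1 //.
      by move: du2; rewrite ltn_subRL; lia.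
    have [v /andP[vu dv]] : exists v, (v != u) && (0 < d - #|G v|).
      apply/existsP; apply: contraLR m2 => /existsPn H; rewrite -sd (bigD1 u) //= big1 ?addn0 -?leqNgt //.
      by move=> x xu; apply/eqP; have := H x; rewrite xu /= lt0n negbK.
    exists u, v => x; case: (x =P u) => [->|_].
      by rewrite eq_sym (negbTE vu) addn0 addn1 -subn_gt0.
    by case: (x =P v) => [->|_]; rewrite ?addn0 // addn1 -subn_gt0.
  have cN x : #|(x |: G x)%SET| <= d.+1.
    by apply: leq_trans (leq_card_setU _ _) _; rewrite cards1 add1n ltnS.
  have := @arcs_avoid d n G (u |: G u)%SET (v |: G v)%SET d.+1 finset.set0 sG Hd (cN u) (cN v).
  rewrite -/(degsum G) dj cards0 addn0 -addnA => H.
  move: H; set S := #|_| => H; have : 0 < S by move: H jd; clearbody S; lia.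
  rewrite /S {S H}.
  rewrite card_gt0 => /set0Pn[[z w]]; rewrite inE /= => /and4P[h1 h2 h3 _].
  exists (u, v, (z, w)); rewrite /ok /=; apply/and4P; split=> //; exact/forallP.
have jinj : {in P &, injective (fun s => (jn s, s.2))}.
  move=> [G [[u v] [z w]]] [G' t'] /andP[/= /and3P[s1 _ _] /and4P[/= a1 a2 a3 _]].
  move=> /andP[/= /and3P[s2 _ _] ok'] [e et]; subst t'; case/and4P: ok' => /= b1 b2 b3 _.
  congr (_, _); rewrite -(join_throughK s1 a1 a2 a3) -(join_throughK s2 b1 b2 b3).
  by move: e; rewrite /jn /= => ->.
have jdeg G t : subregular d j G -> ok G t ->
    subregular d (j + 2) (jn (G, t)) /\ deg_weight d G <= deg_weight d (jn (G, t)).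
  case: t => [[u v] [z w]] /and3P[sG Hd /eqP dj] /and4P[/= a1 a2 a3 /forallP a4]; split.
    apply/and3P; split; first exact: simple_join.
      by apply/forallP => x; rewrite deg_join.
    rewrite /degsum (eq_bigr (fun x => #|G x| + (x == u) + (x == v))) => [|x _]; last exact: deg_join.
    by rewrite !big_split /= !sum_deltaE -/(degsum G) dj -addnA.
  apply: leq_prod => x _; apply: leq_ffact2l; rewrite deg_join // a4 andbT.
  by rewrite -addnA leq_addr.
have H := @leq_sum_inj _ _ P Q (fun s => (jn s, s.2)) (fun s => deg_weight d s.1) jinj _.
have L2 : \sum_(s | Q s) deg_weight d s.1 <= n ^ 4 * weighted_count d n (j + 2).
  rewrite -(pair_big_dep (subregular d (j + 2)) (fun _ _ => true) (fun G (_ : T) => deg_weight d G)) /=.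
  rewrite /weighted_count big_distrr /=; apply: leq_sum => G _.
  rewrite sum_nat_const leq_mul2r; apply/orP; right.
  by rewrite cardT -cardE !card_prod card_ord; apply: eq_leq; rewrite !expnS expn0; ring.
apply: leq_trans (leq_trans (H _) L2); last first.
  by move=> [G t] /andP[/= sr okt]; rewrite /Q /= andbT; have [] := jdeg G t sr okt.
rewrite -(pair_big_dep (subregular d j) ok (fun G t => deg_weight d (jn (G, t)))) /=.
apply: leq_sum => G sr; have [t okt] := ex G sr.
by rewrite (bigD1 t) //=; apply: leq_trans (leq_addr _ _); have [] := jdeg G t sr okt.
Qed.

Lemma weighted_count_regular : weighted_count d n (d * n) = (d`!) ^ n * #|[pred G : graph n | regular d G]|.
Proof.
rewrite /weighted_count [RHS]mulnC -sum_nat_const [LHS](eq_bigl (fun G : graph n => regular d G)); last first.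
  move=> G; apply/and3P/regularP => [[sG /forallP Hd /eqP e]|[sG Hd]].
    split=> // x; apply/eqP; rewrite eqn_leq Hd leqNgt; apply/negP => lx.
    have : degsum G < d * n.
      have -> : d * n = \sum_(x < n) d by rewrite sum_nat_const card_ord mulnC.
      rewrite /degsum (bigD1 x) //= [in X in _ < X](bigD1 x) //= -addSn.
      by apply: leq_add => //; apply: leq_sum => y _; exact: Hd.
    by rewrite e ltnn.
  split=> //; first by apply/forallP => x; rewrite Hd.
  by rewrite /degsum (eq_bigr (fun=> d)) // sum_nat_const card_ord mulnC.
apply: eq_bigr => G /regularP[_ Hd].
rewrite /deg_weight (eq_bigr (fun=> d`!)) => [|x _]; last by rewrite Hd ffactnn.
by rewrite prod_nat_const card_ord.
Qed.

Lemma weighted_count0 : weighted_count d n 0 = 1.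
Proof.
rewrite /weighted_count (big_pred1 ([ffun=> finset.set0] : graph n)) => [|G].
  by rewrite /deg_weight big1 // => x _; rewrite ffunE cards0 ffactn0.
apply/and3P/eqP => [[_ _]|->].
  rewrite sum_nat_eq0 => /forallP H; apply/ffunP => x; rewrite ffunE.
  by apply/eqP; rewrite -cards_eq0; exact: H.
split.
- by apply/simpleP; split=> [u|u v]; rewrite !ffunE !inE.
- by apply/forallP => x; rewrite ffunE cards0.
by rewrite sum_nat_eq0; apply/forallP => x; rewrite ffunE cards0.
Qed.

(** The falling factorial counts ordered choices of [2e] half-edges in the configuration model.
    While at least [L] half-edges are free, inserting an edge loses at most a factor [(q+1)/q];
    afterwards [weighted_count_completion] is used and each step may lose [L^2 n^4] more. The
    truncated exponent is 0 during the first phase and never exceeds [L]. *)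
Lemma ffact_weighted_count q L e : 0 < q -> d.+1 * d * q.+1 < L ->
  d.+1 * d + d.+1 * d + L < d * n -> 2 * e <= d * n -> ~~ odd (d * n) ->
  q ^ e * (d * n) ^_ (2 * e) <=
  q.+1 ^ e * (L ^ 2 * n ^ 4) ^ (L - (d * n - 2 * e)) * (2 ^ e * e`! * weighted_count d n (2 * e)).
Proof.
move=> q0 cL nL.
have n0 : 0 < n by move: nL; case: (n) => //; rewrite muln0.
have L0 : 0 < L by apply: leq_ltn_trans cL.
elim: e => [|e IH] eM od.
  by rewrite muln0 ffactn0 weighted_count0 subn0 (eqP (_ : L - d * n == 0)) // subn_eq0; lia.
have {IH} := IH (leq_trans _ eM) od; rewrite leq_mul2l leqnSn orbT => /(_ isT) IH.
set m := d * n - 2 * e in IH *.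
have m2 : 2 <= m by rewrite /m; lia.
have em : d * n - 2 * e.+1 = m - 2 by rewrite /m; lia.
rewrite em.
have -> : (d * n) ^_ (2 * e.+1) = (d * n) ^_ (2 * e) * (m * (m - 1)).
  by rewrite mulnS addnC addn2 !ffactnSr -mulnA /m subnS subn1.
have ee : 2 * e.+1 = 2 * e + 2 by lia.
set A := weighted_count d n (2 * e) in IH *; set B := weighted_count d n (2 * e.+1).
set K := L ^ 2 * n ^ 4 in IH *.
have K0 : 0 < K by rewrite muln_gt0 !expn_gt0 L0 n0.
have step1 : m * (m - d.+1 * d) * A <= (2 * e.+1) * B.
  by have := @weighted_count_step d n (2 * e); rewrite -/m -/A /B ee.
have cB : 2 ^ e.+1 * e.+1`! * B = 2 ^ e * e`! * ((2 * e.+1) * B).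
  by rewrite expnS factS; move: (2 ^ e) (e`!) => a b; ring.
rewrite cB.
set f := (d * n) ^_ (2 * e) in IH *.
set D := 2 ^ e * e`! in IH *.
have IHm : L - m <= L - (m - 2) by rewrite leq_sub2l // leq_subr.
case: (leqP L m) => Lm.
  have s1 : q * (m * (m - 1)) <= q.+1 * (m * (m - d.+1 * d)).
    have : q * (m - 1) <= q.+1 * (m - d.+1 * d).
      rewrite mulnBr mulnBr; have : q.+1 * (d.+1 * d) < m by apply: leq_trans Lm; rewrite mulnC.
      rewrite !mulSn; lia.
    by move=> h; rewrite mulnCA [leqRHS]mulnCA leq_mul2l h orbT.
  apply: leq_trans (_ : (q ^ e * f) * (q.+1 * (m * (m - d.+1 * d))) <= _).
    rewrite expnS; apply: leq_trans (_ : q ^ e * f * (q * (m * (m - 1))) <= _).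
      by move: (q ^ e) (m * (m - 1)) => a b; apply/eq_leq; ring.
    by rewrite leq_mul2l s1 orbT.
  apply: leq_trans (leq_mul IH (leqnn _)) _.
  rewrite (eqP (_ : L - m == 0)) ?subn_eq0 // expn0 muln1 expnS.
  apply: leq_trans (_ : q.+1 * q.+1 ^ e * 1 * (D * (2 * e.+1 * B)) <= _); last first.
    by rewrite leq_mul2r leq_mul2l expn_gt0 K0 !orbT.
  rewrite muln1; apply: leq_trans (_ : q.+1 * q.+1 ^ e * (D * (m * (m - d.+1 * d) * A)) <= _).
    by move: (q.+1 ^ e) (m * (m - _)) => a b; apply/eq_leq; ring.
  by rewrite !leq_mul2l step1 !orbT.
have step2 : A <= n ^ 4 * B.
  rewrite /A /B ee; apply: weighted_count_completion; first by rewrite -/m.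
  by move: Lm; rewrite /m; lia.
have mL : m * (m - 1) <= L ^ 2.
  by rewrite -mulnn; apply: leq_mul; [exact: ltnW|apply: leq_trans (leq_subr _ _) (ltnW Lm)].
apply: leq_trans (_ : (q ^ e * f) * (q.+1 * L ^ 2) <= _).
  rewrite expnS; apply: leq_trans (_ : q ^ e * f * (q * (m * (m - 1))) <= _).
    by move: (q ^ e) (m * (m - 1)) => a b; apply/eq_leq; ring.
  by rewrite leq_mul2l leq_mul // orbT.
apply: leq_trans (leq_mul IH (leqnn _)) _.
have kk : K ^ (L - m) * K <= K ^ (L - (m - 2)).
  by rewrite -expnSr leq_pexp2l //; lia.
apply: leq_trans (_ : q.+1 ^ e.+1 * (K ^ (L - m) * K) * (D * (2 * e.+1 * B)) <= _); last first.
  by rewrite leq_mul2r leq_mul2l kk !orbT.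
apply: leq_trans (_ : q.+1 ^ e.+1 * K ^ (L - m) * L ^ 2 * (D * (n ^ 4 * B)) <= _).
  rewrite (expnS q.+1 e); apply: leq_trans (_ : q.+1 * q.+1 ^ e * K ^ (L - m) * L ^ 2 * (D * A) <= _).
    by move: (q.+1 ^ e) (K ^ _) (L ^ 2) => a b c; apply/eq_leq; ring.
  by rewrite !leq_mul2l step2 !orbT.
rewrite {2}/K; apply: leq_trans (_ : q.+1 ^ e.+1 * (K ^ (L - m) * (L ^ 2 * n ^ 4)) * (D * (1 * B)) <= _).
  by move: (q.+1 ^ _) (K ^ _) (L ^ 2) (n ^ 4) => a b c f'; apply/eq_leq; ring.
by rewrite !leq_mul2l leq_mul2r muln_gt0 /= !orbT.
Qed.

End Switching.

(** * Short cycles in regular graphs *)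

Section Cycles.
Variables (d n : nat).
Implicit Types (G : graph n) (u v w z x y : 'I_n) (es : seq ('I_n * 'I_n)).

Definition has_edges G es := all (fun p => p.2 \in G p.1) es.

Definition sym_edges es := es ++ [seq (p.2, p.1) | p <- es].

Lemma has_edges_sym G es : simple G -> has_edges G (sym_edges es) = has_edges G es.
Proof.
move=> /simpleP[_ H2]; rewrite /has_edges all_cat all_map.
rewrite (eq_all (a2 := fun p => p.2 \in G p.1)) ?andbb //.
Qed.

Lemma sym_edges_swap es x y : ((y, x) \in sym_edges es) = ((x, y) \in sym_edges es).
Proof.
rewrite !mem_cat orbC; congr (_ || _); last first.
  by apply/idP/mapP => [h|[[a b] h [-> ->]] //]; exists (y, x).
by apply/mapP/idP => [[[a b] h [-> ->]] //|h]; exists (x, y).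
Qed.

(** Switch the edge [uv] with an arc [zw] outside [es]: both are deleted and [uz], [vw] are added,
    which keeps the degrees and the edges of [es]. At least [d n - c] arcs qualify, while in the
    result [z] and [w] are neighbours of [u] and [v], leaving at most [d ^ 2] possibilities. *)
Lemma switch_count es u v c : (u, v) \notin sym_edges es ->
  d.+1 * d + d.+1 * d + size (sym_edges es) <= c ->
  (d * n - c) * #|[pred G | regular d G & has_edges G ((u, v) :: es)]| <=
  d ^ 2 * #|[pred G | regular d G & has_edges G es]|.
Proof.
move=> uvE cE.
pose T := ('I_n * 'I_n)%type.
pose ok G (t : T) := [&& t.2 \in G t.1, t.1 \notin (u |: G u)%SET,
   t.2 \notin (v |: G v)%SET & t \notin [set p in sym_edges es]%SET].
pose P (s : graph n * T) := [&& regular d s.1, has_edges s.1 es & v \in s.1 u] && ok s.1 s.2.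
pose Q (s : graph n * T) := (regular d s.1 && has_edges s.1 es) && ((s.2.1 \in s.1 u) && (s.2.2 \in s.1 v)).
pose jn (s : graph n * T) := join_through (del_edge s.1 u v) u v s.2.1 s.2.2.
have pre G t : regular d G -> v \in G u -> ok G t ->
   [/\ simple (del_edge G u v), t.2 \in del_edge G u v t.1, t.1 \notin (u |: del_edge G u v u)%SET &
      t.2 \notin (v |: del_edge G u v v)%SET].
  move=> /regularP[sG _] vu /and4P[h1 h2 h3 _]; split; first exact: simple_del.
  - rewrite in_del h1 /is_edge; move: h2; rewrite !inE negb_or => /andP[/negbTE -> h2] /=.
    by rewrite negb_and; apply/orP; left; apply: contraNneq h2 => ->.
  - by move: h2; rewrite !inE !negb_or in_del negb_and => /andP[-> ->].
  - by move: h3; rewrite !inE !negb_or in_del negb_and => /andP[-> ->].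
have jinj : {in P &, injective (fun s => (jn s, s.2))}.
  move=> [G t] [G' t'] /andP[/= /and3P[r1 _ v1] o1] /andP[/= /and3P[r2 _ v2] o2] [e et]; subst t'.
  have [a1 a2 a3 a4] := pre _ _ r1 v1 o1; have [b1 b2 b3 b4] := pre _ _ r2 v2 o2.
  have [s1 _] := regularP _ _ r1; have [s2 _] := regularP _ _ r2.
  congr (_, _); rewrite -(del_edgeK s1 v1) -(del_edgeK s2 v2).
  congr (add_edge _ _ _); rewrite -(join_throughK a1 a2 a3 a4) -(join_throughK b1 b2 b3 b4).
  by move: e; rewrite /jn /= => ->.
have PQ s : P s -> Q (jn s, s.2).
  case: s => G [z w] /andP[/= /and3P[r1 hE v1] o1].
  have [a1 a2 a3 a4] := pre _ _ r1 v1 o1; have [s1 d1] := regularP _ _ r1.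
  have /= jm := join_mem (del_edge G u v) u v z w.
  rewrite /Q /= jm andbT; apply/andP; split.
    apply/regularP; split; first exact: simple_join.
    by move=> x; rewrite deg_join // deg_del.
  have hE' := hE; rewrite -(has_edges_sym es s1) in hE'.
  apply/allP => -[x y] xyE /=.
  have xyS : (x, y) \in sym_edges es by rewrite mem_cat xyE.
  apply: in_join => //.
    rewrite in_del (allP hE _ xyE) /=; apply/negP => /orP[]/andP[/eqP /= e1 /eqP /= e2].
      by move: uvE; rewrite -e1 -e2 xyS.
    by move: uvE; rewrite -e1 -e2 sym_edges_swap xyS.
  case/and4P: o1 => _ _ _; rewrite inE => zwE.
  apply/negP => /orP[]/andP[/eqP /= e1 /eqP /= e2].
    by move: zwE; rewrite -e1 -e2 xyS.
  by move: zwE; rewrite -e1 -e2 sym_edges_swap xyS.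
have := @leq_sum_inj _ _ P Q (fun s => (jn s, s.2)) (fun=> 1) jinj PQ.
rewrite -(pair_big_dep (fun G => [&& regular d G, has_edges G es & v \in G u]) ok (fun _ _ => 1)) /=.
rewrite -(pair_big_dep (fun G => regular d G && has_edges G es) (fun G (t : T) => (t.1 \in G u) && (t.2 \in G v))
   (fun _ _ => 1)) /= => H.
apply: leq_trans (leq_trans _ H) _.
  rewrite mulnC -sum_nat_const.
  rewrite (eq_bigl (fun G => [&& regular d G, has_edges G es & v \in G u])); last first.
    by move=> G; rewrite !inE /= [has_edges G _]/= [(v \in _) && _]andbC.
  apply: leq_sum => G /and3P[r1 hE v1]; have [s1 d1] := regularP _ _ r1.
  have cN x : #|(x |: G x)%SET| <= d.+1.
    by apply: leq_trans (leq_card_setU _ _) _; rewrite cards1 add1n d1.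
  have dd x : #|G x| <= d by rewrite d1.
  have := @arcs_avoid d n G (u |: G u)%SET (v |: G v)%SET d.+1 [set p in sym_edges es]%SET s1 dd (cN u) (cN v).
  rewrite (eq_bigr (fun=> d)) // sum_nat_const card_ord mulnC sum1_card.
  have : #|[set p in sym_edges es]%SET| <= size (sym_edges es) by rewrite cardsE card_size.
  have -> : #|[set p : 'I_n * 'I_n | [&& p.2 \in G p.1, p.1 \notin (u |: G u)%SET, p.2 \notin (v |: G v)%SET & p \notin [set p in sym_edges es]%SET]]%SET| = #|ok G|.
    by apply: eq_card => p; rewrite inE.
  move: #|_| #|ok G| cE => a b; lia.
rewrite mulnC -sum_nat_const; apply: leq_sum => G /andP[/regularP[_ dG] _].
rewrite sum1_card -mulnn -{1}(dG u) -(dG v) -cardX.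
by apply/eq_leq/eq_card => t; rewrite !inE.
Qed.

(** Distinct as undirected edges, so that [switch_count] can remove them one after the other. *)
Fixpoint separated es := if es is p :: es' then (p \notin sym_edges es') && separated es' else true.

Lemma separated_count es c : separated es ->
  d.+1 * d + d.+1 * d + (size es).*2 <= c ->
  (d * n - c) ^ size es * #|[pred G | regular d G & has_edges G es]| <=
  (d ^ 2) ^ size es * #|[pred G : graph n | regular d G]|.
Proof.
elim: es => [|[u v] es IH] /=.
  move=> _ _; rewrite !mul1n; apply/subset_leq_card/fintype.subsetP => G.
  by rewrite !inE => /andP[].
move=> /andP[uvE sE] cE.
have c1 : d.+1 * d + d.+1 * d + (size es).*2 <= c by move: cE; rewrite doubleS; lia.
have c2 : d.+1 * d + d.+1 * d + size (sym_edges es) <= c.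
  by rewrite size_cat size_map (addnn (size es)) c1.
have H := switch_count uvE c2.
rewrite !(expnS _ (size es)) -[leqLHS]mulnA -[leqRHS]mulnA.
apply: leq_trans (_ : (d * n - c) ^ size es * (d ^ 2 * #|[pred G | regular d G & has_edges G es]|) <= _).
  by rewrite mulnCA; apply: leq_mul.
by rewrite [leqLHS]mulnCA leq_mul2l IH ?orbT.
Qed.

Fixpoint path_edges x (s : seq 'I_n) := if s is y :: s' then (x, y) :: path_edges y s' else [::].
Definition cycle_edges x (s : seq 'I_n) := (last x s, x) :: path_edges x s.

Lemma path_edges_mem x s p : p \in path_edges x s -> (p.1 \in x :: s) && (p.2 \in s).
Proof.
elim: s x => [|y s IH] x //=; rewrite inE => /orP[/eqP ->|/IH/andP[h1 h2]] /=.
  by rewrite !inE !eqxx.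
by rewrite [p.1 \in _]inE h1 orbT inE h2 orbT.
Qed.

Lemma sym_path_edges_mem x s p : p \in sym_edges (path_edges x s) -> (p.1 \in x :: s) && (p.2 \in x :: s).
Proof.
rewrite mem_cat => /orP[/path_edges_mem/andP[-> h]|/mapP[q /path_edges_mem/andP[h1 h2] ->]] /=.
  by rewrite inE h orbT.
by rewrite h1 inE h2 orbT.
Qed.

Lemma separated_path x s : uniq (x :: s) -> separated (path_edges x s).
Proof.
elim: s x => [|y s IH] x // /andP[xys us] /=; rewrite IH // andbT.
by apply/negP => /sym_path_edges_mem/andP[/= h _]; rewrite h in xys.
Qed.

Lemma separated_cycle x s : uniq (x :: s) -> 1 < size s -> separated (cycle_edges x s).
Proof.
case: s => [|y [|z s]] // us _; rewrite /cycle_edges [separated _]/=.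
rewrite [X in _ && X](separated_path us) andbT; apply/negP.
have lz : last x [:: y, z & s] \in z :: s by rewrite /= mem_last.
move: us => /and3P[/= xs ys _].
have lx : last x [:: y, z & s] != x by apply: contraNneq xs => <-; rewrite inE lz orbT.
have ly : last x [:: y, z & s] != y by apply: contraNneq ys => <-.
suff : (last x [:: y, z & s], x) \notin sym_edges ((x, y) :: path_edges y (z :: s)) by move/negP.
have := @sym_path_edges_mem y (z :: s).
move: (path_edges y (z :: s)) (last x [:: y, z & s]) lx ly => pe l lx ly H.
rewrite mem_cat map_cons !inE !xpair_eqE (negbTE lx) (negbTE ly) /= -mem_cat.
by apply/negP => /H/andP[_ h]; rewrite h in xs.
Qed.

Lemma size_path_edges x s : size (path_edges x s) = size s.
Proof. by elim: s x => //= y s IH x; rewrite IH. Qed.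

Definition cycle_count l G :=
  #|[set t : l.+1.-tuple 'I_n | uniq t && has_edges G (cycle_edges (thead t) (behead t))]%SET|.

(** Each of at most [n^(l+1)] vertex sequences is a cycle in a proportion at most
    [(d^2 / (d n - c))^(l+1)] of the regular graphs, and [n <= d n - c]. The bound [1 < l] makes the
    edges of the cycle distinct. *)
Lemma cycle_count_sum l : 1 < l -> d.+1 * d + d.+1 * d + l.+1.*2 + n <= d * n ->
  \sum_(G | regular d G) cycle_count l G <= d ^ (2 * l.+1) * #|[pred G : graph n | regular d G]|.
Proof.
move=> l1 dn; set c := d.+1 * d + d.+1 * d + l.+1.*2 in dn.
case: (posnP n) => [n0|n0].
  rewrite big1 ?leq0n // => G _; apply/eqP; rewrite cards_eq0; apply/eqP/setP => t.
  by have := ltn_ord (tnth t ord0); rewrite [in X in _ < X]n0.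
have nc : n <= d * n - c by lia.
rewrite -(@leq_pmul2l (n ^ l.+1)) ?expn_gt0 ?n0 //.
apply: leq_trans (_ : \sum_(t : l.+1.-tuple 'I_n | uniq t)
   (d * n - c) ^ l.+1 * #|[pred G | regular d G & has_edges G (cycle_edges (thead t) (behead t))]| <= _).
  rewrite -big_distrr /= leq_mul ?leq_exp2r //.
  rewrite (eq_bigr (fun G => \sum_(t : l.+1.-tuple 'I_n | uniq t) (has_edges G (cycle_edges (thead t) (behead t)) : nat))).
    rewrite exchange_big /=; apply: leq_sum => t _.
    rewrite -sum1_card [leqRHS]big_mkcond [leqLHS]big_mkcond; apply: leq_sum => G _.
    by rewrite inE; case: (regular d G); case: has_edges.
  move=> G _; rewrite /cycle_count -sum1_card big_mkcond [RHS]big_mkcond; apply: eq_bigr => t _.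
  by rewrite inE; case: (uniq t); case: has_edges.
apply: leq_trans (_ : \sum_(t : l.+1.-tuple 'I_n) (d ^ 2) ^ l.+1 * #|[pred G : graph n | regular d G]| <= _); last first.
  by rewrite sum_nat_const card_tuple card_ord expnM.
rewrite big_mkcond; apply: leq_sum => t _; case: ifP => // ut.
have st : size (cycle_edges (thead t) (behead t)) = l.+1.
  by rewrite /= size_path_edges size_behead size_tuple.
have := @separated_count (cycle_edges (thead t) (behead t)) c; rewrite st; apply; last by [].
have et : thead t :: behead t = t :> seq _ by rewrite [in RHS](tuple_eta t).
by apply: separated_cycle; rewrite ?et // size_behead size_tuple.
Qed.

End Cycles.

(** * Encoding coloured graphs by half-edge matchings *)

Section Encoding.
Variables (d n k E : nat) (F : finType) (i0 : 'I_d).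
Hypothesis EM : (2 * E = d * n)%N.

Notation T := (bt d F k).
Notation S := (star_type d F k).
Notation pos := ('I_E * bool)%type.

Definition half_edge_type (s : {ffun 'I_n -> S}) (h : 'I_n * 'I_d) : T * T := (s h.1).2 h.2.

(** Since [2 E = d n], an injective map is a bijection: a perfect matching of the half-edges
    together with an order of its pairs and of the two ends of each pair. *)
Definition matchings (s : {ffun 'I_n -> S}) : {set {ffun pos -> 'I_n * 'I_d}} :=
  [set p : {ffun pos -> 'I_n * 'I_d} | injectiveb p &&
     [forall j, half_edge_type s (p (j, true)) == 
        ((half_edge_type s (p (j, false))).2, (half_edge_type s (p (j, false))).1)]]%SET.

Definition star_act (x : S) (a : 'S_d) : S := (x.1, [ffun c => x.2 (a c)]).

(** Summing over all relabellings of each star removes the dependence on the labels and makes the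
    count agree with [star_count]. *)
Definition sym_count (s : {ffun 'I_n -> S}) (x : S) : nat :=
  \sum_v #|[set a : 'S_d | star_act (s v) a == x]%SET|.

Definition fwd_edges (G : graph n) : {set 'I_n * 'I_n} :=
  [set p : 'I_n * 'I_n | (p.1 < p.2) && (p.2 \in G p.1)]%SET.

Definition labellings (G : graph n) : pred {ffun 'I_n -> {ffun 'I_d -> 'I_n}} :=
  [pred L | L \in family (fun v => mem (Theta d G v))].
Definition listings (G : graph n) : {set {ffun 'I_E -> 'I_n * 'I_n}} :=
  [set f in ffun_on (mem (fwd_edges G)) | injectiveb f]%SET.

Lemma double_fwd_edges G : regular d G -> (2 * #|fwd_edges G| = d * n)%N.
Proof.
move=> Greg; have /regularP[sG dG] := Greg; have /simpleP[H1 H2] := sG.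
transitivity (\sum_v #|G v|); last first.
  by rewrite (eq_bigr (fun=> d)) // sum_nat_const card_ord mulnC.
transitivity #|[set p : 'I_n * 'I_n | p.2 \in G p.1]%SET|; last first.
  rewrite -sum1_card (eq_bigl (fun p => xpredT p.1 && (p.2 \in G p.1))); last by move=> p; rewrite inE.
  by rewrite -(pair_big_dep xpredT (fun x y => y \in G x) (fun _ _ => 1)) /=; apply: eq_bigr => x _; rewrite sum1_card.
pose sw (p : 'I_n * 'I_n) := (p.2, p.1).
have swI : injective sw by move=> [? ?] [? ?] [-> ->].
have -> : [set p : 'I_n * 'I_n | p.2 \in G p.1]%SET = (fwd_edges G :|: sw @: fwd_edges G)%SET.
  apply/setP => -[v w]; rewrite !inE /=.
  have -> : ((v, w) \in sw @: fwd_edges G)%SET = (w < v) && (w \in G v).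
    apply/imsetP/idP => [[[a b]]|/andP[wv h]].
      by rewrite inE /= => /andP[ab bG] [-> ->]; rewrite ab H2.
    by exists (w, v) => //; rewrite inE /= wv H2.
  rewrite -andb_orl; case: (ltngtP v w) => //= /val_inj e.
  by rewrite e (negbTE (H1 w)).
rewrite cardsU card_imset // (_ : _ :&: _ = finset.set0)%SET ?cards0 ?subn0 ?mul2n ?addnn //.
apply/setP => -[v w]; rewrite !inE /=; apply/negP => /andP[/andP[vw _] /imsetP[[a b]]].
by rewrite inE /= => /andP[ab _] [e1 e2]; subst; move: vw; rewrite ltnNge ltnW.
Qed.

Lemma card_fwd_edges G : regular d G -> #|fwd_edges G| = E.
Proof.
move=> Greg; apply/eqP; rewrite -(eqn_pmul2l (ltn0Sn 1)) EM; apply/eqP.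
exact: double_fwd_edges.
Qed.

Lemma card_encodings G : regular d G ->
  #|labellings G| * #|listings G| * #|{ffun 'I_E -> bool}| = (d`!) ^ n * E`! * 2 ^ E.
Proof.
move=> Greg; congr (_ * _ * _).
- rewrite (eq_card (B := family (fun v => mem (Theta d G v)))) => [|//].
  rewrite card_family foldrE big_map big_enum /=.
  rewrite (eq_bigr (fun=> d`!)) => [|v _]; last exact: card_Theta.
  by rewrite prod_nat_const card_ord.
- by rewrite card_inj_ffuns_on card_ord card_fwd_edges // ffactnn.
by rewrite card_ffun card_bool card_ord.
Qed.

Definition arc (f : {ffun 'I_E -> 'I_n * 'I_n}) (b : {ffun 'I_E -> bool}) (p : pos) : 'I_n * 'I_n :=
  if b p.1 (+) p.2 then ((f p.1).2, (f p.1).1) else f p.1.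

Definition label (L : {ffun 'I_n -> {ffun 'I_d -> 'I_n}}) (a : 'I_n * 'I_n) : 'I_d :=
  odflt i0 [pick c | L a.1 c == a.2].

Definition encode (g : {ffun 'I_n -> F}) (G : graph n) (L : {ffun 'I_n -> {ffun 'I_d -> 'I_n}})
  (f : {ffun 'I_E -> 'I_n * 'I_n}) (b : {ffun 'I_E -> bool}) :
   {ffun 'I_n -> S} * {ffun pos -> 'I_n * 'I_d} :=
  ([ffun v => graph_star (d := d) G k g v (L v)], [ffun p => ((arc f b p).1, label L (arc f b p))]).

Lemma arc_flip f b j c : arc f b (j, ~~ c) = ((arc f b (j, c)).2, (arc f b (j, c)).1).
Proof. by rewrite /arc /= addbN; case: (_ (+) _) => /=; case: (f j). Qed.

Section OneGraph.
Variables (G : graph n) (L : {ffun 'I_n -> {ffun 'I_d -> 'I_n}}) (f : {ffun 'I_E -> 'I_n * 'I_n})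
  (b : {ffun 'I_E -> bool}).
Hypotheses (Greg : regular d G) (LG : L \in labellings G) (fG : f \in listings G).

Let Lth v : L v \in Theta d G v.
Proof. by move: LG; rewrite inE => /familyP/(_ v). Qed.

Let sG : simple G. Proof. by have /regularP[] := Greg. Qed.

Let fj j : (f j).1 < (f j).2 /\ (f j).2 \in G (f j).1.
Proof. by move: fG; rewrite inE => /andP[/ffun_onP/(_ j)]; rewrite inE => /andP[]. Qed.

Let finj : injective f.
Proof. by move: fG; rewrite inE => /andP[_ /injectiveP]. Qed.

Lemma fsurj p : p \in fwd_edges G -> exists j, f j = p.
Proof.
have sub : codom f \subset fwd_edges G.
  by apply/fintype.subsetP => _ /codomP[j ->]; have [h1 h2] := fj j; rewrite inE h1 h2.
have /subset_leqif_card/leqifP : codom f \subset fwd_edges G := sub.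
have -> : #|codom f| = #|fwd_edges G|.
  by rewrite card_codom // card_ord card_fwd_edges.
case: ifP => [/fintype.subsetP h _ /h /codomP[j ->]|_]; first by exists j.
by rewrite ltnn.
Qed.

Lemma arc_edge p : (arc f b p).2 \in G (arc f b p).1.
Proof.
have /simpleP[H1 H2] := sG; have [h1 h2] := fj p.1.
by rewrite /arc; case: ifP => //= _; rewrite H2.
Qed.

Lemma edge_arc v w : w \in G v -> exists p, arc f b p = (v, w).
Proof.
move=> wv; have /simpleP[H1 H2] := sG.
case: (ltngtP v w) => vw.
- have [|j fj'] := @fsurj (v, w); first by rewrite inE /= vw.
  by exists (j, b j); rewrite /arc /= addbb.
- have [|j fj'] := @fsurj (w, v); first by rewrite inE /= vw H2.
  by exists (j, ~~ b j); rewrite /arc /= addbN addbb /= fj'.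
by move: wv; rewrite (val_inj vw) (negbTE (H1 w)).
Qed.

Lemma arc_inj : injective (arc f b).
Proof.
have fne i j : f i <> ((f j).2, (f j).1).
  move=> e; have [h1 _] := fj i; have [h2 _] := fj j.
  by move: h1; rewrite e /= ltnNge ltnW.
have sI (p q : 'I_n * 'I_n) : (p.2, p.1) = (q.2, q.1) -> p = q.
  by case: p q => [? ?] [? ?] [-> ->].
move=> [i x] [j y]; rewrite /arc /=.
case: ifP => bi; case: ifP => bj.
- by move/sI/finj => e; subst; congr (_, _); apply: (@addbI (b j)); rewrite bi bj.
- by move/esym/fne.
- by move/fne.
by move/finj => e; subst; congr (_, _); apply: (@addbI (b j)); rewrite bi bj.
Qed.

Lemma labelK a : a.2 \in G a.1 -> L a.1 (label L a) = a.2.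
Proof.
move=> aG; rewrite /label; case: pickP => [c /eqP //|H].
by have [c ec] := Theta_surj (Lth a.1) aG; have := H c; rewrite ec eqxx.
Qed.

Lemma label_eq v c : label L (v, L v c) = c.
Proof.
have [inj _] := ThetaP _ _ _ (Lth v); apply: inj.
by rewrite (labelK (a := (v, L v c))) //=; exact: Theta_mem (Lth v).
Qed.

Lemma encode_matching g : (encode g G L f b).2 \in matchings (encode g G L f b).1.
Proof.
rewrite inE; apply/andP; split.
  apply/injectiveP => p q; rewrite /= !ffunE => -[e1 e2].
  apply: arc_inj; apply/eqP; rewrite -pair_eqE /= /pair_eq e1 eqxx /=.
  by rewrite -labelK ?arc_edge // e1 e2 labelK ?arc_edge.
apply/forallP => j; rewrite /half_edge_type /= !ffunE /graph_star /= ?ffunE.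
have e := arc_flip f b j false; rewrite /= in e.
have a1 := arc_edge (j, true); have a0 := arc_edge (j, false).
rewrite (labelK a1) (labelK a0).
by rewrite e /=.
Qed.

Lemma encode_sym_count g x : sym_count (encode g G L f b).1 x = star_count G g x.
Proof.
apply: eq_bigr => v _; rewrite ffunE.
have [inj eT] := Theta_imset (Lth v).
have -> : [set th in Theta d G v | graph_star G k g v th == x]%SET =
   [set perm_th (L v) a | a in [set a : 'S_d | star_act (graph_star G k g v (L v)) a == x]%SET]%SET.
  apply/setP => th; rewrite inE eT.
  have eg a : graph_star G k g v (perm_th (L v) a) = star_act (graph_star G k g v (L v)) a.
    by congr (_, _); apply/ffunP => c; rewrite !ffunE.
  apply/andP/imsetP => [[/imsetP[a _ ->] h]|[a aP ->]].
    by exists a => //; rewrite inE -eg.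
  split; first by apply/imsetP; exists a.
  by rewrite eg; move: aP; rewrite inE.
by rewrite card_imset.
Qed.

End OneGraph.

(** The second component shows the first end of every arc; the opposite position of the same pair
    shows its second end. The arcs give the edges of [G], and the labels at their ends give [L]. *)
Lemma encode_inj G G' L L' f f' b b' g g' : regular d G -> regular d G' ->
  L \in labellings G -> L' \in labellings G' -> f \in listings G -> f' \in listings G' ->
  encode g G L f b = encode g' G' L' f' b' -> [/\ G = G', g = g', L = L', f = f' & b = b'].
Proof.
move=> rG rG' LG LG' fG fG' [/ffunP es /ffunP ep].
have eg : g = g' by apply/ffunP => v; have := es v; rewrite !ffunE => -[].
have e1 p : (arc f b p).1 = (arc f' b' p).1 by have := ep p; rewrite !ffunE => -[].
have ea p : arc f b p = arc f' b' p.
  case: p => j c; apply/eqP; rewrite -pair_eqE /= /pair_eq e1 eqxx /=.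
  by have := e1 (j, ~~ c); rewrite !arc_flip /= => ->.
have fj H h (hG : h \in listings H) j : (h j).1 < (h j).2.
  by move: hG; rewrite inE => /andP[/ffun_onP/(_ j)]; rewrite inE => /andP[].
(* Listed edges have increasing ends, so the direction of an arc reveals the orientation bit. *)
have ebf j : b j = b' j /\ f j = f' j.
  have := ea (j, false); have := fj _ _ fG j; have := fj _ _ fG' j.
  rewrite /arc /= !addbF; case: (b j); case: (b' j) => //.
  - by case: (f j) (f' j) => [? ?] [? ?] /= _ _ [-> ->].
  - by move=> h1 h2 e; move: h1; rewrite -e /= ltnNge ltnW.
  by move=> h1 h2 e; move: h2; rewrite e /= ltnNge ltnW.
have eG : G = G'.
  apply/ffunP => v; apply/setP => w; apply/idP/idP => h.
    have [p ep'] := edge_arc b rG fG h.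
    by have := arc_edge b' rG' fG' p; rewrite -ea ep'.
  have [p ep'] := edge_arc b' rG' fG' h.
  by have := arc_edge b rG fG p; rewrite ea ep'.
have eL : L = L'.
  apply/ffunP => v; apply/ffunP => c.
  have Lth : L v \in Theta d G v by move: LG; rewrite inE => /familyP/(_ v).
  have [p ep'] := edge_arc b rG fG (Theta_mem c Lth).
  have := ep p; rewrite !ffunE -ea ep' /= (label_eq LG) => -[ec].
  have vL : (v, L v c).2 \in G' (v, L v c).1 by rewrite -eG /=; exact: Theta_mem Lth.
  by have := labelK LG' vL; rewrite -ec /= => ->.
split=> //; apply/ffunP => j; by have [] := ebf j.
Qed.

(* The right-hand side counts the codes of (G, g) enriched with a labelling of the half-edges, an
   enumeration of the edges and an orientation of each edge. *)
Lemma pairs_bound (kap : S -> nat) :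
  #|[set x : graph n * {ffun 'I_n -> F} | regular d x.1 && [forall y, star_count x.1 x.2 y == kap y]]%SET|
    * ((d`!) ^ n * E`! * 2 ^ E) <=
  \sum_(s : {ffun 'I_n -> S} | [forall y, sym_count s y == kap y]) #|matchings s|.
Proof.
pose X := (graph n * {ffun 'I_n -> F})%type.
pose D := ({ffun 'I_n -> {ffun 'I_d -> 'I_n}} * {ffun 'I_E -> 'I_n * 'I_n} * {ffun 'I_E -> bool})%type.
pose ok (x : X) := regular d x.1 && [forall y, star_count x.1 x.2 y == kap y].
pose okD (x : X) (t : D) := ((t.1.1 \in labellings x.1) && (t.1.2 \in listings x.1)) && true.
pose P (z : X * D) := ok z.1 && okD z.1 z.2.
pose Q (z : {ffun 'I_n -> S} * {ffun pos -> 'I_n * 'I_d}) :=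
   [forall y, sym_count z.1 y == kap y] && (z.2 \in matchings z.1).
pose h (z : X * D) := encode z.1.2 z.1.1 z.2.1.1 z.2.1.2 z.2.2.
have hinj : {in P &, injective h}.
  move=> [[G g] [[L f] b]] [[G' g'] [[L' f'] b']] /andP[/andP[/= rG _] /andP[/andP[/= LG fG] _]].
  move=> /andP[/andP[/= rG' _] /andP[/andP[/= LG' fG'] _]] /(encode_inj rG rG' LG LG' fG fG').
  by move=> [] /= -> -> -> -> ->.
have hPQ z : P z -> Q (h z).
  case: z => [[G g] [[L f] b]] /andP[/andP[/= rG /forallP H] /andP[/andP[/= LG fG] _]].
  apply/andP; split; last exact: encode_matching.
  by apply/forallP => y; rewrite encode_sym_count.
have := @leq_sum_inj _ _ P Q h (fun=> 1) hinj hPQ.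
rewrite -(pair_big_dep ok okD (fun _ _ => 1)) /=.
rewrite -(pair_big_dep (fun s : {ffun 'I_n -> S} => [forall y, sym_count s y == kap y]) (fun s p => p \in matchings s) (fun _ _ => 1)) /=.
rewrite [X in _ <= X -> _](eq_bigr (fun s => #|matchings s|)) => [|s _]; last by rewrite sum1_card.
apply: leq_trans; rewrite -sum_nat_const.
rewrite [leqLHS](eq_bigl ok) => [|x]; last by rewrite inE.
apply: leq_sum => x /andP[rG _].
rewrite -(card_encodings rG) sum1_card.
rewrite -[#|labellings _|]cardsE -[#|{: {ffun 'I_E -> bool}}|]cardsT -!cardsX.
by apply/eq_leq/eq_card => -[[L f] b]; rewrite !finset.in_setX finset.in_setT finset.in_set.
Qed.

End Encoding.

Local Open Scope classical_set_scope.
Local Open Scope ring_scope.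

(** * Entropy bounds for the number of encodings *)

Section EntropyTools.
Variable R : realType.
Implicit Types x y : R.

Definition entropy (A : finType) (p : A -> R) : R := - \sum_a p a * ln (p a).

Lemma ln_le_sub1 x : 0 < x -> ln x <= x - 1.
Proof. by move=> x0; rewrite -[in leLHS](subrKC 1 x); apply: le_ln1Dx; rewrite ltrBrDr addNr. Qed.

Lemma ln_prod (I : Type) (r : seq I) (P : pred I) (f : I -> R) :
  (forall i, P i -> 0 < f i) -> ln (\prod_(i <- r | P i) f i) = \sum_(i <- r | P i) ln (f i).
Proof.
move=> f0; elim: r => [|i r IH]; first by rewrite !big_nil ln1.
rewrite !big_cons; case: ifP => // Pi; rewrite lnM ?IH ?posrE ?f0 //.
exact: prodr_gt0.
Qed.

Lemma lnS_diff_le (m : nat) : (0 < m)%N -> m%:R * (ln m.+1%:R - ln m%:R) <= 1 :> R.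
Proof.
move=> m0; have m0' : 0 < m%:R :> R by rewrite ltr0n.
rewrite -ln_div ?posrE ?ltr0n // -ler_pdivlMl // mulr1.
apply: le_trans (ln_le_sub1 _) _; first by rewrite divr_gt0 // ltr0n.
by rewrite -natr1 mulrDl divff ?gt_eqF // mul1r addrAC subrr add0r.
Qed.

Lemma lnS_diff_ge (m : nat) : (0 < m)%N -> 1 <= m.+1%:R * (ln m.+1%:R - ln m%:R) :> R.
Proof.
move=> m0; have m0' : 0 < m%:R :> R by rewrite ltr0n.
have m1' : 0 < m.+1%:R :> R by rewrite ltr0n.
rewrite -opprB -ln_div ?posrE // mulrN lerNr -ler_pdivlMl //.
apply: le_trans (ln_le_sub1 _) _; first by rewrite divr_gt0.
rewrite mulrN1 -[X in _ - X](@divff _ m.+1%:R) ?gt_eqF // -mulrBl -natr1.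
by rewrite opprD addrA subrr sub0r mulN1r.
Qed.

Lemma ln_fact_ge (m : nat) : m%:R * ln m%:R - m%:R <= ln m`!%:R :> R.
Proof.
elim: m => [|m IH]; first by rewrite mul0r subr0 fact0 ln1.
rewrite factS natrM lnM ?posrE ?ltr0n ?fact_gt0 //.
case: (posnP m) => [->|m0]; first by rewrite fact0 ln1; lra.
have := lnS_diff_le m0; rewrite -natr1; lra.
Qed.

Lemma ln_fact_le (m : nat) : ln m`!%:R <= m%:R * ln m%:R - m%:R + 1 + ln m.+1%:R :> R.
Proof.
case: (posnP m) => [->|m0]; first by rewrite fact0 ln1; lra.
have lS : ln m%:R <= ln m.+1%:R :> R by rewrite ler_ln ?posrE ?ltr0n // ler_nat.
suff : ln m`!%:R <= m%:R * ln m%:R - m%:R + 1 + ln m%:R :> R by lra.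
case: m m0 {lS} => // m _; elim: m => [|m IH]; first by rewrite factS fact0 muln1 ln1; lra.
rewrite factS natrM lnM ?posrE ?ltr0n ?fact_gt0 //.
have := lnS_diff_ge (ltn0Sn m); rewrite -(natr1 m.+1); lra.
Qed.

Lemma sum_counts_entropy (I A : finType) (h : I -> A) :
  \sum_a #|fibre h a|%:R * ln (#|fibre h a|%:R / #|I|%:R) =
  \sum_i ln (#|fibre h (h i)|%:R / #|I|%:R) :> R.
Proof.
rewrite [RHS](partition_big h predT) //=; apply: eq_bigr => a _.
rewrite (eq_bigr (fun=> ln (#|fibre h a|%:R / #|I|%:R))) => [|i /eqP -> //].
rewrite sumr_const mulr_natl; congr (_ *+ _).
by apply: eq_card => i; rewrite !inE.
Qed.

Lemma sum_fibre (I A : finType) (h : I -> A) : (\sum_a #|fibre h a| = #|I|)%N.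
Proof.
rewrite -sum1_card (partition_big h predT) //=; apply: eq_bigr => a _.
by rewrite -sum1_card; apply: eq_bigl => i; rewrite inE.
Qed.

(** Stirling's bounds for each factorial: the inverse multinomial coefficient is [exp (- #|I| H)] up
    to a polynomial factor. *)
Lemma prod_fact_le (I A : finType) (h : I -> A) : (0 < #|I|)%N ->
  \sum_a ln ((#|fibre h a|)`!%:R) <=
  ln ((#|I|)`!%:R) + #|A|%:R * (1 + ln #|I|.+1%:R) - #|I|%:R * entropy (fun a => #|fibre h a|%:R / #|I|%:R) :> R.
Proof.
move=> I0; have I0' : 0 < #|I|%:R :> R by rewrite ltr0n.
set m := fun a => #|fibre h a|.
have e1 : #|I|%:R * entropy (fun a => (m a)%:R / #|I|%:R) =
   #|I|%:R * ln #|I|%:R - \sum_a (m a)%:R * ln (m a)%:R :> R.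
  rewrite /entropy mulrN mulr_sumr.
  have -> : #|I|%:R * ln #|I|%:R = \sum_a (m a)%:R * ln #|I|%:R :> R.
    by rewrite -mulr_suml -natr_sum sum_fibre.
  rewrite -sumrB -sumrN; apply: eq_bigr => a _.
  case: (posnP (m a)) => [->|ma]; first by rewrite !mul0r mulr0 subr0 oppr0.
  rewrite ln_div ?posrE ?ltr0n // mulrA mulrCA mulfV ?gt_eqF // mulr1; lra.
have e2 := ln_fact_ge #|I|.
have e3 : \sum_a ln ((m a)`!%:R) <= \sum_a ((m a)%:R * ln (m a)%:R - (m a)%:R + (1 + ln #|I|.+1%:R)) :> R.
  apply: ler_sum => a _; have := ln_fact_le (m a).
  have : ln (m a).+1%:R <= ln #|I|.+1%:R :> R.
    by rewrite ler_ln ?posrE ?ltr0n // ler_nat ltnS -(sum_fibre h) (bigD1 a) //= leq_addr.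
  lra.
move: e3; rewrite big_split sumrB /= sumr_const cardT -cardE -[_ *+ #|A|]mulr_natl -natr_sum sum_fibre.
rewrite e1; move: e2; lra.
Qed.

(** The counting principle of the method of types; [w] will be a product measure that is constant on
    [X]. *)
Lemma card_by_weight (J : finType) (X : {set J}) (w : J -> R) (c : R) :
  (forall j, 0 <= w j) -> \sum_j w j <= 1 -> (forall j, j \in X -> expR (- c) <= w j) ->
  #|X|%:R <= expR c.
Proof.
move=> w0 w1 wX; rewrite -(@ler_pM2r _ (expR (- c))) ?expR_gt0 // -expRD subrr expR0.
apply: le_trans w1; rewrite mulr_natl -sumr_const.
rewrite [leRHS](bigID (mem X)) /= -[leLHS]addr0; apply: lerD; first exact: ler_sum.
exact: sumr_ge0.
Qed.

End EntropyTools.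

(** * Entropy bound for the number of coloured regular graphs *)

Section UpperBound.
Variables (R : realType) (d n k E : nat) (F : finType) (i0 : 'I_d).
Hypothesis EM : (2 * E = d * n)%N.
Hypothesis n0 : (0 < n)%N.

Notation T := (bt d F k).
Notation S := (star_type d F k).
Notation pos := ('I_E * bool)%type.

Lemma star_actM (x : S) a b : star_act (star_act x a) b = star_act x (b * a)%g.
Proof. by congr (_, _); apply/ffunP => c; rewrite !ffunE /= permM. Qed.

Lemma star_act1 (x : S) : star_act x 1%g = x.
Proof. by case: x => z1 z2; congr (_, _); apply/ffunP => c; rewrite ffunE /= perm1. Qed.

Lemma star_act_inj a : injective (fun x : S => star_act x a).
Proof.
by move=> x y /(congr1 (fun z => star_act z a^-1)); rewrite !star_actM mulVg !star_act1.
Qed.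

Lemma sym_count_act (s : {ffun 'I_n -> S}) x a : sym_count s (star_act x a) = sym_count s x.
Proof.
apply: eq_bigr => v _.
rewrite -(card_imset (pred_of_set [set b | star_act (s v) b == x]%SET) (mulgI a)); apply: eq_card => b.
rewrite inE; apply/eqP/imsetP => [e|[c cP ->]].
  exists (a^-1 * b)%g; last by rewrite mulKVg.
  by rewrite inE; apply/eqP/(@star_act_inj a); rewrite star_actM mulKVg.
by rewrite -star_actM; move: cP; rewrite inE => /eqP ->.
Qed.

Lemma sum_sym_count (s : {ffun 'I_n -> S}) (f : S -> R) :
  \sum_x (sym_count s x)%:R * f x = \sum_v \sum_(a : 'S_d) f (star_act (s v) a).
Proof.
rewrite (eq_bigr (fun x => \sum_v \sum_(a : 'S_d | star_act (s v) a == x) f x)) => [|x _].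
  rewrite exchange_big /=; apply: eq_bigr => v _.
  rewrite [RHS](partition_big (fun a => star_act (s v) a) predT) //=.
  by apply: eq_bigr => x _; apply: eq_bigr => a /eqP ->.
rewrite /sym_count natr_sum mulr_suml; apply: eq_bigr => v _.
rewrite sumr_const mulr_natl; congr (_ *+ _).
by apply: eq_card => a; rewrite !inE.
Qed.

Definition star_density (kap : S -> nat) (x : S) : R := (kap x)%:R / (n * d`!)%:R.

Let nd0 : 0 < (n * d`!)%:R :> R. Proof. by rewrite ltr0n muln_gt0 n0 fact_gt0. Qed.

Lemma star_density_sum1 (s : {ffun 'I_n -> S}) : \sum_x star_density (sym_count s) x = 1.
Proof.
have e : \sum_x (sym_count s x)%:R = (n * d`!)%:R :> R.
  have := sum_sym_count s (fun=> 1); under eq_bigr => x _ do rewrite mulr1.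
  move=> ->; rewrite (eq_bigr (fun=> (d`!)%:R)) => [|v _]; last by rewrite sumr_const card_Sn.
  by rewrite sumr_const card_ord natrM mulr_natl.
by rewrite /star_density -mulr_suml e divff // gt_eqF.
Qed.

Lemma sum_prod_weights (A : finType) (m : nat) (p : A -> R) : \sum_a p a = 1 ->
  \sum_(f : {ffun 'I_m -> A}) \prod_i p (f i) = 1.
Proof.
by move=> p1; rewrite -(bigA_distr_bigA (fun=> p)) /= (eq_bigr (fun=> 1)) ?prodr_const ?expr1n.
Qed.

(** Under the product measure with marginal [star_density kap] all members of the class have weight
    [exp (- n H)]. Symmetrised counts suffice for this, because the density is constant on orbits of
    relabellings. *)
Lemma card_sym_class (kap : S -> nat) :
  #|[set s : {ffun 'I_n -> S} | [forall y, sym_count s y == kap y]]%SET|%:R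
   <= expR (n%:R * entropy (star_density kap)).
Proof.
set X := [set s | _]%SET.
have XP s : s \in X -> sym_count s =1 kap by rewrite inE => /forallP h y; exact/eqP.
have dE s : s \in X -> star_density (sym_count s) =1 star_density kap.
  by move=> sX y; rewrite /star_density (XP s sX).
have [->|[s0 s0X]] := set_0Vmem X; first by rewrite cards0 expR_ge0.
apply: (@card_by_weight _ _ _ (fun s : {ffun 'I_n -> S} => \prod_v star_density kap (s v))).
- by move=> s; apply: prodr_ge0 => v _; rewrite divr_ge0.
- by rewrite sum_prod_weights // -(star_density_sum1 s0); apply: eq_bigr => y _; rewrite dE.
move=> s sX.
have pos_s v : 0 < star_density kap (s v).
  rewrite divr_gt0 // -(XP s sX) ltr0n /sym_count (bigD1 v) //= ltn_addr // card_gt0.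
  by apply/set0Pn; exists 1%g; rewrite inE star_act1.
rewrite -[leRHS]lnK ?posrE ?prodr_gt0 // ler_expR ln_prod //.
rewrite /entropy mulrN opprK mulr_sumr.
rewrite -(@ler_pM2r _ (d`!)%:R) ?ltr0n ?fact_gt0 //.
rewrite mulr_suml [leRHS]mulr_suml.
rewrite [leRHS](eq_bigr (fun v => \sum_(a : 'S_d) ln (star_density kap (star_act (s v) a)))).
  rewrite -(sum_sym_count s (fun x => ln (star_density kap x))) le_eqVlt; apply/orP; left; apply/eqP.
  apply: eq_bigr => y _; rewrite (XP s sX).
  have -> : (kap y)%:R = n%:R * star_density kap y * (d`!)%:R :> R.
    rewrite /star_density natrM; field.
    by rewrite !pnatr_eq0 -!lt0n fact_gt0 n0.
  by ring.
move=> v _; rewrite (eq_bigr (fun=> ln (star_density kap (s v)))) => [|a _].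
  by rewrite sumr_const card_Sn mulr_natr.
by rewrite /star_density -!(XP s sX) sym_count_act.
Qed.

Section OneStar.
Variable s : {ffun 'I_n -> S}.

Let H := ('I_n * 'I_d)%type.
Let t : H -> T * T := half_edge_type s.

Definition edge_density (a : T * T) : R := #|fibre t a|%:R / #|{: H}|%:R.

Let cardH : #|{: H}| = #|{: pos}|.
Proof. by rewrite !card_prod !card_ord card_bool mulnC -EM mulnC. Qed.

Let H0 : (0 < #|{: H}|)%N.
Proof. by rewrite card_prod !card_ord muln_gt0 n0 /=; case: (d) i0 => // -[]. Qed.

Let H0' : 0 < #|{: H}|%:R :> R. Proof. by rewrite ltr0n. Qed.

Definition word_type (w : {ffun 'I_E -> T * T}) (p : pos) : T * T :=
  if p.2 then ((w p.1).2, (w p.1).1) else w p.1.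

Definition balanced : {set {ffun 'I_E -> T * T}} :=
  [set w | [forall a, #|fibre (word_type w) a| == #|fibre t a|]]%SET.

Let h0 (p : pos) : H := enum_val (cast_ord (esym cardH) (enum_rank p)).

Let h0_inj : injective h0.
Proof. by move=> p q /enum_val_inj /cast_ord_inj /enum_rank_inj. Qed.

Let h0_surj h : exists p, h0 p = h.
Proof.
exists (enum_val (cast_ord cardH (enum_rank h))).
by rewrite /h0 enum_valK cast_ordK enum_rankK.
Qed.

Let fibre_h0 a : #|fibre (t \o h0) a| = #|fibre t a|.
Proof.
rewrite -(card_imset _ h0_inj); apply: eq_card => h; rewrite inE.
apply/imsetP/eqP => [[p pP ->]|<-].
  by move: pP; rewrite inE => /eqP.
by have [p <-] := h0_surj h; exists p; rewrite // inE.
Qed.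

(** Sorted by the word of types at the [false] ends: reversal dictates the types at the other ends,
    and then the matching is a bijection between two coloured sets of equal size. *)
Lemma card_matchings_le : (#|matchings E s| <= #|balanced| * \prod_a (#|fibre t a|)`!)%N.
Proof.
pose wd (p : {ffun pos -> H}) : {ffun 'I_E -> T * T} := [ffun j => t (p (j, false))].
rewrite -sum1_card (partition_big wd predT) //= -sum_nat_const [leqRHS]big_mkcond.
apply: leq_sum => w _.
have wdE (p : {ffun pos -> H}) : (p \in matchings E s) && (wd p == w) ->
    injective p /\ forall q, t (p q) = word_type w q.
  rewrite inE => /andP[/andP[/injectiveP pi /forallP H1] /eqP <-]; split=> // -[j []].
    by rewrite /word_type /= ffunE; apply/eqP/H1.
  by rewrite /word_type /= ffunE.
pose inv (h : H) := enum_val (cast_ord cardH (enum_rank h)).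
have h0K h : h0 (inv h) = h by rewrite /h0 /inv enum_valK cast_ordK enum_rankK.
have inv_inj : injective inv by move=> x y e; rewrite -(h0K x) e h0K.
pose pf (p : {ffun pos -> H}) (q : pos) : pos := inv (p q).
pose sg (p : {ffun pos -> H}) : {perm pos} :=
  if pselect (injective p) is left pi then perm (inj_comp inv_inj pi : injective (pf p)) else 1%g.
have sgE (p : {ffun pos -> H}) q : injective p -> h0 (sg p q) = p q.
  by move=> pi; rewrite /sg; case: pselect => // pi'; rewrite permE /pf h0K.
have := @card_perm_coloring _ _ (word_type w) (t \o h0).
have -> : [forall a, #|fibre (word_type w) a| == #|fibre (t \o h0) a|] = (w \in balanced).
  by rewrite inE; apply/eq_forallb => a; rewrite fibre_h0.
move=> cE.
have -> : (if w \in balanced then \prod_a (#|fibre t a|)`! else 0)%N =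
   (if w \in balanced then \prod_a (#|fibre (word_type w) a|)`! else 0)%N.
  case: ifP => // wb; apply: eq_bigr => a _.
  by move: wb; rewrite inE => /forallP/(_ a)/eqP ->.
rewrite -cE -sum1_card.
apply: (@leq_sum_inj _ _ (fun p => (p \in matchings E s) && (wd p == w)) _ sg (fun=> 1%N)).
  move=> p p' /wdE[pi _] /wdE[pi' _] e; apply/ffunP => q.
  by rewrite -(sgE p) // e sgE.
move=> p /wdE[pi ht]; rewrite inE; apply/forallP => q.
by rewrite /= sgE // ht.
Qed.

(** A word has length [E], although it fixes the types of [2 E] half-edges. For a balanced word the
    density is invariant under reversal, so the two ends of an edge contribute the same logarithm
    and only [E H] remains. *)
Lemma card_balanced : #|balanced|%:R <= expR (E%:R * entropy edge_density).
Proof.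
have bP w : w \in balanced -> forall a, #|fibre (word_type w) a| = #|fibre t a|.
  by rewrite inE => /forallP h a; exact/eqP.
apply: (@card_by_weight _ _ _ (fun w : {ffun 'I_E -> T * T} => \prod_j edge_density (w j))).
- by move=> w; apply: prodr_ge0 => j _; rewrite divr_ge0.
- by rewrite sum_prod_weights // -mulr_suml -natr_sum sum_fibre divff // gt_eqF.
move=> w wb.
have pos_w j : 0 < edge_density (w j).
  rewrite divr_gt0 // ltr0n -(bP w wb) card_gt0; apply/set0Pn.
  by exists (j, false); rewrite inE.
have sw a : edge_density (a.2, a.1) = edge_density a.
  rewrite /edge_density -!(bP w wb); congr (_%:R / _).
  pose fl (p : pos) := (p.1, ~~ p.2).
  have flI : injective fl by move=> [? ?] [? ?] [-> /negb_inj ->].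
  rewrite -(card_imset (pred_of_set (fibre (word_type w) a)) flI); apply: eq_card => p; rewrite inE.
  apply/eqP/imsetP => [e|[q qP ->]].
    exists (fl p); last by rewrite /fl /= negbK; case: (p).
    rewrite inE; apply/eqP; move: e; rewrite /word_type /fl /=.
    by case: (p.2) => /=; case: (w p.1) a => [x y] [x' y'] /= [-> ->].
  move: qP; rewrite inE => /eqP <-; rewrite /word_type /fl /=.
  by case: (q.2) => //=; case: (w q.1).
rewrite -[leRHS]lnK ?posrE ?prodr_gt0 // ler_expR ln_prod //.
rewrite -(@ler_pM2l _ 2) // le_eqVlt; apply/orP; left; apply/eqP.
have -> : 2 * (\sum_j ln (edge_density (w j))) = \sum_(p : pos) ln (edge_density (word_type w p)).
  rewrite -(pair_bigA _ (fun j b => ln (edge_density (word_type w (j, b))))) /=.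
  rewrite mulr_sumr; apply: eq_bigr => j _.
  by rewrite big_bool /= /word_type /= sw; lra.
have := @sum_counts_entropy R _ _ (word_type w) => e.
rewrite -[RHS](_ : \sum_p ln (#|fibre (word_type w) (word_type w p)|%:R / #|{: pos}|%:R) = _); last first.
  by apply: eq_bigr => p _; rewrite (bP w wb) -cardH.
rewrite -e /entropy !mulrN opprK mulrA mulr_sumr; apply: eq_bigr => a _.
rewrite (bP w wb) -cardH -/(edge_density a) mulrA; congr (_ * _).
have -> : 2 * E%:R = #|{: pos}|%:R :> R by rewrite card_prod card_ord card_bool natrM mulrC.
by rewrite /edge_density cardH mulrC divfK // -cardH gt_eqF.
Qed.

(** The words contribute [E H] and the factorials [- d n H], which is [- 2 E H]. *)
Lemma card_matchings_entropy : #|matchings E s|%:R <=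
  expR (ln ((d * n)`!)%:R + #|{: T * T}|%:R * (1 + ln (d * n).+1%:R) - E%:R * entropy edge_density).
Proof.
apply: le_trans (_ : (#|balanced| * \prod_a (#|fibre t a|)`!)%:R <= _).
  by rewrite ler_nat card_matchings_le.
have HM : #|{: H}| = (d * n)%N by rewrite card_prod !card_ord mulnC.
rewrite natrM.
have p0 : 0 < (\prod_a (#|fibre t a|)`!)%:R :> R.
  by rewrite ltr0n prodn_gt0 // => a; exact: fact_gt0.
rewrite -[X in _ * X]lnK ?posrE // natr_prod ln_prod => [|a _]; last by rewrite ltr0n fact_gt0.
have := @prod_fact_le R _ _ t H0.
rewrite HM -/(edge_density) => pf.
have eE : entropy edge_density = entropy (fun a => #|fibre t a|%:R / (d * n)%:R).
  by rewrite /edge_density HM.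
rewrite -eE in pf.
set c := ln _ + _ * _ in pf; apply: le_trans (_ : expR (E%:R * entropy edge_density) * expR (c - (d * n)%:R * entropy edge_density) <= _).
  by apply: ler_pM; rewrite ?expR_ge0 ?card_balanced ?ler_expR.
by rewrite -expRD ler_expR /c -EM natrM; lra.
Qed.

Definition edge_marginal (P : S -> R) (a : T * T) : R :=
  d%:R^-1 * \sum_i \sum_(x : S | x.2 i == a) P x.

Lemma edge_densityE : edge_density =1 edge_marginal (star_density (sym_count s)).
Proof.
move=> a; rewrite /edge_marginal (exchange_big_dep xpredT) //=.
have d0 : d%:R != 0 :> R by rewrite pnatr_eq0; case: (d) i0 => // -[].
transitivity ((d%:R^-1 : R) * \sum_(x : S) (sym_count s x)%:R * (\sum_(i < d) (x.2 i == a)%:R / (n * d`!)%:R : R)); last first.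
  congr (_ * _); apply: eq_bigr => x _; rewrite mulr_sumr [RHS]big_mkcond /=; apply: eq_bigr => i _.
  by case: eqP => _; rewrite ?mul1r ?mul0r ?mulr0.
rewrite (sum_sym_count s (fun x : S => \sum_(i < d) (x.2 i == a)%:R / (n * d`!)%:R : R)).
have e (v : 'I_n) (b : 'S_d) : \sum_(i < d) ((star_act (s v) b).2 i == a)%:R / (n * d`!)%:R =
    #|[set i | t (v, i) == a]%SET|%:R / (n * d`!)%:R :> R.
  rewrite -mulr_suml; congr (_ / _); rewrite -sum1_card natr_sum [RHS](reindex_inj (@perm_inj _ b)).
  rewrite [RHS]big_mkcond /=; apply: eq_bigr => i _.
  by rewrite inE ffunE; case: eqP.
under eq_bigr => v _ do (under eq_bigr => b _ do rewrite e).
rewrite (eq_bigr (fun v => #|[set i | t (v, i) == a]%SET|%:R / n%:R)) => [|v _]; last first.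
  rewrite sumr_const card_Sn -[LHS]mulr_natl natrM invfM mulrCA; congr (_ * _).
  by rewrite mulrCA divff ?mulr1 // pnatr_eq0 -lt0n fact_gt0.
rewrite -mulr_suml -natr_sum /edge_density.
have -> : #|fibre t a| = (\sum_v #|[set i | t (v, i) == a]%SET|)%N.
  rewrite -sum1_card (eq_bigl (fun h => xpredT h.1 && (t (h.1, h.2) == a))); last by case=> v i; rewrite inE.
  rewrite -(pair_big_dep xpredT (fun v i => t (v, i) == a) (fun _ _ => 1%N)) /=.
  by apply: eq_bigr => v _; rewrite sum1_card; apply: eq_card => i; rewrite inE.
rewrite card_prod !card_ord natrM; field.
by rewrite d0 pnatr_eq0 -lt0n n0.
Qed.

End OneStar.

Lemma card_pairs_le (kap : S -> nat) :
  #|[set x : graph n * {ffun 'I_n -> F} | regular d x.1 && [forall y, star_count x.1 x.2 y == kap y]]%SET|%:R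
    * ((d`!) ^ n * E`! * 2 ^ E)%:R <=
  expR (n%:R * (entropy (star_density kap) - d%:R / 2 * entropy (edge_marginal (star_density kap)))
    + ln ((d * n)`!)%:R + #|{: T * T}|%:R * (1 + ln (d * n).+1%:R)) :> R.
Proof.
have := pairs_bound i0 EM kap; rewrite -(ler_nat R) natrM => /le_trans; apply.
rewrite natr_sum.
have En : E%:R = n%:R * (d%:R / 2) :> R.
  by apply: (@mulfI _ 2%:R) => //; rewrite -natrM EM natrM; lra.
pose c : R := ln ((d * n)`!)%:R + #|{: T * T}|%:R * (1 + ln (d * n).+1%:R).
apply: le_trans (_ : \sum_(s : {ffun 'I_n -> S} | [forall y, sym_count s y == kap y])
   expR (c - E%:R * entropy (edge_marginal (star_density kap))) <= _).
  apply: ler_sum => s /forallP sk; apply: le_trans (card_matchings_entropy s) _.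
  rewrite le_eqVlt; apply/orP; left; apply/eqP; rewrite -/c; congr (expR (_ - _ * entropy _)).
  apply/funext => a; rewrite edge_densityE; congr edge_marginal; apply/funext => y.
  by rewrite /star_density (eqP (sk y)).
rewrite sumr_const -[leLHS]mulr_natl.
apply: le_trans (ler_wpM2r _ (_ : _ <= expR (n%:R * entropy (star_density kap)))) _.
- exact: expR_ge0.
- by apply: le_trans (card_sym_class kap); rewrite ler_nat; apply/subset_leq_card/fintype.subsetP => s; rewrite !inE.
by rewrite -expRD ler_expR En /c; lra.
Qed.

End UpperBound.

(** * Continuity of entropy and comparison of logarithmic with linear growth *)

Section Continuity.
Variable R : realType.
Implicit Types x y : R.

(** From [ln y <= y - 1] at [y = x^(-1/2)]; gives continuity of [x * ln x] at 0. *)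
Lemma xlnx_small x : 0 < x -> x < 1 -> `|x * ln x| <= 2 * Num.sqrt x.
Proof.
move=> x0 x1; have s0 : 0 < Num.sqrt x by rewrite sqrtr_gt0.
rewrite ler0_norm; last by rewrite pmulr_rle0 // ln_le0 // ltW.
have e : ln x = - (2 * ln (Num.sqrt x)^-1).
  by rewrite -{1}(sqr_sqrtr (ltW x0)) lnXn // lnV ?posrE // mulrN opprK mulr_natl.
rewrite e mulrN opprK mulrCA ler_pM2l // -{1}(sqr_sqrtr (ltW x0)) expr2 -mulrA ler_piMr ?(ltW s0) //.
rewrite mulrC -ler_pdivlMr // div1r.
by apply: le_trans (ln_le_sub1 _) _; rewrite ?invr_gt0 // gerBl.
Qed.

Lemma xlnx_cont x (eps : R) : 0 < eps ->
  exists2 del : R, 0 < del & forall y, `|y - x| < del -> `|y * ln y - x * ln x| < eps.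
Proof.
move=> e0; case: (ltrgtP x 0) => x0.
- exists (- x) => [|y]; first by rewrite oppr_gt0.
  rewrite ltr_norml => /andP[_ yx]; have y0 : y < 0 by move: yx; rewrite ltrBlDr addNr.
  by rewrite (ln0 (ltW y0)) (ln0 (ltW x0)) !mulr0 subrr normr0.
- have c : {for x, continuous (fun y => y * ln y)}.
    by apply: continuousM; [exact: cvg_id|exact: continuous_ln].
  have /cvgrPdist_lt/(_ _ e0)/nbhs_ballP[del /= d0 H] := c.
  exists del => // y yx; have := H y; rewrite /ball /= distrC [X in _ -> X < _]distrC; apply.
  exact: yx.
exists (Num.min 1 ((eps / 2) ^+ 2)) => [|y]; first by rewrite lt_min ltr01 exprn_gt0 // divr_gt0.
rewrite x0 subr0 mul0r subr0 lt_min => /andP[y1 y2].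
have [y0|y0] := ltP 0 y; last by rewrite (ln0 y0) mulr0 normr0.
rewrite gtr0_norm // in y1 y2.
apply: le_lt_trans (xlnx_small y0 y1) _.
rewrite mulrC -ltr_pdivlMr //.
by rewrite -(@ltr_pXn2r _ 2) ?nnegrE ?sqrtr_ge0 ?divr_ge0 ?ltW // sqr_sqrtr // ltW.
Qed.

Lemma finite_delta (A : finType) (Pr : A -> R -> Prop) :
  (forall a (t u : R), u <= t -> Pr a t -> Pr a u) ->
  (forall a, exists2 del : R, 0 < del & Pr a del) -> exists2 del : R, 0 < del & forall a, Pr a del.
Proof.
move=> mon H; have /choice[f fP] : forall a, exists t : R, 0 < t /\ Pr a t.
  by move=> a; have [t t0 Pt] := H a; exists t.
exists (\big[Num.min/1]_a f a) => [|a].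
  apply: (big_ind (fun x => 0 < x)) => [|x y x0 y0|a _]; first exact: ltr01.
    by rewrite lt_min x0 y0.
  by have [] := fP a.
by apply: (mon a (f a)); [rewrite (bigD1 a) //= ge_min lexx|exact: (fP a).2].
Qed.

Lemma entropy_cont (A : finType) (p : A -> R) (eps : R) : 0 < eps ->
  exists2 del : R, 0 < del & forall p' : A -> R, (forall a, `|p' a - p a| <= del) ->
     `|entropy p' - entropy p| <= eps.
Proof.
move=> e0; pose e1 := eps / #|A|.+1%:R.
have e10 : 0 < e1 by rewrite divr_gt0.
have [|a|del d0 H] := @finite_delta A (fun a t => forall y, `|y - p a| <= t -> `|y * ln y - p a * ln (p a)| <= e1).
- by move=> a t u ut h y yu; apply: h; exact: le_trans ut.
- have [del d0 h] := xlnx_cont (p a) e10; exists (del / 2); first by rewrite divr_gt0.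
  by move=> y yd; apply/ltW/h; apply: le_lt_trans yd _; rewrite ltr_pdivrMr // ltr_pMr // ltr1n.
exists del => // p' hp; rewrite /entropy opprK addrC -sumrB.
apply: le_trans (ler_norm_sum _ _ _) _.
apply: le_trans (_ : \sum_(a : A) e1 <= _).
  by apply: ler_sum => a _; rewrite distrC; exact: H.
rewrite sumr_const cardT -cardE -[_ *+ _]mulr_natr /e1 mulrAC ler_pdivrMr //.
by rewrite ler_pM2l // ler_nat.
Qed.

Lemma ln_nat_small (C1 C2 eps : R) : 0 < C2 -> 0 < eps ->
  exists N : nat, forall n : nat, (N <= n)%N -> (0 < n)%N -> C1 + C2 * ln n%:R <= eps * n%:R.
Proof.
(* With this scale, [ln y <= y - 1] at [y = n t] makes the logarithm cost half of [eps * n] plus a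
   constant. *)
move=> C20 e0; pose t := eps / (2 * C2).
have t0 : 0 < t by rewrite divr_gt0 // mulr_gt0.
pose C := C1 + C2 * (- 1 - ln t).
have [N /ltW HN] : exists N : nat, C / (eps / 2) < N%:R.
  have /archi_boundP := normr_ge0 (C / (eps / 2)).
  by move=> h; eexists; apply: le_lt_trans (ler_norm _) h.
exists N => n Nn n0; have n0' : 0 < n%:R :> R by rewrite ltr0n.
have := ln_le_sub1 (mulr_gt0 n0' t0); rewrite lnM ?posrE // => h.
have h2 : C2 * ln n%:R <= C2 * (n%:R * t - 1 - ln t) by rewrite ler_pM2l //; lra.
have h3 : C2 * (n%:R * t) = n%:R * (eps / 2).
  by rewrite /t; field; rewrite ?mulf_neq0 ?gt_eqF //; lra.
have h4 : C <= n%:R * (eps / 2).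
  rewrite -ler_pdivrMr ?divr_gt0 //; apply: le_trans HN _; by rewrite ler_nat.
have -> : eps * n%:R = n%:R * (eps / 2) + n%:R * (eps / 2) by field.
move: h4; rewrite /C; nra.
Qed.

End Continuity.

(** * Asymptotic form of the counting bounds *)

Section Asymptotics.
Variables (R : realType) (d k : nat) (F : finType).
Hypothesis d1 : (1 < d)%N.

Notation T := (bt d F k).
Notation S := (star_type d F k).

Definition edge_vertex_entropy (P : S -> R) : R :=
  entropy P - d%:R / 2 * entropy (edge_marginal P).

Lemma edge_vertex_entropy_cont (P : S -> R) (eps : R) : 0 < eps ->
  exists2 del : R, 0 < del & forall P' : S -> R, (forall x, `|P' x - P x| <= del) ->
    `|edge_vertex_entropy P' - edge_vertex_entropy P| <= eps.
Proof.
move=> e0; have d0 : 0 < d%:R :> R by rewrite ltr0n ltnW.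
have e1 : 0 < eps / 2 by rewrite divr_gt0.
have e2 : 0 < eps / d%:R by rewrite divr_gt0.
have [del1 d10 H1] := entropy_cont P e1.
have [del2 d20 H2] := entropy_cont (edge_marginal P) e2.
have S0 : 0 < #|{: S}|.+1%:R :> R by rewrite ltr0n.
exists (Num.min del1 (del2 / #|{: S}|.+1%:R)) => [|P' hP]; first by rewrite lt_min d10 divr_gt0.
have h1 : `|entropy P' - entropy P| <= eps / 2.
  by apply: H1 => x; apply: le_trans (hP x) _; rewrite ge_min lexx.
have h2 : `|entropy (edge_marginal P') - entropy (edge_marginal P)| <= eps / d%:R.
  apply: H2 => a; rewrite /edge_marginal -mulrBr -sumrB normrM ger0_norm ?invr_ge0 ?ler0n //.
  rewrite ler_pdivrMl //.
  apply: le_trans (ler_norm_sum _ _ _) _.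
  apply: le_trans (_ : \sum_(i < d) del2 <= _); last by rewrite sumr_const card_ord mulr_natl.
  apply: ler_sum => i _; rewrite -sumrB.
  apply: le_trans (ler_norm_sum _ _ _) _.
  apply: le_trans (_ : \sum_(x : S) (del2 / #|{: S}|.+1%:R) <= _).
    rewrite [leLHS]big_mkcond; apply: ler_sum => x _; case: ifP => _.
      by apply: le_trans (hP x) _; rewrite ge_min lexx orbT.
    by rewrite divr_ge0 ?ltW.
  rewrite sumr_const cardT -cardE -[_ *+ _]mulr_natr mulrAC ler_pdivrMr //.
  by rewrite ler_pM2l // ler_nat.
have -> : edge_vertex_entropy P' - edge_vertex_entropy P = (entropy P' - entropy P) -
   d%:R / 2 * (entropy (edge_marginal P') - entropy (edge_marginal P)).
  by rewrite /edge_vertex_entropy; ring.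
apply: le_trans (ler_normB _ _) _; rewrite normrM (ger0_norm (_ : 0 <= d%:R / 2)) ?divr_ge0 ?ler0n //.
have h3 : d%:R / 2 * `|entropy (edge_marginal P') - entropy (edge_marginal P)| <= d%:R / 2 * (eps / d%:R).
  by rewrite ler_pM2l // divr_gt0.
have h4 : d%:R / 2 * (eps / d%:R) = eps / 2 by field; rewrite gt_eqF.
lra.
Qed.

Definition near_pairs n (q : S -> R) (del : R) : {set graph n * {ffun 'I_n -> F}} :=
  [set x : graph n * {ffun 'I_n -> F} | regular d x.1 &&
     `[< forall y, `|star_density R n (star_count x.1 x.2) y - q y| <= del >]]%SET.

Definition num_regular n : nat := #|[pred G : graph n | regular d G]|.

Lemma star_count_le n (G : graph n) (g : 'I_n -> F) (x : S) : regular d G ->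
  (star_count G g x <= n * d`!)%N.
Proof.
move=> rG; rewrite /star_count -[X in (_ <= X * _)%N]card_ord -sum_nat_const.
apply: leq_sum => v _; rewrite -(card_Theta rG v).
by apply/subset_leq_card/fintype.subsetP => th; rewrite inE => /andP[].
Qed.

Lemma ln_le_lnM (a n m : nat) : (0 < a)%N -> (0 < n)%N -> (m <= a * n)%N -> (0 < m)%N ->
  ln m%:R <= ln a%:R + ln n%:R :> R.
Proof.
move=> a0 n0 man m0; rewrite -lnM ?posrE ?ltr0n // -natrM ler_ln ?posrE ?ltr0n ?muln_gt0 ?a0 //.
by rewrite ler_nat.
Qed.

Lemma num_regular_lower (eps : R) : 0 < eps -> exists N : nat, forall n E : nat, (N <= n)%N ->
  (2 * E = d * n)%N ->
  ln ((d * n)`!)%:R <= eps * n%:R + ln ((d`!) ^ n * E`! * 2 ^ E * num_regular n)%:R /\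
  (0 < num_regular n)%N.
Proof.
move=> e0; have e2 : 0 < eps / 2 by rewrite divr_gt0.
have d0 : (0 < d)%N by exact: ltnW.
have d0' : 0 < d%:R :> R by rewrite ltr0n.
(* There are [E = n d / 2] insertions, each losing at most [ln ((q+1)/q) <= 1/q]; this [q] keeps the
   total below half of [eps * n]. *)
have [q q0 hq] : exists2 q : nat, (0 < q)%N & d%:R / 2 / q%:R <= eps / 2.
  have [q /ltW hq] : exists q : nat, d%:R / eps < q%:R.
    by have /archi_boundP h := normr_ge0 (d%:R / eps : R); eexists; apply: le_lt_trans (ler_norm _) h.
  have q0 : 0 < q%:R :> R by apply: lt_le_trans hq; rewrite divr_gt0.
  exists q; first by rewrite -(ltr0n R).
  rewrite ler_pdivrMr // mulrAC ler_pM2r ?invr_gt0 // mulrC.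
  by rewrite -ler_pdivrMr.
pose L := (d.+1 * d * q.+1).+1.
have L0 : (0 < L)%N by [].
have C20 : 0 < (4 * L)%:R :> R by rewrite ltr0n muln_gt0.
(* The constants come from the logarithm of [(L^2 n^4)^L], the loss of the final phase. *)
have [N1 H1] := ln_nat_small ((2 * L)%:R * ln L%:R) C20 e2.
exists (maxn N1 (d.+1 * d + d.+1 * d + L).+1) => n E; rewrite geq_max => /andP[nN1 nN2] EM.
have n0 : (0 < n)%N by exact: leq_trans nN2.
have bigL : (d.+1 * d + d.+1 * d + L < d * n)%N.
  by apply: leq_trans nN2 _; rewrite leq_pmull.
have cL : (d.+1 * d * q.+1 < L)%N by [].
have od : ~~ odd (d * n) by rewrite -EM oddM.
have EM' : (2 * E <= d * n)%N by rewrite EM.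
have := ffact_weighted_count q0 cL bigL EM' od.
rewrite EM subnn subn0 ffactnn weighted_count_regular -/(num_regular n) => H.
have N0 : (0 < num_regular n)%N.
  rewrite lt0n; apply: contraTneq H => ->; rewrite !muln0 -ltnNge.
  by rewrite muln_gt0 expn_gt0 q0 fact_gt0.
split=> //.
have W0 : (0 < d`! ^ n * E`! * 2 ^ E * num_regular n)%N.
  by rewrite !muln_gt0 !expn_gt0 !fact_gt0 N0.
have eW : (2 ^ E * E`! * (d`! ^ n * num_regular n) = d`! ^ n * E`! * 2 ^ E * num_regular n)%N.
  by move: (2 ^ E)%N (E`!) (d`! ^ n)%N => a b c; ring.
rewrite eW in H.
have K0 : (0 < L ^ 2 * n ^ 4)%N by rewrite muln_gt0 !expn_gt0 n0.
have A0 : (0 < q ^ E * (d * n)`!)%N by rewrite muln_gt0 expn_gt0 q0 fact_gt0.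
have K1 : (0 < q.+1 ^ E * (L ^ 2 * n ^ 4) ^ L)%N by rewrite muln_gt0 !expn_gt0 K0.
have B0 : (0 < q.+1 ^ E * (L ^ 2 * n ^ 4) ^ L * (d`! ^ n * E`! * 2 ^ E * num_regular n))%N.
  by rewrite muln_gt0 K1 W0.
have H' : ln (q ^ E * (d * n)`!)%:R <= ln (q.+1 ^ E * (L ^ 2 * n ^ 4) ^ L *
      (d`! ^ n * E`! * 2 ^ E * num_regular n))%:R :> R.
  by rewrite ler_ln ?posrE ?(ltr0n, A0, B0) // ler_nat.
have lnN (a b : nat) : (0 < a)%N -> (0 < b)%N -> ln (a * b)%:R = ln a%:R + ln b%:R :> R.
  by move=> a0 b0; rewrite natrM lnM ?posrE ?ltr0n.
have lnE (a b : nat) : (0 < a)%N -> ln (a ^ b)%:R = b%:R * ln a%:R :> R.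
  by move=> a0; rewrite natrX lnXn ?ltr0n // mulr_natl.
have qE0 : (0 < q ^ E)%N by rewrite expn_gt0 q0.
rewrite (lnN (q ^ E)%N) ?fact_gt0 // (lnN (q.+1 ^ E * (L ^ 2 * n ^ 4) ^ L)%N) // in H'.
have L20 : (0 < L ^ 2)%N by rewrite expn_gt0.
have n40 : (0 < n ^ 4)%N by rewrite expn_gt0 n0.
rewrite (lnN (q.+1 ^ E)%N) ?expn_gt0 ?K0 // !lnE // (lnN (L ^ 2)%N) // !lnE // in H'.
  have q0' : 0 < q%:R :> R by rewrite ltr0n.
  have hE : E%:R * (ln q.+1%:R - ln q%:R) <= eps / 2 * n%:R.
    have e : E%:R = q%:R * (n%:R * (d%:R / 2 / q%:R)) :> R.
      have -> : q%:R * (n%:R * (d%:R / 2 / q%:R)) = d%:R * n%:R / 2 :> R.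
        by field; rewrite gt_eqF.
      by rewrite -natrM -EM natrM mulrAC divff // mul1r.
    have z0 : 0 <= d%:R / 2 / q%:R :> R by rewrite !divr_ge0.
    have y1 := lnS_diff_le R q0.
    have -> : E%:R * (ln q.+1%:R - ln q%:R) =
       n%:R * (d%:R / 2 / q%:R) * (q%:R * (ln q.+1%:R - ln q%:R)) :> R by rewrite {1}e; ring.
    apply: le_trans (ler_wpM2l _ y1) _; first by rewrite mulr_ge0.
    by rewrite mulr1 mulrC ler_wpM2r.
rewrite mulrBr in hE; rewrite mulrDr in H'; have h1 := H1 n nN1 n0; rewrite !natrM in h1. clear -hE H' h1. move: hE H' h1. set Y := ln (_ * num_regular n)%:R. set Z := ln ((d*n)`!)%:R. clearbody L Y Z. lra.
Qed.

(** Only polynomially many vectors of star counts exist. For each one near [q], [card_pairs_le] and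
    continuity bound the number of pairs. Of [eps], one quarter pays for continuity, one for
    [num_regular_lower], and half for the polynomial factors. *)
Lemma near_pairs_upper (q : S -> R) (eps : R) : 0 < eps ->
  exists2 del : R, 0 < del & exists N : nat, forall n E : nat, (N <= n)%N -> (2 * E = d * n)%N ->
    #|near_pairs n q del|%:R <= (num_regular n)%:R * expR (n%:R * (edge_vertex_entropy q + eps)).
Proof.
move=> e0; have e4 : 0 < eps / 4 by rewrite divr_gt0.
have [del d0 Hc] := edge_vertex_entropy_cont q e4.
have [N1 H1] := num_regular_lower e4.
pose A : R := #|{: T * T}|%:R; pose B : R := #|{: S}|%:R.
have C20 : 0 < A + B + 1 by rewrite ltr_wpDl // addr_ge0.
have e2 : 0 < eps / 2 by rewrite divr_gt0.
have [N2 H2] := ln_nat_small (A * (1 + ln d.+1%:R) + B * ln (d`!).+1%:R) C20 e2.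
have i0 : 'I_d by exact: (Ordinal (ltnW d1)).
exists del => //; exists (maxn (maxn N1 N2) 1) => n E; rewrite !geq_max => /andP[/andP[n1 n2] n0] EM.
have [h1 N0] := H1 n E n1 EM; have h2 := H2 n n2 n0.
pose W := ((d`!) ^ n * E`! * 2 ^ E)%N.
have W0 : 0 < W%:R :> R by rewrite ltr0n !muln_gt0 !expn_gt0 !fact_gt0.
have n0' : 0 < n%:R :> R by rewrite ltr0n.
pose bnd : R := expR (n%:R * (edge_vertex_entropy q + eps / 4) + ln ((d * n)`!)%:R +
   A * (1 + ln (d * n).+1%:R)) / W%:R.
have bnd0 : 0 <= bnd by rewrite divr_ge0 ?expR_ge0 ?ler0n.
pose cnt (x : graph n * {ffun 'I_n -> F}) : {ffun S -> 'I_(n * d`!).+1} :=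
  [ffun y => inord (star_count x.1 x.2 y)].
have step1 : #|near_pairs n q del|%:R <= #|{: {ffun S -> 'I_(n * d`!).+1}}|%:R * bnd.
  rewrite -sum1_card (partition_big cnt predT) //= natr_sum.
  apply: le_trans (_ : \sum_(kap : {ffun S -> 'I_(n * d`!).+1}) bnd <= _); last first.
    by rewrite sumr_const mulr_natl.
  apply: ler_sum => kap _; rewrite sum1_card.
  pose Xk := [set x : graph n * {ffun 'I_n -> F} | regular d x.1 && [forall y, star_count x.1 x.2 y == kap y]]%SET.
  have cntE x : x \in near_pairs n q del -> cnt x == kap -> x \in Xk.
    rewrite !inE => /andP[rx _] /eqP <-; rewrite rx; apply/forallP => y.
    by rewrite ffunE inordK // ltnS star_count_le.
  case: (pickP (fun x => (x \in near_pairs n q del) && (cnt x == kap))) => [x /andP[xn xk]|H0]; last first.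
    by rewrite eq_card0 // => x; exact: H0.
  have := @card_pairs_le R d n k E F i0 EM n0 (fun y => kap y : nat); rewrite -/Xk -/W -ler_pdivlMr // => h.
  apply: le_trans (_ : #|Xk|%:R <= _).
    rewrite ler_nat; apply/subset_leq_card/fintype.subsetP => z /andP[z1 z2]; exact: cntE.
  apply: le_trans h _; rewrite /bnd ler_pM2r ?invr_gt0 // ler_expR !lerD2r ler_pM2l //.
  rewrite -/(edge_vertex_entropy (star_density R n (fun y => kap y : nat))).
  have near_k y : `|star_density R n (fun y => kap y : nat) y - q y| <= del.
    have := cntE x xn xk; rewrite inE => /andP[_ /forallP ek].
    move: xn; rewrite inE => /andP[_ /asboolP/(_ y)].
    by rewrite /star_density (eqP (ek y)).
  by have := Hc _ near_k; rewrite ler_norml => /andP[_]; lra.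
apply: le_trans step1 _.
have c0 : 0 < #|{: {ffun S -> 'I_(n * d`!).+1}}|%:R :> R.
  by rewrite ltr0n card_ffun expn_gt0 card_ord.
have lc : ln #|{: {ffun S -> 'I_(n * d`!).+1}}|%:R <= B * (ln (d`!).+1%:R + ln n%:R) :> R.
  rewrite card_ffun card_ord natrX lnXn ?ltr0n // -[leLHS]mulr_natl ler_wpM2l // ln_le_lnM //.
  by rewrite mulSn addnC mulnC -addn1 leq_add2l.
have ld : ln (d * n).+1%:R <= ln d.+1%:R + ln n%:R :> R.
  by apply: ln_le_lnM => //; rewrite mulSn addnC -addn1 leq_add2l.
have lA : A * (1 + ln (d * n).+1%:R) <= A * (1 + ln d.+1%:R) + A * ln n%:R.
  by rewrite -mulrDr ler_wpM2l // -addrA lerD2l.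
have N0' : 0 < (num_regular n)%:R :> R by rewrite ltr0n.
have ln0 : 0 <= ln n%:R :> R by rewrite ln_ge0 // ler1n.
rewrite -[X in X * bnd]lnK ?posrE // -[X in X * expR _]lnK ?posrE //.
have -> : bnd = expR (n%:R * (edge_vertex_entropy q + eps / 4) + ln ((d * n)`!)%:R +
   A * (1 + ln (d * n).+1%:R) - ln W%:R) by rewrite expRD expRN lnK ?posrE.
rewrite -!expRD ler_expR.
move: h1; rewrite natrM -/W lnM ?posrE // => h1.
move: h1 h2 lc lA ln0; rewrite !mulrDr !mulrDl.
set l1 := ln (W%:R); set l2 := ln ((d * n)`!)%:R; set l3 := ln #|_|%:R; set l4 := ln n%:R.
move: (edge_vertex_entropy q) => ph.
clearbody l1 l2 l3 l4 A B.
move: (A * ln d.+1%:R) (A * ln (d * n).+1%:R) (B * ln (d`!).+1%:R) (ln #|{: {ffun S -> 'I_(n * d`!).+1}}|%:R)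
  (n%:R * entropy q) (n%:R * - (d%:R / 2 * entropy (edge_marginal q))) => a1 a2 a3 a4 a5 a6.
move: (n%:R : R) => a7; lra.
Qed.

End Asymptotics.

(** * Collisions of covering maps *)

Section Collisions.
Variables (d n : nat) (G : graph n) (n0 : 'I_n) (r : nat).
Hypothesis Greg : regular d G.
Hypothesis r0 : (0 < r)%N.
Variable psi : {ffun 'I_(size (ball_root d r)) -> 'I_n}.
Hypothesis psiG : psi \in @covers d r n G.

Let f := look n0 psi.

Fixpoint reach j (x : 'I_n) : {set 'I_n} :=
  if j is j'.+1 then (x |: \bigcup_(y in G x) reach j' y)%SET else [set x]%SET.

Lemma reach_refl j x : x \in reach j x.
Proof. by case: j => [|j]; rewrite !inE eqxx. Qed.

Lemma card_reach j x : (#|reach j x| <= d.+1 ^ j)%N.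
Proof.
elim: j x => [|j IH] x; first by rewrite /= cards1.
rewrite /= expnS mulSn; apply: leq_trans (leq_card_setU _ _) _.
rewrite cards1; apply: leq_add; first by rewrite expn_gt0.
apply: leq_trans (_ : \sum_(y in G x) #|reach j y| <= _)%N.
  by apply: (big_ind2 (fun (A : {set 'I_n}) m => (#|A| <= m)%N)) => [|A a B b Aa Bb|//];
    [rewrite cards0|apply: leq_trans (leq_card_setU _ _) (leq_add Aa Bb)].
apply: leq_trans (_ : \sum_(y in G x) d.+1 ^ j <= _)%N; first exact: leq_sum.
by rewrite sum_nat_const (regular_card Greg).
Qed.

Let local p : (size (val p) < r)%N -> local_cover G f p.
Proof. exact: ((in_covers G n0 psi).1 psiG). Qed.

Lemma cover_step p c : (size (val p) < r)%N -> f (step p c) \in G (f p).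
Proof.
move=> pr; have := local pr; rewrite /local_cover => /(Theta_mem c).
by rewrite ffunE.
Qed.

Lemma cover_adj p q : adj p q -> (size (val p) <= r)%N -> (size (val q) <= r)%N -> f q \in G (f p).
Proof.
move=> /adjP[c ->] pr qr; case: (boolP (back p c)) => bc.
  have sb := size_step_back bc.
  rewrite (regular_sym Greg) -{1}(stepK c p); apply: cover_step.
  by rewrite -ltnS -sb.
by apply: cover_step; move: qr; rewrite size_step_fwd.
Qed.

Lemma cover_root_reach p : (size (val p) <= r)%N -> f (root_ d) \in reach r (f p).
Proof.
suff H j q : (size (val q) <= j)%N -> (j <= r)%N -> f (root_ d) \in reach j (f q) by move=> pr; exact: H.
elim: j q => [|j IH] q qj jr.
  have -> : q = root_ d by apply: val_inj; apply/eqP; rewrite -size_eq0 -leqn0.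
  exact: reach_refl.
case: (posnP (size (val q))) => [q0|q0].
  have -> : q = root_ d by apply: val_inj; apply/eqP; rewrite -size_eq0 q0.
  exact: reach_refl.
have [|c bc] := @back_ex d q; first by rewrite -size_eq0 -lt0n.
have sb := size_step_back bc.
rewrite /= !inE; apply/orP; right; apply/bigcupP; exists (f (step q c)).
  apply: cover_adj; first exact: adj_step; first exact: leq_trans jr.
  by rewrite -ltnS -sb ltnW // ltnS; exact: leq_trans jr.
by apply: IH; [rewrite -ltnS -sb|exact: ltnW].
Qed.

Definition ball_adj : rel (Vd d) :=
  fun p q => [&& adj p q, size (val p) <= r & size (val q) <= r]%N.

Lemma ball_path_root p : (size (val p) <= r)%N ->
  exists s, path ball_adj p s /\ last p s = root_ d.
Proof.
have [m] := ubnP (size (val p)); elim: m p => // m IH p; rewrite ltnS => pm pr.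
case: (posnP (size (val p))) => [p0|p0].
  by exists [::]; split=> //; apply: val_inj; apply/eqP; rewrite -size_eq0 p0.
have [|c bc] := @back_ex d p; first by rewrite -size_eq0 -lt0n.
have sb := size_step_back bc.
have sr : (size (val (step p c)) <= r)%N by rewrite ltnW // -sb.
have [|s [ps ls]] := IH (step p c) _ sr; first by rewrite -sb.
by exists (step p c :: s); rewrite /= ps andbT /ball_adj adj_step pr sr.
Qed.

Lemma ball_path p q : (size (val p) <= r)%N -> (size (val q) <= r)%N -> p != q ->
  exists s, [/\ path ball_adj p s, last p s = q, uniq (p :: s) & s != [::]].
Proof.
move=> pr qr pq.
have [s1 [ps1 ls1]] := ball_path_root pr; have [s2 [ps2 ls2]] := ball_path_root qr.
have bs : symmetric ball_adj by move=> x y; rewrite /ball_adj adj_sym [X in _ && X]andbC.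
have p3 : path ball_adj (root_ d) (rev (belast q s2)).
  rewrite -ls2 rev_path (eq_path (e' := ball_adj)) // => x y; exact: bs.
have l3 : last (root_ d) (rev (belast q s2)) = q.
  by case: (s2) ls2 => [|x s] //=; rewrite rev_cons last_rcons.
have pp : path ball_adj p (s1 ++ rev (belast q s2)) by rewrite cat_path ps1 ls1.
have lp : last p (s1 ++ rev (belast q s2)) = q by rewrite last_cat ls1.
case/shortenP: pp lp => s ps us _ ls; exists s; split=> //.
by apply: contra_neq pq => e; rewrite -ls e.
Qed.

Lemma collision_subpath p s : path ball_adj p s -> uniq (p :: s) -> ~~ uniq (map f (p :: s)) ->
  exists x t, [/\ path ball_adj x t, uniq (x :: t), f (last x t) = f x, t != [::] & (size t <= size s)%N].
Proof.
elim: s p => [|y s IH] p // ps us; rewrite map_cons cons_uniq negb_and negbK => /orP[/mapP[z zs fz]|nu].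
  case/splitPr: zs ps us => s1 s2 ps us; exists p, (rcons s1 z); split.
  - by move: ps; rewrite -cat_rcons cat_path => /andP[].
  - by move: us; rewrite -cat_rcons -cat_cons cat_uniq => /andP[].
  - by rewrite last_rcons fz.
  - by rewrite -size_eq0 size_rcons.
  by rewrite size_rcons size_cat /= addnS ltnS leq_addr.
case/andP: ps => _ ps; case/andP: us => _ us.
have [x [t [h1 h2 h3 h4 h5]]] := IH y ps us nu.
by exists x, t; split=> //; exact: leq_trans h5 (leqnSn _).
Qed.

Lemma has_path_edges x s : has_edges G (path_edges x s) = path (fun a b => b \in G a) x s.
Proof. by elim: s x => //= y s IH x; rewrite -IH. Qed.

(** Induction on the length: if the path without its last vertex has injective image, that image
    closes up to a simple cycle; otherwise it contains a shorter path with colliding ends. *)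
Lemma collision_cycle p s : path ball_adj p s -> uniq (p :: s) -> f (last p s) = f p -> s != [::] ->
  exists x t, [/\ uniq (map f (x :: t)), has_edges G (cycle_edges (f x) (map f t)), (1 < size t)%N,
     uniq (x :: t) & all (fun q => size (val q) <= r)%N (x :: t)].
Proof.
have [m] := ubnP (size s); elim: m p s => // m IH p s; rewrite ltnS => sm.
case/lastP: s sm => // s q; rewrite size_rcons => sm ps us; rewrite last_rcons => fq _.
have [ps1 bq] : path ball_adj p s /\ ball_adj (last p s) q by move: ps; rewrite rcons_path => /andP.
have us1 : uniq (p :: s) by move: us; rewrite -rcons_cons rcons_uniq => /andP[].
case: (boolP (uniq (map f (p :: s)))) => [uf|nuf]; last first.
  have [x [t [h1 h2 h3 h4 h5]]] := collision_subpath ps1 us1 nuf.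
  by apply: (IH x t) => //; apply: leq_ltn_trans h5 sm.
have badj x y : ball_adj x y -> f y \in G (f x) by move=> /and3P[h1 h2 h3]; exact: cover_adj.
exists p, s; split=> //.
- rewrite /cycle_edges /has_edges /= -/(has_edges G (path_edges (f p) (map f s))) has_path_edges last_map.
  rewrite -{1}fq badj //= path_map; apply: sub_path ps1 => x y; exact: badj.
(* The cycle has at least three vertices: a loop contradicts irreflexivity, and a return after two
   steps contradicts injectivity of the cover around the middle vertex [x]. *)
- case: s {sm IH ps us1 uf} ps1 bq us => [|x [|y s]] //= ps1 bq us.
    by have := badj _ _ bq; rewrite fq (negbTE (regular_irr Greg _)).
  move: us; rewrite !inE negb_or => /and3P[/andP[_ pq] _ _].
  case/andP: ps1 => /and3P[/adjP[c ex] pr xr] _.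
  have px : p = step x c by rewrite ex stepK.
  case/and3P: bq => /adjP[c' ex'] _ qr.
  have cc : c != c' by apply: contra_neq pq => e; rewrite px ex' e.
  (* At most one of the two neighbours of [x] lies towards the root, so the other is one step
     further out and still in the ball. *)
  have xr' : (size (val x) < r)%N.
    case: (boolP (back x c)) => bc; last by move: pr; rewrite px size_step_fwd.
    by move: qr; rewrite ex' size_step_fwd // (back_uniq _ bc) eq_sym.
  have := local xr'; rewrite /local_cover => /ThetaP[inj _].
  have : [ffun c => f (step x c)] c = [ffun c => f (step x c)] c' :> 'I_n by rewrite !ffunE -px -ex' fq.
  by move/inj/eqP; rewrite (negbTE cc).
have pr : (size (val p) <= r)%N.
  by case: (s) ps1 bq => [|x s'] /= => [_ /and3P[]|/andP[/and3P[]]].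
rewrite /= pr /=; elim: (s) p ps1 {ps us us1 uf bq fq pr} => [|x s' IHs] p //= /andP[/and3P[_ _ ->] /IHs].
by [].
Qed.

Definition cycle_total : nat := \sum_(l < size (ball_root d r) | (1 < l)%N) cycle_count l G.

(** Two vertices with the same image are joined by a path inside the ball; the length of the cycle
    found there is bounded by the size of the ball, and the image of the root is within [r] of
    it. *)
Lemma noninjective_cover_cycle : ~~ injectiveb psi ->
  exists2 l : 'I_(size (ball_root d r)), (1 < l)%N & exists t : l.+1.-tuple 'I_n,
   uniq t && has_edges G (cycle_edges (thead t) (behead t)) /\ f (root_ d) \in reach r (thead t).
Proof.
move=> /injectivePn[i [j ij e]].
have uB := @uniq_ball_root d r.
have fi (i' : 'I_(size (ball_root d r))) : f (nth (root_ d) (ball_root d r) i') = psi i' by rewrite /f look_nth.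
have sb (i' : 'I_(size (ball_root d r))) : (size (val (nth (root_ d) (ball_root d r) i')) <= r)%N.
  by rewrite -mem_ball_root mem_nth.
have [|s [ps ls us s0]] := ball_path (sb i) (sb j).
  by rewrite nth_uniq.
have [|x [t [h1 h2 h3 h4 h5]]] := collision_cycle ps us _ s0; first by rewrite ls !fi.
have lt : (size t < size (ball_root d r))%N.
  have : (size (x :: t) <= size (ball_root d r))%N.
    by apply: uniq_leq_size => // q qt; rewrite mem_ball_root; exact: (allP h5).
  by [].
exists (Ordinal lt) => //.
have st : size (map f (x :: t)) == (size t).+1 by rewrite size_map.
exists (Tuple st); split; first by apply/andP; split; [exact: h1|exact: h2].
by apply: cover_root_reach; case/andP: h5.
Qed.

End Collisions.

(** * Proportion of non-injective covers and of intersecting pairs *)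

Section Fractions.
Variables (R : realFieldType) (d n : nat) (G : graph n) (n0 : 'I_n) (k : nat).
Hypothesis Greg : regular d G.

Notation cov := (@covers d k.+1 n G).
Let rt psi := look n0 (psi : {ffun 'I_(size (ball_root d k.+1)) -> 'I_n}) (root_ d).

(** The number of covers with a prescribed image of the root, the same for every vertex. *)
Definition root_covers : R := (d`! * branch_covers d k ^ d)%:R.

Lemma root_covers_gt0 : 0 < root_covers.
Proof. by rewrite ltr0n muln_gt0 fact_gt0 expn_gt0 branch_covers_gt0. Qed.

Lemma card_coversE : #|cov|%:R = n%:R * root_covers.
Proof. by rewrite (card_covers Greg R n0) -mulnA natrM. Qed.

Lemma card_covers_root v : \sum_(psi in cov) (rt psi == v)%:R = root_covers.
Proof.
have := sum_covers G n0 (fun w => (w == v)%:R) (fun (_ : Vd d) (_ _ : 'I_n) => 1 : R) k.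
rewrite (eq_bigr (fun psi => (rt psi == v)%:R)) => [->|psi _]; last first.
  by rewrite /cover_weight big1 ?mulr1 // => p _; rewrite big1.
rewrite (bigD1 v) //= eqxx mul1r [X in _ + X]big1 ?addr0 => [|w /negbTE ->]; last by rewrite mul0r.
rewrite (eq_bigr (fun=> (branch_covers d k)%:R ^+ d)) => [|th t0]; last first.
  rewrite -[X in _ ^+ X]card_ord -prodr_const; apply: eq_bigr => c _.
  by rewrite (branch_sum1 Greg) // (regular_sym Greg) (Theta_mem _ t0).
by rewrite sumr_const (card_Theta Greg) /root_covers natrM natrX mulr_natl.
Qed.

(** Each non-injective cover is charged to a short cycle near the image of its root; a cycle has at
    most [(d+1)^(k+1)] such images, each with [root_covers] covers. *)
Lemma noninjective_covers : \sum_(psi in cov) (~~ injectiveb psi)%:R <=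
  (cycle_total d G k.+1 * d.+1 ^ k.+1)%:R * root_covers.
Proof.
pose cyc (l : nat) := [set t : l.+1.-tuple 'I_n | uniq t && has_edges G (cycle_edges (thead t) (behead t))]%SET.
apply: le_trans (_ : \sum_(psi in cov) \sum_(l < size (ball_root d k.+1) | (1 < l)%N)
   \sum_(t in cyc l) \sum_(v in reach G k.+1 (thead t)) (rt psi == v)%:R <= _).
  apply: ler_sum => psi psiG; case: (boolP (injectiveb psi)) => [_|ni] /=.
    by do 3!(apply: sumr_ge0 => ? _); exact: ler0n.
  have [l l1 [t [tc tr]]] := noninjective_cover_cycle n0 Greg psiG ni.
  rewrite (bigD1 l) //= (bigD1 t) ?inE //= (bigD1 (rt psi)) //= eqxx -!addrA lerDl.
  by rewrite !addr_ge0 //; do ?(apply: sumr_ge0 => ? _); exact: ler0n.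
rewrite exchange_big /= /cycle_total natrM natr_sum !mulr_suml; apply: ler_sum => l l1.
rewrite exchange_big /=.
apply: le_trans (_ : \sum_(t in cyc l) (d.+1 ^ k.+1)%:R * root_covers <= _).
  apply: ler_sum => t _; rewrite exchange_big /= (eq_bigr (fun=> root_covers)) => [|v _]; last exact: card_covers_root.
  rewrite sumr_const -[leLHS]mulr_natl ler_wpM2r ?(ltW root_covers_gt0) // ler_nat.
  exact: card_reach.
by rewrite sumr_const -[leLHS]mulr_natl -mulrA.
Qed.

(** A common vertex [x] of the two images confines both root images to [reach G k.+1 x]. *)
Lemma intersecting_covers : \sum_(psi in cov) \sum_(psi' in cov) [exists i, exists j, psi i == psi' j]%:R <=
  (n * (d.+1 ^ k.+1) ^ 2)%:R * root_covers ^+ 2.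
Proof.
apply: le_trans (_ : \sum_(psi in cov) \sum_(psi' in cov) \sum_x
   \sum_(v in reach G k.+1 x) \sum_(w in reach G k.+1 x) (rt psi == v)%:R * (rt psi' == w)%:R <= _).
  apply: ler_sum => psi psiG; apply: ler_sum => psi' psiG'.
  case: (boolP [exists i, exists j, psi i == psi' j]) => [/existsP[i /existsP[j /eqP e]]|_]; last first.
    by do 3!(apply: sumr_ge0 => ? _); rewrite mulr_ge0.
  have sb (i' : 'I_(size (ball_root d k.+1))) : (size (val (nth (root_ d) (ball_root d k.+1) i')) <= k.+1)%N.
    by rewrite -mem_ball_root mem_nth.
  have r1 := cover_root_reach n0 Greg psiG (sb i).
  have r2 := cover_root_reach n0 Greg psiG' (sb j).
  rewrite !look_nth ?uniq_ball_root // -?e in r1 r2.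
  rewrite (bigD1 (psi i)) //= (bigD1 (rt psi)) //= (bigD1 (rt psi')) //= !eqxx mulr1 -!addrA lerDl.
  rewrite !addr_ge0 //; do ?(apply: sumr_ge0 => ? _); rewrite ?mulr_ge0 //.
have -> : \sum_(psi in cov) \sum_(psi' in cov) \sum_x
   \sum_(v in reach G k.+1 x) \sum_(w in reach G k.+1 x) (rt psi == v)%:R * (rt psi' == w)%:R =
   \sum_x \sum_(v in reach G k.+1 x) \sum_(w in reach G k.+1 x) root_covers ^+ 2.
  under eq_bigr => psi _ do rewrite exchange_big /=.
  rewrite exchange_big /=; apply: eq_bigr => x _.
  under eq_bigr => psi _ do rewrite exchange_big /=.
  rewrite exchange_big /=; apply: eq_bigr => v _.
  under eq_bigr => psi _ do rewrite exchange_big /=.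
  rewrite exchange_big /=; apply: eq_bigr => w _.
  under eq_bigr => psi _ do rewrite -mulr_sumr card_covers_root.
  by rewrite -mulr_suml card_covers_root expr2.
apply: le_trans (_ : \sum_(x < n) ((d.+1 ^ k.+1) ^ 2)%:R * root_covers ^+ 2 <= _); last first.
  by rewrite sumr_const card_ord -[leLHS]mulr_natl natrM mulrA.
apply: ler_sum => x _; rewrite !sumr_const -mulrnA -[leLHS]mulr_natl.
rewrite ler_wpM2r ?exprn_ge0 ?(ltW root_covers_gt0) // ler_nat -mulnn leq_mul //; exact: card_reach.
Qed.

End Fractions.

(** * Independent random colourings *)

Section ProductMeasure.
Variables (R : realType) (n : nat) (F : finType) (pv : 'I_n -> F -> R).
Hypothesis pv0 : forall v x, 0 <= pv v x.
Hypothesis pv1 : forall v, \sum_x pv v x = 1.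
Notation colouring := ({ffun 'I_n -> F}).

Definition wt (g : colouring) : R := \prod_v pv v (g v).

Lemma wt_ge0 g : 0 <= wt g. Proof. exact: prodr_ge0. Qed.

Lemma sum_wt_prod (h : 'I_n -> F -> R) :
  \sum_(g : colouring) wt g * \prod_v h v (g v) = \prod_v \sum_x pv v x * h v x.
Proof. by rewrite bigA_distr_bigA /=; apply: eq_bigr => g _; rewrite -big_split. Qed.

Lemma sum_wt : \sum_(g : colouring) wt g = 1.
Proof.
have := sum_wt_prod (fun _ _ => 1).
rewrite (eq_bigr wt) => [->|g _]; last by rewrite big1 // mulr1.
by rewrite big1 // => v _; under eq_bigr => x _ do rewrite mulr1.
Qed.

Lemma sum_wt1 v (h : F -> R) : \sum_(g : colouring) wt g * h (g v) = \sum_x pv v x * h x.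
Proof.
have := sum_wt_prod (fun u x => if u == v then h x else 1).
rewrite (bigD1 v) //= eqxx [X in _ * X]big1 ?mulr1 => [<-|u /negbTE ->].
  apply: eq_bigr => g _; congr (_ * _).
  by rewrite (bigD1 v) //= eqxx big1 ?mulr1 // => u /negbTE ->.
by under eq_bigr => x _ do rewrite mulr1.
Qed.

Lemma wt_entropy : entropy wt = \sum_v entropy (pv v).
Proof.
rewrite /entropy sumrN; congr (- _).
transitivity (\sum_(g : colouring) wt g * \sum_v ln (pv v (g v))).
  apply: eq_bigr => g _; case: (eqVneq (wt g) 0) => [->|w0]; first by rewrite !mul0r.
  congr (_ * _); rewrite /wt ln_prod // => v _; rewrite lt_neqAle pv0 andbT eq_sym.
  by apply: contra_neq w0 => e; rewrite /wt (bigD1 v) //= e mul0r.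
under eq_bigr => g _ do rewrite mulr_sumr.
by rewrite exchange_big /=; apply: eq_bigr => v _; rewrite (sum_wt1 v (fun x => ln (pv v x))).
Qed.

Lemma gibbs (A : finType) (p q : A -> R) : (forall a, 0 <= p a) -> \sum_a p a = 1 ->
  (forall a, 0 < q a) -> \sum_a q a <= 1 -> entropy p <= - \sum_a p a * ln (q a).
Proof.
move=> p0 p1 q0 q1; rewrite /entropy lerN2.
suff : \sum_a (p a * ln (q a) - p a * ln (p a)) <= 0 by rewrite sumrB subr_le0.
apply: le_trans (_ : \sum_a (q a - p a) <= _); last by rewrite sumrB p1 subr_le0.
apply: ler_sum => a _; case: (eqVneq (p a) 0) => [->|pa]; first by rewrite !mul0r !subr0 ltW.
have pa0 : 0 < p a by rewrite lt_neqAle eq_sym pa p0.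
rewrite -mulrBr -ln_div ?posrE //.
apply: le_trans (_ : p a * (q a / p a - 1) <= _).
  by rewrite ler_pM2l //; apply/ln_le_sub1/divr_gt0.
by rewrite mulrBr mulr1 mulrCA divff // mulr1.
Qed.

Lemma card_ge_entropy (A : {set colouring}) (eta : R) :
  \sum_(g | g \notin A) wt g <= eta -> eta < 1 ->
  (0 < #|A|)%N /\ \sum_v entropy (pv v) <= ln 2 + ln #|A|%:R + eta * (n%:R * ln #|F|%:R).
Proof.
move=> hA e1.
have A0 : (0 < #|A|)%N.
  rewrite lt0n; apply/negP => /eqP/cards0_eq A0; move: hA.
  have -> : \sum_(g | g \notin A) wt g = 1.
    by rewrite -sum_wt; apply: eq_bigl => g; rewrite A0 inE.
  by move=> h; have := le_lt_trans h e1; rewrite ltxx.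
split=> //.
have A0' : 0 < #|A|%:R :> R by rewrite ltr0n.
have [g0 _] : exists g, g \in A by apply/set0Pn; rewrite -card_gt0.
have T0 : (0 < #|{: colouring}|)%N by apply/card_gt0P; exists g0.
have T0' : 0 < #|{: colouring}|%:R :> R by rewrite ltr0n.
(* Test measure for Gibbs' inequality: half of the mass uniform on [A], the rest spread thinly
   enough to be positive everywhere. Colourings in [A] then cost [ln 2 + ln #|A|], the others
   [ln 2 + n * ln #|F|]. *)
pose q g : R := if g \in A then (2 * #|A|%:R)^-1 else (2 * #|{: colouring}|%:R)^-1.
have q0 g : 0 < q g by rewrite /q; case: ifP => _; rewrite invr_gt0 mulr_gt0.
have q1 : \sum_g q g <= 1.
  rewrite (bigID (mem A)) /=.
  have -> : \sum_(g in A) q g = 2^-1.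
    rewrite (eq_bigr (fun=> (2 * #|A|%:R)^-1)) => [|g gA]; last by rewrite /q gA.
    by rewrite sumr_const -[LHS]mulr_natl; field; rewrite gt_eqF.
  have : \sum_(g | g \notin A) q g <= 2^-1.
    rewrite (eq_bigr (fun=> (2 * #|{: colouring}|%:R)^-1)) => [|g /negbTE gA]; last by rewrite /q gA.
    rewrite sumr_const -[leLHS]mulr_natl invfM mulrCA ger_pMr ?invr_gt0 //.
    by rewrite ler_pdivrMr // mul1r ler_nat max_card.
  lra.
have := gibbs wt_ge0 sum_wt q0 q1; rewrite wt_entropy => /le_trans; apply.
rewrite -sumrN (bigID (mem A)) /=.
set pA := \sum_(g in A) wt g; set pB := \sum_(g | g \notin A) wt g.
have pAB : pA + pB = 1 by rewrite -sum_wt [RHS](bigID (mem A)).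
have -> : \sum_(i in A) - (wt i * ln (q i)) = pA * (ln 2 + ln #|A|%:R).
  rewrite mulr_suml; apply: eq_bigr => g gA.
  by rewrite /q gA lnV ?posrE ?mulr_gt0 // lnM ?posrE // mulrN opprK.
have -> : \sum_(i | i \notin A) - (wt i * ln (q i)) = pB * (ln 2 + ln #|{: colouring}|%:R).
  rewrite mulr_suml; apply: eq_bigr => g /negbTE gA.
  by rewrite /q gA lnV ?posrE ?mulr_gt0 // lnM ?posrE // mulrN opprK.
have eT : ln #|{: colouring}|%:R = n%:R * ln #|F|%:R :> R.
  rewrite card_ffun card_ord natrX; case: (posnP #|F|) => F0; last by rewrite lnXn ?ltr0n // mulr_natl.
  case: (posnP n) => [->|n0]; first by rewrite expr0 ln1 mul0r.
  by have := fintype0 (g0 (Ordinal n0)) F0.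
have l0 : 0 <= n%:R * ln #|F|%:R :> R by rewrite -eT ln_ge0 // ler1n.
have lA : 0 <= ln #|A|%:R :> R by rewrite ln_ge0 // ler1n.
have pA0 : 0 <= pA by apply: sumr_ge0 => g _; exact: wt_ge0.
have pB0 : 0 <= pB by apply: sumr_ge0 => g _; exact: wt_ge0.
rewrite eT; have h1 : pA * ln #|A|%:R <= ln #|A|%:R by rewrite ler_piMl //; lra.
have h2 : pB * (n%:R * ln #|F|%:R) <= eta * (n%:R * ln #|F|%:R) by rewrite ler_wpM2r.
have -> : pA * (ln 2 + ln #|A|%:R) + pB * (ln 2 + n%:R * ln #|F|%:R) =
  (pA + pB) * ln 2 + pA * ln #|A|%:R + pB * (n%:R * ln #|F|%:R) :> R by ring.
by rewrite pAB mul1r; apply: lerD => //; apply: lerD.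
Qed.

(** * Concentration of the local statistics of a random colouring *)

Section LocalStatistics.
Variables (J : finType) (cov : pred {ffun J -> 'I_n}).
Hypothesis cov0 : (0 < #|cov|)%N.
Implicit Types (psi : {ffun J -> 'I_n}) (a : {ffun J -> F}).

Definition match_at psi a (g : colouring) : R := \prod_j (g (psi j) == a j)%:R.
Definition ball_freq (g : colouring) a : R := #|cov|%:R^-1 * \sum_(psi in cov) match_at psi a g.
Definition ball_mean a : R := #|cov|%:R^-1 * \sum_(psi in cov) \prod_j pv (psi j) (a j).

(** Groups the constraints by the vertex they concern, so that expectations factor over vertices
    even if [psi] takes a value several times. *)
Definition site psi a v x : R := \prod_(j | psi j == v) (x == a j)%:R.

Lemma match_site psi a g : match_at psi a g = \prod_v site psi a v (g v).
Proof.
rewrite /match_at (partition_big psi predT) //=; apply: eq_bigr => v _.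
by apply: eq_bigr => j /eqP ->.
Qed.

Lemma match_le1 psi a g : 0 <= match_at psi a g <= 1.
Proof.
rewrite prodr_ge0 => [|j _]; last exact: ler0n.
by rewrite prodr_ile1 // => j _; rewrite ler0n lern1 leq_b1.
Qed.

Definition match_mean psi a : R := \sum_(g : colouring) wt g * match_at psi a g.

Lemma match_meanE psi a : match_mean psi a = \prod_v \sum_x pv v x * site psi a v x.
Proof. by rewrite -sum_wt_prod; apply: eq_bigr => g _; rewrite match_site. Qed.

Lemma match_mean_le1 psi a : 0 <= match_mean psi a <= 1.
Proof.
rewrite sumr_ge0 => [|g _] /=; last by rewrite mulr_ge0 ?wt_ge0; case/andP: (match_le1 psi a g).
rewrite -sum_wt; apply: ler_sum => g _; case/andP: (match_le1 psi a g) => _ h.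
by rewrite ler_piMr // wt_ge0.
Qed.

Lemma match_mean_inj psi a : injective psi -> match_mean psi a = \prod_j pv (psi j) (a j).
Proof.
move=> inj; rewrite match_meanE [RHS](partition_big psi predT) //=; apply: eq_bigr => v _.
case: (pickP (fun j => psi j == v)) => [j /eqP jv|H0]; last first.
  rewrite [RHS]big_pred0 // -(pv1 v); apply: eq_bigr => x _.
  by rewrite /site big_pred0 // mulr1.
have e1 i : (psi i == v) = (i == j) by rewrite -jv inj_eq.
rewrite [RHS](big_pred1 j) // jv (bigD1 (a j)) //= [X in _ + X]big1 => [|x xa].
  by rewrite /site (big_pred1 j) // eqxx mulr1 addr0.
by rewrite /site (big_pred1 j) // (negbTE xa) mulr0.
Qed.

Lemma match_mean2_disjoint psi psi' a : (forall i j, psi i != psi' j) ->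
  \sum_(g : colouring) wt g * (match_at psi a g * match_at psi' a g) = match_mean psi a * match_mean psi' a.
Proof.
move=> dis.
transitivity (\sum_(g : colouring) wt g * \prod_v (site psi a v (g v) * site psi' a v (g v))).
  by apply: eq_bigr => g _; rewrite !match_site big_split.
rewrite (sum_wt_prod (fun v x => site psi a v x * site psi' a v x)) !match_meanE -big_split /=.
apply: eq_bigr => v _.
case: (pickP (fun j => psi j == v)) => [j /eqP jv|H0].
  have e2 x : site psi' a v x = 1 by rewrite /site big_pred0 // => i; rewrite -jv eq_sym; apply/negbTE/dis.
  under eq_bigr => x _ do rewrite e2 mulr1.
  by under [X in _ = _ * X]eq_bigr => x _ do rewrite e2 mulr1; rewrite pv1 mulr1.
have e1 x : site psi a v x = 1 by rewrite /site big_pred0.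
under eq_bigr => x _ do rewrite e1 mul1r.
by under [X in _ = X * _]eq_bigr => x _ do rewrite e1 mulr1; rewrite pv1 mul1r.
Qed.

Definition freq_mean a : R := \sum_(g : colouring) wt g * ball_freq g a.

Let N0 : 0 < #|cov|%:R :> R. Proof. by rewrite ltr0n. Qed.

Lemma freq_meanE a : freq_mean a = #|cov|%:R^-1 * \sum_(psi in cov) match_mean psi a.
Proof.
rewrite /freq_mean /ball_freq (eq_bigr (fun g => #|cov|%:R^-1 * \sum_(psi in cov) wt g * match_at psi a g)).
  by rewrite -mulr_sumr exchange_big.
by move=> g _; rewrite mulrCA mulr_sumr.
Qed.

(** Injective maps see independent colours and contribute no error; any other map contributes at
    most 1. *)
Lemma freq_mean_bias a : `|freq_mean a - ball_mean a| <=
  #|cov|%:R^-1 * \sum_(psi in cov) (~~ injectiveb psi)%:R.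
Proof.
rewrite freq_meanE /ball_mean -mulrBr normrM ger0_norm ?invr_ge0 ?ler0n //.
rewrite ler_pM2l ?invr_gt0 // -sumrB; apply: le_trans (ler_norm_sum _ _ _) _.
apply: ler_sum => psi _; case: (boolP (injectiveb psi)) => [/injectiveP inj|_] /=.
  by rewrite match_mean_inj // subrr normr0.
have /andP[m0 m1] := match_mean_le1 psi a.
have p0 : 0 <= \prod_j pv (psi j) (a j) by apply: prodr_ge0.
have p1 : \prod_j pv (psi j) (a j) <= 1.
  apply: prodr_ile1 => j _; rewrite pv0 /= -(pv1 (psi j)) (bigD1 (a j)) //= lerDl.
  exact: sumr_ge0.
by rewrite ler_norml; apply/andP; split; lra.
Qed.

(** Maps with disjoint images are uncorrelated, and an intersecting pair has covariance at most
    1. *)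
Lemma freq_variance a : \sum_(g : colouring) wt g * (ball_freq g a - freq_mean a) ^+ 2 <=
  #|cov|%:R^-2 * \sum_(psi in cov) \sum_(psi' in cov) [exists i, exists j, psi i == psi' j]%:R.
Proof.
have -> : \sum_(g : colouring) wt g * (ball_freq g a - freq_mean a) ^+ 2 =
   \sum_(g : colouring) wt g * ball_freq g a ^+ 2 - freq_mean a ^+ 2.
  rewrite (eq_bigr (fun g => wt g * ball_freq g a ^+ 2 - 2 * freq_mean a * (wt g * ball_freq g a) +
     freq_mean a ^+ 2 * wt g)) => [|g _]; last by ring.
  by rewrite big_split sumrB /= -!mulr_sumr sum_wt -/(freq_mean a); ring.
have -> : \sum_(g : colouring) wt g * ball_freq g a ^+ 2 = #|cov|%:R^-2 *
   \sum_(psi in cov) \sum_(psi' in cov) \sum_(g : colouring) wt g * (match_at psi a g * match_at psi' a g).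
  rewrite (eq_bigr (fun g => #|cov|%:R^-2 * \sum_(psi in cov) \sum_(psi' in cov)
     wt g * (match_at psi a g * match_at psi' a g))) => [|g _].
    rewrite -mulr_sumr exchange_big /=; congr (_ * _); apply: eq_bigr => psi _.
    by rewrite exchange_big.
  rewrite /ball_freq exprMn exprVn mulrCA; congr (_ * _).
  rewrite expr2 mulr_suml mulr_sumr; apply: eq_bigr => psi _.
  by rewrite mulr_sumr mulr_sumr.
have -> : freq_mean a ^+ 2 = #|cov|%:R^-2 *
   \sum_(psi in cov) \sum_(psi' in cov) match_mean psi a * match_mean psi' a.
  rewrite freq_meanE exprMn exprVn; congr (_ * _).
  by rewrite expr2 mulr_suml; apply: eq_bigr => psi _; rewrite mulr_sumr.
rewrite -mulrBr ler_pM2l ?invr_gt0 ?exprn_gt0 // -sumrB; apply: ler_sum => psi _.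
rewrite -sumrB; apply: ler_sum => psi' _.
case: (boolP [exists i, exists j, psi i == psi' j]) => [_|/existsPn H] /=.
  have /andP[m0 m1] := match_mean_le1 psi a; have /andP[m0' m1'] := match_mean_le1 psi' a.
  apply: le_trans (_ : \sum_(g : colouring) wt g <= _); last by rewrite sum_wt.
  rewrite lerBlDr; apply: le_trans (_ : \sum_(g : colouring) wt g <= _); last by rewrite lerDl mulr_ge0.
  apply: ler_sum => g _; rewrite ler_piMr ?wt_ge0 //.
  have /andP[a0 a1] := match_le1 psi a g; have /andP[b0 b1] := match_le1 psi' a g.
  exact: mulr_ile1.
rewrite match_mean2_disjoint ?subrr // => i j; by have /existsPn/(_ j) := H i.
Qed.

Lemma chebyshev_freq a (t : R) : 0 < t ->
  \sum_(g : colouring | t < `|ball_freq g a - freq_mean a|) wt g <=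
  t^-2 * \sum_(g : colouring) wt g * (ball_freq g a - freq_mean a) ^+ 2.
Proof.
move=> t0; rewrite mulr_sumr big_mkcond; apply: ler_sum => g _.
have w0 := wt_ge0 g.
case: ifP => h; last by rewrite mulr_ge0 ?invr_ge0 ?exprn_ge0 ?(ltW t0) // mulr_ge0 // sqr_ge0.
rewrite mulrCA ler_peMr // -ler_pdivrMl ?invr_gt0 ?exprn_gt0 // invrK mulr1.
by rewrite -[leRHS]real_normK ?num_real // lerXn2r ?nnegrE ?normr_ge0 ?(ltW t0) ?(ltW h).
Qed.

Definition good_colourings (nu : {ffun J -> F} -> R) (t : R) : {set colouring} :=
  [set g : colouring | `[< forall a, `|ball_freq g a - nu a| <= t >]]%SET.

(** The radius [3 * t] leaves [t] each for the random fluctuation, the bias from non-injective maps,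
    and the distance of [ball_mean] from [nu]. *)
Lemma bad_colourings (nu : {ffun J -> F} -> R) (t : R) : 0 < t ->
  (forall a, `|ball_mean a - nu a| <= t) ->
  #|cov|%:R^-1 * \sum_(psi in cov) (~~ injectiveb psi)%:R <= t ->
  \sum_(g | g \notin good_colourings nu (3 * t)) wt g <=
  #|{: {ffun J -> F}}|%:R * (t^-2 * (#|cov|%:R^-2 *
    \sum_(psi in cov) \sum_(psi' in cov) [exists i, exists j, psi i == psi' j]%:R)).
Proof.
move=> t0 hm hi.
apply: le_trans (_ : \sum_a \sum_(g : colouring | t < `|ball_freq g a - freq_mean a|) wt g <= _).
  rewrite (exchange_big_dep xpredT) //= big_mkcond; apply: ler_sum => g _; case: ifP => [gB|_]; last first.
    by apply: sumr_ge0 => a _; exact: wt_ge0.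
  have [a ha] : exists a, t < `|ball_freq g a - freq_mean a|.
    move: gB; rewrite inE => /asboolPn/existsNP[a /negP]; rewrite -ltNge => h.
    exists a; have := freq_mean_bias a; have := hm a => h1 h2.
    have h3 : `|ball_freq g a - nu a| <= `|ball_freq g a - freq_mean a| + `|freq_mean a - ball_mean a| + `|ball_mean a - nu a|.
      have -> : ball_freq g a - nu a = (ball_freq g a - freq_mean a) + (freq_mean a - ball_mean a) + (ball_mean a - nu a) by ring.
      by apply: le_trans (ler_normD _ _) _; rewrite lerD2r ler_normD.
    lra.
  rewrite (bigD1 a) //= lerDl; apply: sumr_ge0 => a' _; exact: wt_ge0.
apply: le_trans (_ : \sum_(a : {ffun J -> F}) (t^-2 * (#|cov|%:R^-2 *
    \sum_(psi in cov) \sum_(psi' in cov) [exists i, exists j, psi i == psi' j]%:R)) <= _); last first.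
  by rewrite sumr_const -[leLHS]mulr_natl.
apply: ler_sum => a _; apply: le_trans (chebyshev_freq a t0) _.
by rewrite ler_pM2l ?invr_gt0 ?exprn_gt0 // freq_variance.
Qed.

End LocalStatistics.
End ProductMeasure.

(** * Ball frequencies in terms of star densities *)

Section BallFrequencies.
Variables (R : realType) (d n k : nat) (G : graph n) (F : finType) (f0 : F) (n0 : 'I_n).
Hypothesis Greg : regular d G.
Hypothesis d0 : (0 < d)%N.

Notation B := (ball_root d k.+1).
Notation cov := [pred psi | psi \in @covers d k.+1 n G].
Notation ballcol := {ffun 'I_(size B) -> F}.

Definition ext (a : ballcol) : Vd d -> F := look f0 a.
Definition pull (g : 'I_n -> F) (psi : {ffun 'I_(size B) -> 'I_n}) : ballcol := [ffun j => g (psi j)].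

Lemma card_covers_gt0 : (0 < #|cov|)%N.
Proof.
rewrite -(ltr0n R) (@card_covers d n G Greg R n0) ltr0n !muln_gt0 fact_gt0 expn_gt0 branch_covers_gt0 andbT /=.
by rewrite andbT; apply: leq_ltn_trans (ltn_ord n0).
Qed.

Lemma match_at_pull (psi : {ffun 'I_(size B) -> 'I_n}) (a : ballcol) (g : {ffun 'I_n -> F}) :
  match_at R psi a g = (a == pull g psi)%:R.
Proof.
rewrite /match_at; case: eqP => [->|ne]; first by rewrite big1 // => j _; rewrite ffunE eqxx.
have [j hj] : exists j, a j != pull g psi j.
  apply/existsP; apply: contra_notT ne => /existsPn H; apply/ffunP => j.
  by apply/eqP; have := H j; rewrite negbK.
by rewrite (bigD1 j) //= eq_sym; move: hj; rewrite ffunE => /negbTE ->; rewrite mul0r.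
Qed.

Lemma sum_ball_freq (g : {ffun 'I_n -> F}) (P : pred ballcol) :
  \sum_(a | P a) ball_freq R cov g a = #|cov|%:R^-1 * \sum_(psi in cov) (P (pull g psi))%:R.
Proof.
rewrite /ball_freq -mulr_sumr exchange_big /=; congr (_ * _); apply: eq_bigr => psi _.
rewrite big_mkcond (bigD1 (pull g psi)) //= match_at_pull eqxx big1 ?addr0 => [|a ne]; first by case: (P _).
by rewrite match_at_pull (negbTE ne); case: ifP.
Qed.

Lemma match_at_ball psi (a : ballcol) (g : {ffun 'I_n -> F}) :
  match_at R psi a g = \prod_(q <- B) (g (look n0 psi q) == ext a q)%:R.
Proof.
rewrite -(big_look B *%R (fun q => (g (look n0 psi q) == ext a q)%:R)) /=; apply: eq_bigr => j _.
by rewrite /ext !look_nth ?uniq_ball_root.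
Qed.

(** The conditional probability of the labelled ball [a] given its star type: automorphisms of each
    branch over the number of its covers. *)
Definition ball_factor (a : ballcol) : R :=
  \prod_(c < d) ((zeta (tree_type k (ext a) (step (root_ d) c) c))%:R / (branch_covers d k)%:R).

Lemma ball_freqE (g : {ffun 'I_n -> F}) (a : ballcol) :
  ball_freq R cov g a = star_density R n (star_count G g) (tree_star k (ext a)) * ball_factor a.
Proof.
rewrite /ball_freq (eq_bigr (fun psi => \prod_(q <- B) (g (look n0 psi q) == ext a q)%:R)) => [|psi _].
  rewrite cover_ball_sum // (@card_covers d n G Greg R n0) /star_density /ball_factor prodf_div prodr_const card_ord.
  by rewrite !natrM natrX natr_prod !invfM; ring.
exact: match_at_ball.
Qed.

(** A cover induces an ordering of the neighbours at every inner vertex, which matches the children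
    in the tree with those in the graph; the length condition keeps the recursion inside the
    ball. *)
Lemma cover_type (g : 'I_n -> F) psi j p c : psi \in cov -> (size (val p) + j <= k.+1)%N ->
  tree_type j (fun q => g (look n0 psi q)) p c =
  graph_type d G j g (look n0 psi (step p c)) (look n0 psi p).
Proof.
move=> pc; have H := (in_covers G n0 psi).1 pc; elim: j p c => [|j IH] p c pj //.
have pk : (size (val p) < k.+1)%N by apply: leq_trans pj; rewrite addnS ltnS leq_addr.
have := H p pk; rewrite /local_cover => t0.
rewrite [LHS]/= [RHS]/=; congr (_, _).
apply: (eq_mult_Theta t0); first by rewrite ffunE.
move=> c' _; rewrite ffunE IH ?stepK //.
by apply: leq_trans (leq_add (size_step_le p c') (leqnn j)) _; rewrite addSnnS.
Qed.

Lemma cover_star (g : 'I_n -> F) psi : psi \in cov ->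
  tree_star k (fun q => g (look n0 psi q)) =
  graph_star G k g (look n0 psi (root_ d)) [ffun c => look n0 psi (step (root_ d) c)].
Proof.
move=> pc; congr (_, _); apply/ffunP => c; rewrite !ffunE.
rewrite (cover_type g c pc) ?(cover_type g c pc) ?stepK //. 
Qed.

Lemma tree_star_ext (a a' : Vd d -> F) : {in B, a =1 a'} -> tree_star k a = tree_star k a'.
Proof.
move=> H.
have tt j p c : (size (val p) + j <= k.+1)%N -> tree_type j a p c = tree_type j a' p c.
  elim: j p c => [|j IH] p c pj; first by rewrite /= H // mem_ball_root -(addn0 (size _)).
  rewrite [LHS]/= [RHS]/= H; last by rewrite mem_ball_root (leq_trans _ pj) // leq_addr.
  congr (_, _); apply/ffunP => t; rewrite !ffunE; congr inord; apply: eq_card => c'.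
  rewrite !inE IH //.
  by apply: leq_trans (leq_add (size_step_le p c') (leqnn j)) _; rewrite addSnnS.
congr (_, _); first by rewrite H // mem_ball_root.
by apply/ffunP => c; rewrite !ffunE !tt // add0n.
Qed.

Lemma ext_pull (g : {ffun 'I_n -> F}) psi : {in B, ext (pull g psi) =1 (fun q => g (look n0 psi q))}.
Proof.
move=> q qB; have iq : (index q B < size B)%N by rewrite index_mem.
rewrite -(nth_index (root_ d) qB) /ext.
by rewrite (look_nth _ _ (Ordinal iq)) ?(look_nth _ psi (Ordinal iq)) ?uniq_ball_root ?ffunE.
Qed.

Lemma covers_with_star v (th : {ffun 'I_d -> 'I_n}) : th \in Theta d G v ->
  \sum_(psi in cov) ((look n0 psi (root_ d) == v) &&
    ([ffun c => look n0 psi (step (root_ d) c)] == th))%:R = (branch_covers d k)%:R ^+ d :> R.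
Proof.
move=> t0; pose e : 'I_d := Ordinal d0.
(* This weight fixes the images of the neighbours of the root and leaves deeper vertices free. *)
pose H (p : Vd d) (_ w : 'I_n) : R := if size (val p) == 1%N then (w == th (head e (val p)))%:R else 1.
have := sum_covers G n0 (fun w => (w == v)%:R) H k.
rewrite (eq_bigr (fun psi => ((look n0 psi (root_ d) == v) &&
    ([ffun c => look n0 psi (step (root_ d) c)] == th))%:R)); last first.
  move=> psi _; rewrite /cover_weight -mulnb natrM; congr (_ * _).
  rewrite big_mkcond (bigD1_seq (root_ d)) ?uniq_ball_root ?mem_ball_root //= [X in _ * X]big1 ?mulr1; last first.
    move=> p pr; case: ifP => // _; rewrite big1 // => c bc; rewrite /H -/(val _) size_step_fwd //.
    case: eqP => // -[] /eqP; rewrite size_eq0 => /eqP p0.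
    by move: pr; rewrite (_ : p = root_ d) ?eqxx //; apply: val_inj.
  transitivity (\prod_(c < d) (look n0 psi (step (root_ d) c) == th c)%:R : R).
    by apply: eq_bigr => c _; rewrite /H.
  case: eqP => [<-|ne]; first by rewrite big1 // => c _; rewrite ffunE eqxx.
  have [c hc] : exists c, look n0 psi (step (root_ d) c) != th c.
    apply/existsP; apply: contra_notT ne => /existsPn H0; apply/ffunP => c; rewrite ffunE.
    by apply/eqP; have := H0 c; rewrite negbK.
  by rewrite (bigD1 c) //= (negbTE hc) mul0r.
move=> ->; rewrite (bigD1 v) //= eqxx mul1r [X in _ + X]big1 ?addr0 => [|w /negbTE ->]; last by rewrite mul0r.
have bs j p c u w : (1 < size (val p))%N -> back p c -> u \in G w -> branch_sum G H j p c u w = (branch_covers d j)%:R.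
  elim: j p c u w => [|j IH] p c u w p1 bc uw.
    by rewrite /= /H -/(val p) gtn_eqF // mulr1.
  rewrite [LHS]/= /H -/(val p) gtn_eqF // mul1r -(branch_sum1 Greg R j.+1 p c uw) /= mul1r.
  apply: eq_bigr => th' /andP[t' _]; apply: eq_bigr => c' cc'.
  have bc' : ~~ back p c' by rewrite (back_uniq c' bc).
  rewrite IH ?back_step ?size_step_fwd //; last by rewrite (regular_sym Greg) (Theta_mem _ t').
    by rewrite (branch_sum1 Greg) // (regular_sym Greg) (Theta_mem _ t').
  exact: ltnW.
have b1 c w : w \in G v -> branch_sum G H k (step (root_ d) c) c v w = (w == th c)%:R * (branch_covers d k)%:R.
  move=> wv; have vw : v \in G w by rewrite (regular_sym Greg).
  case: (k) => [|j]; first by rewrite /= /H.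
  rewrite -(branch_sum1 Greg R j.+1 (step (root_ d) c) c vw) /= mul1r; congr (_ * _).
  apply: eq_bigr => th' /andP[t' _]; apply: eq_bigr => c' cc'.
  have bc' : ~~ back (step (root_ d) c) c' by rewrite (back_uniq (c := c)) ?back_step.
  have uG : w \in G (th' c') by rewrite (regular_sym Greg) (Theta_mem _ t').
  by rewrite bs ?back_step // ?(branch_sum1 Greg) // size_step_fwd.
rewrite (bigD1 th) //= [X in _ + X]big1 ?addr0 => [|th' /andP[t' ne]].
  rewrite -[X in _ ^+ X]card_ord -prodr_const; apply: eq_bigr => c _.
  by rewrite b1 ?(Theta_mem _ t0) // eqxx mul1r.
have [c hc] : exists c, th' c != th c.
  apply/existsP; apply: contraNT ne => /existsPn H0; apply/eqP/ffunP => c.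
  by apply/eqP; have := H0 c; rewrite negbK.
by rewrite (bigD1 c) //= b1 ?(Theta_mem _ t') // (negbTE hc) !mul0r.
Qed.

(** Every star is the centre of the same number of covers, and a pulled-back colouring has the type
    of the star on which its cover is centred. *)
Lemma star_densityE (g : {ffun 'I_n -> F}) (y : star_type d F k) :
  star_density R n (star_count G g) y = \sum_(a | tree_star k (ext a) == y) ball_freq R cov g a.
Proof.
rewrite sum_ball_freq.
have -> : \sum_(psi in cov) (tree_star k (ext (pull g psi)) == y)%:R =
   (star_count G g y)%:R * (branch_covers d k)%:R ^+ d :> R.
  transitivity (\sum_(psi in cov) \sum_v \sum_(th in Theta d G v | graph_star G k g v th == y)
     ((look n0 psi (root_ d) == v) && ([ffun c => look n0 psi (step (root_ d) c)] == th))%:R : R).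
    apply: eq_bigr => psi pc; rewrite (tree_star_ext (@ext_pull g psi)) cover_star //.
    rewrite (bigD1 (look n0 psi (root_ d))) //= [X in _ + X]big1 ?addr0; last first.
      by move=> v nv; rewrite big1 // => th _; rewrite eq_sym (negbTE nv).
    have t0 : [ffun c => look n0 psi (step (root_ d) c)] \in Theta d G (look n0 psi (root_ d)).
      by have := (in_covers G n0 psi).1 pc (root_ d); apply.
    case: eqP => [e|ne].
      move: e t0; set th0 : {ffun 'I_d -> 'I_n} := [ffun c => _] => e t0.
      rewrite (bigD1 th0) /=; last by rewrite t0 e eqxx.
      by rewrite !eqxx big1 ?addr0 // => th /andP[_ nt]; rewrite eq_sym (negbTE nt).
    rewrite big1 // => th /andP[_ /eqP e]; rewrite eqxx andTb; case: eqP => // et.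
    by case: ne; rewrite et.
  rewrite exchange_big /= /star_count natr_sum mulr_suml; apply: eq_bigr => v _.
  rewrite exchange_big /= (eq_bigr (fun=> (branch_covers d k)%:R ^+ d)) => [|th /andP[t0 _]].
    rewrite sumr_const -[LHS]mulr_natl; congr (_%:R * _). by apply: eq_card => th; rewrite [RHS]inE.
  exact: covers_with_star.
rewrite (@card_covers d n G Greg R n0) /star_density -mulnA !natrM natrX.
have D0 : (branch_covers d k)%:R ^+ d != 0 :> R by rewrite expf_neq0 // branch_covers_neq0.
have f0' : d`!%:R != 0 :> R by rewrite pnatr_eq0 -lt0n fact_gt0.
have n0' : n%:R != 0 :> R by rewrite pnatr_eq0 -lt0n; apply: leq_ltn_trans (ltn_ord n0).
by field; rewrite D0 f0' n0'.
Qed.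

End BallFrequencies.

(** * Edge frequencies in terms of star densities *)

Section EdgeFrequencies.
Variables (R : realType) (d n k : nat) (G : graph n) (F : finType) (f0 : F) (n0 : 'I_n).
Hypothesis Greg : regular d G.
Hypothesis d0 : (0 < d)%N.

Notation B := (ball_root d k.+1).
Notation cov := [pred psi | psi \in @covers d k.+1 n G].

Lemma edge_count_swap (g : 'I_n -> F) (b : bt d F k * bt d F k) :
  edge_count G g (b.2, b.1) = edge_count G g b.
Proof.
have H : (\sum_v \sum_(w in G v) ((graph_type d G k g v w, graph_type d G k g w v) == (b.2, b.1)) =
   \sum_v \sum_w (w \in G v) * ((graph_type d G k g v w, graph_type d G k g w v) == (b.2, b.1)))%N.
  by apply: eq_bigr => v _; rewrite big_mkcond; apply: eq_bigr => w _; case: (w \in G v); rewrite ?mul1n.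
rewrite /edge_count H exchange_big /=; apply: eq_bigr => v _.
rewrite [RHS]big_mkcond; apply: eq_bigr => w _.
rewrite (regular_sym Greg v w); case: (w \in G v); rewrite ?mul1n ?mul0n //.
by case: b {H} => b1 b2; rewrite !xpair_eqE [in LHS]andbC.
Qed.

Lemma edge_density_count (g : {ffun 'I_n -> F}) (e : 'I_d) (b : bt d F k * bt d F k) :
  \sum_(y : star_type d F k | y.2 e == b) star_density R n (star_count G g) y =
  ((d.-1)`! * edge_count G g b)%:R / (n * d`!)%:R.
Proof.
rewrite /star_density -mulr_suml -natr_sum; congr (_%:R / _).
rewrite /star_count exchange_big /= /edge_count big_distrr /=; apply: eq_bigr => v _.
transitivity (\sum_(th in Theta d G v) ((graph_type d G k g v (th e), graph_type d G k g (th e) v) == b))%N.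
  transitivity (\sum_(y : star_type d F k | y.2 e == b) \sum_(th in Theta d G v | graph_star G k g v th == y) 1)%N.
    by apply: eq_bigr => y _; rewrite -sum1_card; apply: eq_bigl => th; rewrite inE.
  rewrite (exchange_big_dep (fun th => th \in Theta d G v)) /=; last by move=> y th _ /andP[].
  apply: eq_bigr => th t0.
  rewrite (eq_bigl (fun y => (graph_star G k g v th == y) && (y.2 e == b))); last first.
    by move=> y; rewrite t0 /= andbC.
  case: eqP => [eb|nb]; last first.
    by rewrite big_pred0 // => y; case: eqP => // <-; rewrite ffunE; apply/negbTE/eqP.
  rewrite (big_pred1 (graph_star G k g v th)) // => y.
  rewrite eq_sym [RHS]inE; case: (y =P _) => [->|//]; by rewrite ffunE eb eqxx.
rewrite (partition_big (fun th : {ffun 'I_d -> 'I_n} => th e) (fun w => w \in G v)) /=; last first.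
  by move=> th; exact: Theta_mem.
rewrite big_distrr /=; apply: eq_bigr => w wv.
rewrite (eq_bigr (fun=> ((graph_type d G k g v w, graph_type d G k g w v) == b : nat))) => [|th /andP[_ /eqP ->] //].
by rewrite sum_nat_const card_Theta_at // (regular_sym Greg).
Qed.

Variable e : 'I_d.
Notation Eb := (edge_ball k e).

Definition edge_restrict (a : {ffun 'I_(size B) -> F}) : {ffun 'I_(size Eb) -> F} :=
  rst Eb (ext f0 a).

Definition edge_type (z : {ffun 'I_(size Eb) -> F}) : bt d F k * bt d F k :=
  (tree_type k (look f0 z) (step (root_ d) e) e, tree_type k (look f0 z) (root_ d) e).

Definition type_factor (b : bt d F k) : R := (zeta b)%:R / (branch_covers d k)%:R.

Lemma edge_freqE (g : {ffun 'I_n -> F}) (z : {ffun 'I_(size Eb) -> F}) :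
  \sum_(a | edge_restrict a == z) ball_freq R cov g a =
  (\sum_(y : star_type d F k | y.2 e == edge_type z) star_density R n (star_count G g) y) *
  (type_factor (edge_type z).1 * type_factor (edge_type z).2).
Proof.
rewrite (sum_ball_freq R).
have -> : \sum_(psi in cov) (edge_restrict (pull g psi) == z)%:R =
   \sum_(psi in cov) \prod_(q <- Eb) (g (look n0 psi q) == look f0 z q)%:R :> R.
  apply: eq_bigr => psi _.
  have uE : uniq Eb by exact: uniq_tball.
  rewrite -(big_look Eb *%R (fun q => (g (look n0 psi q) == look f0 z q)%:R)) /=.
  have hj (j : 'I_(size Eb)) : edge_restrict (pull g psi) j = g (look n0 psi (nth (root_ d) Eb j)).
    by rewrite ffunE (ext_pull f0 n0) // (@edge_ball_sub d k e) // mem_nth.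
  case: eqP => [<-|ne].
    by rewrite big1 // => j _; rewrite look_nth // hj eqxx.
  have [j hj'] : exists j, edge_restrict (pull g psi) j != z j.
    apply/existsP; apply: contra_notT ne => /existsPn H0; apply/ffunP => j.
    by apply/eqP; have := H0 j; rewrite negbK.
  by rewrite (bigD1 j) //= look_nth // -hj (negbTE hj') mul0r.
rewrite cover_edge_sum // (@card_covers d n G Greg R n0) edge_density_count -/(edge_type z).
rewrite /type_factor /branch_ratio /= !natrM !natrX.
have D0 : (branch_covers d k)%:R != 0 :> R by rewrite branch_covers_neq0.
have f1 : d`!%:R != 0 :> R by rewrite pnatr_eq0 -lt0n fact_gt0.
have n1 : n%:R != 0 :> R by rewrite pnatr_eq0 -lt0n; apply: leq_ltn_trans (ltn_ord n0).
have -> : (branch_covers d k)%:R ^+ d = (branch_covers d k)%:R * (branch_covers d k)%:R ^+ d.-1 :> R.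
  by rewrite -exprS prednK.
have Dd : (branch_covers d k)%:R ^+ d.-1 != 0 :> R by rewrite expf_neq0.
by field; rewrite D0 f1 n1 Dd.
Qed.

End EdgeFrequencies.

(** * Entropy identity for the limit law *)

Section LimitLaw.
Variables (R : realType) (d k : nat) (F : finType) (f0 : F).
Hypothesis d1 : (1 < d)%N.

Notation B := (ball_root d k.+1).
Notation ballcol := {ffun 'I_(size B) -> F}.
Notation covs n G := [pred psi | psi \in @covers d k.+1 n G].
Notation T := (bt d F k).
Notation S := (star_type d F k).

Variable nu : ballcol -> R.
Hypothesis nu0 : forall a, 0 <= nu a.
Hypothesis approx : forall del : R, 0 < del -> exists n, exists G : graph n, exists n0 : 'I_n,
  exists g : {ffun 'I_n -> F}, regular d G /\ forall a, `|ball_freq R (covs n G) g a - nu a| <= del.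

Let d0 : (0 < d)%N. Proof. exact: ltnW. Qed.

(** The source of all structural facts about [nu] below: a linear relation between ball frequencies
    that holds in every coloured regular graph holds for [nu]. *)
Lemma limit_linear (c : ballcol -> R) :
  (forall n (G : graph n) (n0 : 'I_n) (g : {ffun 'I_n -> F}), regular d G ->
     \sum_a c a * ball_freq R (covs n G) g a = 0) -> \sum_a c a * nu a = 0.
Proof.
move=> H; apply/eqP; rewrite -normr_le0; apply/ler_addgt0Pr => eps e0; rewrite add0r.
have C0 : 0 < 1 + \sum_a `|c a| by rewrite ltr_pwDl // sumr_ge0.
have [n [G [n0 [g [rG hg]]]]] := approx (divr_gt0 e0 C0).
have -> : \sum_a c a * nu a = - \sum_a c a * (ball_freq R (covs n G) g a - nu a).
  by under [X in - X]eq_bigr => a _ do rewrite mulrBr; rewrite sumrB H // sub0r opprK.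
rewrite normrN; apply: le_trans (ler_norm_sum _ _ _) _.
apply: le_trans (_ : \sum_a `|c a| * (eps / (1 + \sum_a `|c a|)) <= _).
  by apply: ler_sum => a _; rewrite normrM ler_wpM2l.
rewrite -mulr_suml mulrCA ger_pMr // ler_pdivrMr // mul1r; lra.
Qed.

Definition star_law (y : S) : R := \sum_(a | tree_star k (ext f0 a) == y) nu a.
Definition edge_law (e : 'I_d) (b : T * T) : R := \sum_(y : S | y.2 e == b) star_law y.

Lemma star_law_ge0 y : 0 <= star_law y. Proof. exact: sumr_ge0. Qed.
Lemma edge_law_ge0 e b : 0 <= edge_law e b.
Proof. by apply: sumr_ge0 => y _; exact: star_law_ge0. Qed.

Lemma sum_star_law (f : S -> R) : \sum_y star_law y * f y = \sum_a nu a * f (tree_star k (ext f0 a)).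
Proof.
rewrite [RHS](partition_big (fun a => tree_star k (ext f0 a)) predT) //=.
by apply: eq_bigr => y _; rewrite mulr_suml; apply: eq_bigr => a /eqP ->.
Qed.

Lemma sum_edge_law e (f : T * T -> R) : \sum_b edge_law e b * f b = \sum_y star_law y * f (y.2 e).
Proof.
rewrite [RHS](partition_big (fun y : S => y.2 e) predT) //=.
by apply: eq_bigr => b _; rewrite mulr_suml; apply: eq_bigr => y /eqP ->.
Qed.

Lemma edge_lawE e b : edge_law e b = \sum_a ((tree_star k (ext f0 a)).2 e == b)%:R * nu a.
Proof.
rewrite /edge_law big_mkcond.
rewrite (eq_bigr (fun y => star_law y * (y.2 e == b)%:R)) => [|y _]; last first.
  by case: eqP; rewrite ?mulr1 ?mulr0.
by rewrite (sum_star_law (fun y : S => (y.2 e == b)%:R)); apply: eq_bigr => a _; rewrite mulrC.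
Qed.

Lemma edge_densityE' n (G : graph n) (n0 : 'I_n) (g : {ffun 'I_n -> F}) e b : regular d G ->
  \sum_a ((tree_star k (ext f0 a)).2 e == b)%:R * ball_freq R (covs n G) g a =
  ((d.-1)`! * edge_count G g b)%:R / (n * d`!)%:R.
Proof.
move=> rG; rewrite -(edge_density_count R rG g e b).
rewrite (eq_bigr (fun y => \sum_(a | tree_star k (ext f0 a) == y) ball_freq R (covs n G) g a)); last first.
  by move=> y _; rewrite (star_densityE R f0 n0).
rewrite (exchange_big_dep xpredT) //=; apply: eq_bigr => a _.
set t := tree_star k (ext f0 a).
case: (t.2 e =P b) => [ea|ne]; rewrite ?mul1r ?mul0r.
  rewrite (big_pred1 t) // => y /=; rewrite [RHS]eq_sym; case: (t =P y) => [<-|_]; last by rewrite andbF.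
  by rewrite ea eqxx.
rewrite big_pred0 // => y; case: (t =P y) => [<-|_]; last by rewrite andbF.
by rewrite andbT; apply/negbTE/eqP.
Qed.

(** In a finite graph all orderings of the neighbours are counted, so no direction is
    distinguished. *)
Lemma edge_law_indep e e' b : edge_law e b = edge_law e' b.
Proof.
apply/eqP; rewrite -subr_eq0 !edge_lawE -sumrB.
rewrite (eq_bigr (fun a => (((tree_star k (ext f0 a)).2 e == b)%:R - ((tree_star k (ext f0 a)).2 e' == b)%:R) * nu a)).
  apply/eqP/limit_linear => n G n0 g rG; under eq_bigr => a _ do rewrite mulrBl.
  by rewrite sumrB !edge_densityE' // subrr.
by move=> a _; rewrite mulrBl.
Qed.

Lemma edge_law_swap e b : edge_law e (b.2, b.1) = edge_law e b.
Proof.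
apply/eqP; rewrite -subr_eq0 !edge_lawE -sumrB.
rewrite (eq_bigr (fun a => (((tree_star k (ext f0 a)).2 e == (b.2, b.1))%:R - ((tree_star k (ext f0 a)).2 e == b)%:R) * nu a)).
  apply/eqP/limit_linear => n G n0 g rG; under eq_bigr => a _ do rewrite mulrBl.
  by rewrite sumrB !edge_densityE' // edge_count_swap // subrr.
by move=> a _; rewrite mulrBl.
Qed.

Lemma edge_marginal_law e b : edge_marginal star_law b = edge_law e b.
Proof.
rewrite /edge_marginal (eq_bigr (fun=> edge_law e b)) => [|i _]; last exact: edge_law_indep.
rewrite sumr_const card_ord -[X in _ * X]mulr_natl mulKf //.
by rewrite pnatr_eq0 -lt0n.
Qed.

Lemma nu_factor a : nu a = star_law (tree_star k (ext f0 a)) * ball_factor R f0 a.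
Proof.
pose c (a' : ballcol) : R := (a' == a)%:R - (tree_star k (ext f0 a') == tree_star k (ext f0 a))%:R * ball_factor R f0 a.
have sumc (p : ballcol -> R) : \sum_a' c a' * p a' =
   p a - (\sum_(a' | tree_star k (ext f0 a') == tree_star k (ext f0 a)) p a') * ball_factor R f0 a.
  under eq_bigr => a' _ do rewrite mulrBl.
  rewrite sumrB (bigD1 a) //= eqxx mul1r big1 ?addr0 => [|a' /negbTE ->]; last by rewrite mul0r.
  congr (_ - _); rewrite mulr_suml [RHS]big_mkcond; apply: eq_bigr => a' _.
  by case: eqP => _; rewrite ?mul1r ?mul0r // mulrC.
apply/eqP; rewrite -subr_eq0 -sumc; apply/eqP/limit_linear => n G n0 g rG.
by rewrite sumc -(star_densityE R f0 n0) // (ball_freqE R f0 n0) // subrr.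
Qed.

Variable e : 'I_d.
Notation Eb := (edge_ball k e).

Definition nu_edge (z : {ffun 'I_(size Eb) -> F}) : R := \sum_(a | edge_restrict f0 e a == z) nu a.

Lemma sum_nu_edge (f : {ffun 'I_(size Eb) -> F} -> R) :
  \sum_z nu_edge z * f z = \sum_a nu a * f (edge_restrict f0 e a).
Proof.
rewrite [RHS](partition_big (edge_restrict f0 e) predT) //=.
by apply: eq_bigr => z _; rewrite mulr_suml; apply: eq_bigr => a /eqP ->.
Qed.

Lemma nu_edge_factor z : nu_edge z = edge_law e (edge_type f0 z) *
  (type_factor R (edge_type f0 z).1 * type_factor R (edge_type f0 z).2).
Proof.
pose u := type_factor R (edge_type f0 z).1 * type_factor R (edge_type f0 z).2.
pose c (a : ballcol) : R := (edge_restrict f0 e a == z)%:R - ((tree_star k (ext f0 a)).2 e == edge_type f0 z)%:R * u.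
have sumc (p : ballcol -> R) : \sum_a c a * p a = \sum_(a | edge_restrict f0 e a == z) p a -
   (\sum_a ((tree_star k (ext f0 a)).2 e == edge_type f0 z)%:R * p a) * u.
  under eq_bigr => a _ do rewrite mulrBl.
  rewrite sumrB; congr (_ - _); last by rewrite mulr_suml; apply: eq_bigr => a _; rewrite mulrAC.
  by rewrite [RHS]big_mkcond; apply: eq_bigr => a _; case: eqP => _; rewrite ?mul1r ?mul0r.
apply/eqP; rewrite -subr_eq0 edge_lawE -/u /nu_edge -sumc; apply/eqP/limit_linear => n G n0 g rG.
by rewrite sumc edge_densityE' // (edge_freqE R f0 n0) // edge_density_count // subrr.
Qed.

Lemma zeta_gt0 j (b : bt d F j) : (0 < zeta b)%N.
Proof.
elim: j b => //= j IH b; apply: prodn_gt0 => u.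
by rewrite muln_gt0 expn_gt0 IH fact_gt0.
Qed.

Lemma type_factor_gt0 (b : T) : 0 < type_factor R b.
Proof. by rewrite divr_gt0 // ltr0n ?zeta_gt0 ?branch_covers_gt0. Qed.

(** Both types read colours in the edge ball only: the branch beyond [e] consists of words beginning
    with [e] up to length [k+1], the branch of the root stays within length [k]. *)
Lemma edge_type_restrict a : edge_type f0 (edge_restrict f0 e a) = (tree_star k (ext f0 a)).2 e.
Proof.
have agree q : q \in Eb -> look f0 (edge_restrict f0 e a) q = ext f0 a q by move=> qE; rewrite look_rst.
rewrite /edge_type ffunE; congr (_, _).
  have H j p c : (size (val p) + j <= k.+1)%N -> back p c -> head e (val p) = e ->
      tree_type j (look f0 (edge_restrict f0 e a)) p c = tree_type j (ext f0 a) p c.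
    elim: j p c => [|j IH] p c pj bp hp.
      by apply: agree; rewrite mem_edge_ball hp eqxx andbT orbC -leq_eqVlt -(addn0 (size _)).
    rewrite [LHS]/= [RHS]/= agree; last first.
      by rewrite mem_edge_ball hp eqxx andbT orbC -leq_eqVlt (leq_trans _ pj) // leq_addr.
    congr (_, _); apply/ffunP => t; rewrite !ffunE; congr inord; apply: eq_card => c'.
    rewrite !inE; case: (boolP (c' == c)) => //= cc'.
    have bc : ~~ back p c' by rewrite (back_uniq c' bp).
    rewrite IH ?back_step //; first by rewrite size_step_fwd // addSnnS.
    by rewrite head_step_fwd //; case/andP: bp.
  by apply: H => //; exact: back_step.
have H j p c : (size (val p) + j <= k)%N ->
    tree_type j (look f0 (edge_restrict f0 e a)) p c = tree_type j (ext f0 a) p c.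
  elim: j p c => [|j IH] p c pj.
    by apply: agree; rewrite mem_edge_ball -(addn0 (size _)) pj.
  rewrite [LHS]/= [RHS]/= agree; last by rewrite mem_edge_ball (leq_trans _ pj) // leq_addr.
  congr (_, _); apply/ffunP => t; rewrite !ffunE; congr inord; apply: eq_card => c'.
  rewrite !inE IH //.
  by apply: leq_trans (leq_add (size_step_le p c') (leqnn j)) _; rewrite addSnnS.
exact: H.
Qed.

Lemma entropy_of_factor (A : finType) (p : A -> R) (u v : A -> R) :
  (forall a, p a = u a * v a) -> (forall a, 0 <= u a) -> (forall a, 0 < v a) ->
  entropy p = - \sum_a p a * ln (u a) - \sum_a p a * ln (v a).
Proof.
move=> pE u0 v0; rewrite /entropy -opprD -big_split; congr (- _); apply: eq_bigr => a _ /=.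
rewrite -mulrDr; case: (eqVneq (u a) 0) => ua; first by rewrite pE ua !mul0r.
by congr (_ * _); rewrite pE lnM ?posrE // lt_neqAle eq_sym ua u0.
Qed.

Lemma entropy_identity :
  entropy nu - d%:R / 2 * entropy nu_edge = edge_vertex_entropy star_law.
Proof.
(* The mean logarithmic factor of one branch. It enters once per direction at the root, hence [d]
   times, and once per end of the edge, hence twice by reversal symmetry; [d - (d/2) * 2 = 0]. *)
pose X := \sum_b edge_law e b * ln (type_factor R b.1).
have en : entropy nu = entropy star_law - d%:R * X.
  rewrite (entropy_of_factor nu_factor) => [|a|a]; first last.
  - by apply: prodr_gt0 => c _; exact: type_factor_gt0.
  - exact: star_law_ge0.
  rewrite -(sum_star_law (fun y => ln (star_law y))); congr (_ - _).
  transitivity (\sum_a nu a * \sum_(c < d) ln (type_factor R ((tree_star k (ext f0 a)).2 c).1)).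
    apply: eq_bigr => a _; congr (_ * _); rewrite /ball_factor ln_prod => [|c _]; last exact: type_factor_gt0.
    by apply: eq_bigr => c _; rewrite ffunE.
  rewrite -(sum_star_law (fun y => \sum_(c < d) ln (type_factor R (y.2 c).1))).
  under eq_bigr => y _ do rewrite mulr_sumr.
  rewrite exchange_big /= (eq_bigr (fun=> X)) => [|c _]; first by rewrite sumr_const card_ord mulr_natl.
  rewrite -(sum_edge_law c (fun b => ln (type_factor R b.1))).
  by apply: eq_bigr => b _; rewrite (edge_law_indep c e).
have X2 : \sum_b edge_law e b * ln (type_factor R b.2) = X.
  pose sw (b : T * T) := (b.2, b.1).
  have swI : injective sw by move=> [? ?] [? ?] [-> ->].
  rewrite /X (reindex_inj swI) /=; apply: eq_bigr => b _.
  by rewrite -[in RHS]edge_law_swap.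
have ee : entropy nu_edge = entropy (edge_law e) - 2 * X.
  rewrite (entropy_of_factor nu_edge_factor) => [|z|z]; first last.
  - by rewrite mulr_gt0 // type_factor_gt0.
  - exact: edge_law_ge0.
  have H (f : T * T -> R) : \sum_z nu_edge z * f (edge_type f0 z) = \sum_b edge_law e b * f b.
    rewrite (sum_nu_edge (fun z => f (edge_type f0 z))) sum_edge_law.
    rewrite (sum_star_law (fun y => f (y.2 e))).
    by apply: eq_bigr => a _; rewrite edge_type_restrict.
  rewrite (H (fun b => ln (edge_law e b))); congr (_ - _).
  rewrite (H (fun b => ln (type_factor R b.1 * type_factor R b.2))).
  transitivity (\sum_b (edge_law e b * ln (type_factor R b.1) + edge_law e b * ln (type_factor R b.2))).
    by apply: eq_bigr => b _; rewrite lnM ?posrE ?type_factor_gt0 // mulrDr.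
  by rewrite big_split /= X2 -/X; ring.
rewrite en ee /edge_vertex_entropy.
have -> : entropy (edge_marginal star_law) = entropy (edge_law e).
  by congr entropy; apply/funext => b; exact: edge_marginal_law.
by field.
Qed.

End LimitLaw.

(** * The entropy inequality for limits of coloured regular graphs *)

Section Core.
Variables (R : realType) (d k : nat) (F : finType) (f0 : F).
Hypothesis d1 : (1 < d)%N.

Notation B := (ball_root d k.+1).
Notation ballcol := {ffun 'I_(size B) -> F}.
Notation covs n G := [pred psi | psi \in @covers d k.+1 n G].
Notation S := (star_type d F k).

Variable nu : ballcol -> R.
Variable h : R.

(** All that is kept of a map [f] into [X]: the law [pv v] stands for [phi (f v)], and [h] for the
    expected entropy at the root. *)
Definition admits n (t : R) (G : graph n) : Prop :=
  exists pv : 'I_n -> F -> R, [/\ forall v x, 0 <= pv v x, forall v, \sum_x pv v x = 1,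
    forall a, `|ball_mean pv (covs n G) a - nu a| <= t & n%:R * (h - t) <= \sum_v entropy (pv v)].

Lemma good_near n (G : graph n) (n0 : 'I_n) (t : R) (g : {ffun 'I_n -> F}) : regular d G ->
  g \in good_colourings (covs n G) nu t ->
  forall y : S, `|star_density R n (star_count G g) y - star_law f0 nu y| <= #|{: ballcol}|%:R * t.
Proof.
move=> rG; rewrite inE => /asboolP hg y.
rewrite (star_densityE R f0 n0) // ?(ltnW d1) // /star_law -sumrB.
apply: le_trans (ler_norm_sum _ _ _) _.
apply: le_trans (_ : \sum_(a : ballcol) t <= _); last by rewrite sumr_const mulr_natl.
rewrite big_mkcond; apply: ler_sum => a _; case: ifP => _; first exact: hg.
by apply: le_trans (hg a).
Qed.

Lemma cycle_total_sum n : (d.+1 * d + d.+1 * d + (size B).*2 <= n)%N ->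
  (\sum_(G : graph n | regular d G) cycle_total d G k.+1 <=
   (\sum_(l < size B) d ^ (2 * l.+1)) * num_regular d n)%N.
Proof.
move=> nb; rewrite /cycle_total exchange_big /= big_distrl /= [leqLHS]big_mkcond; apply: leq_sum => l _.
case: ifP => // l1; apply: cycle_count_sum => //.
have : (l.+1.*2 <= (size B).*2)%N by rewrite leq_double.
have : (2 * n <= d * n)%N by rewrite leq_mul2r d1 orbT.
move: nb; lia.
Qed.

Lemma ex_nat_ge (x : R) : exists N : nat, x <= N%:R.
Proof.
by have /archi_boundP/ltW hb := normr_ge0 x; exists (Num.bound `|x|); apply: le_trans (ler_norm _) hb.
Qed.

Hypothesis typ : forall (t : R) (N : nat), 0 < t -> exists n, [/\ (N <= n)%N, (0 < num_regular d n)%N &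
  (num_regular d n <= 2 * #|[set G : graph n | regular d G && `[< admits t G >]]%SET|)%N].

Lemma many_good_colourings (t eta : R) (N : nat) : 0 < t -> 0 < eta -> eta < 1 ->
  exists n, [/\ (N <= n)%N, (0 < n)%N, (0 < num_regular d n)%N &
  exists A : {set graph n}, [/\ (num_regular d n <= 4 * #|A|)%N, forall G, G \in A -> regular d G &
    forall G, G \in A -> (0 < #|good_colourings (covs n G) nu (3 * t)|)%N /\
      n%:R * (h - t) <= ln 2 + ln #|good_colourings (covs n G) nu (3 * t)|%:R + eta * (n%:R * ln #|F|%:R)]].
Proof.
move=> t0 e0 e1.
pose M : R := (d.+1 ^ k.+1)%:R; have M0 : 0 < M by rewrite ltr0n expn_gt0.
pose C : R := (\sum_(l < size B) d ^ (2 * l.+1))%:R.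
(* [N1] brings Markov's bound down to one quarter, [N2] brings Chebyshev's bound below [eta], and
   [N3] is the size required for counting cycles. *)
have [N1 hN1] := ex_nat_ge (4 * C * M / t).
have [N2 hN2] := ex_nat_ge (#|{: ballcol}|%:R * t^-2 * M ^+ 2 / eta).
pose N3 := (d.+1 * d + d.+1 * d + (size B).*2)%N.
have [n [nN N0 nA]] := typ (maxn (maxn N 1) (maxn N3 (maxn N1 N2))) t0.
move: nN; rewrite !geq_max => /andP[/andP[nN n0] /andP[nN3 /andP[nN1 nN2]]].
exists n; split=> //.
have n0' : 0 < n%:R :> R by rewrite ltr0n.
have i0 : 'I_n := Ordinal n0.
pose few (G : graph n) := (cycle_total d G k.+1)%:R <= t * n%:R / M.
pose A := [set G : graph n | [&& regular d G, `[< admits t G >] & few G]]%SET.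
exists A; split.
- have tM : 0 < t * n%:R / M by rewrite divr_gt0 // mulr_gt0.
  have many : (4 * #|[set G : graph n | regular d G && ~~ few G]%SET| <= num_regular d n)%N.
    rewrite -(ler_nat R) natrM -(ler_pM2r tM).
    apply: le_trans (_ : 4 * (\sum_(G : graph n | regular d G) cycle_total d G k.+1)%:R <= _).
      rewrite -mulrA ler_pM2l // mulr_natl -sumr_const natr_sum.
      rewrite [leRHS](bigID few) /= -[leLHS]add0r; apply: lerD; first exact: sumr_ge0.
      rewrite [leLHS](eq_bigl (fun G => regular d G && ~~ few G)) => [|G]; last by rewrite inE.
      by apply: ler_sum => G /andP[_]; rewrite -ltNge => /ltW.
    apply: le_trans (_ : 4 * (C * (num_regular d n)%:R) <= _).
      by rewrite ler_pM2l // -natrM ler_nat cycle_total_sum.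
    rewrite mulrA [leRHS]mulrC ler_wpM2r // ler_pdivlMr //.
    have : 4 * C * M / t <= n%:R by apply: le_trans hN1 _; rewrite ler_nat.
    by rewrite ler_pdivrMr // mulrC [n%:R * t]mulrC.
  have : (#|[set G : graph n | regular d G && `[< admits t G >]]%SET| <= #|A| + #|[set G : graph n | regular d G && ~~ few G]%SET|)%N.
    apply: leq_trans (leq_card_setU _ _); apply/subset_leq_card/fintype.subsetP => G.
    by rewrite !inE => /andP[-> ->]; case: (few G).
  move: many nA; move: #|A| #|[set G : graph n | regular d G && ~~ few G]%SET| => a b; lia.
- by move=> G; rewrite inE => /andP[].
move=> G; rewrite inE => /and3P[rG /asboolP[pv [pv0 pv1 hm hh]] fG].
have c0 := card_covers_gt0 R k i0 rG.
have rc0 := root_covers_gt0 R d k.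
have covE : #|covs n G|%:R = n%:R * root_covers R d k by have := @card_coversE R d n G i0 k rG.
have hi : #|covs n G|%:R^-1 * \sum_(psi in covs n G) (~~ injectiveb psi)%:R <= t.
  rewrite covE ler_pdivrMl ?mulr_gt0 //.
  apply: le_trans (_ : (cycle_total d G k.+1 * d.+1 ^ k.+1)%:R * root_covers R d k <= _).
    exact: noninjective_covers.
  rewrite mulrAC ler_wpM2r ?(ltW rc0) // natrM -/M -ler_pdivlMr // [n%:R * t]mulrC.
  exact: fG.
have bad := bad_colourings pv0 pv1 c0 t0 hm hi.
have hb : \sum_(g | g \notin good_colourings (covs n G) nu (3 * t)) wt pv g <= eta.
  apply: le_trans bad _.
  apply: le_trans (_ : #|{: ballcol}|%:R * (t^-2 * (#|covs n G|%:R^-2 * ((n * (d.+1 ^ k.+1) ^ 2)%:R * root_covers R d k ^+ 2))) <= _).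
    rewrite ler_wpM2l // ler_wpM2l ?invr_ge0 ?exprn_ge0 ?(ltW t0) // ler_wpM2l ?invr_ge0 ?exprn_ge0 //.
    exact: intersecting_covers.
  rewrite covE natrM natrX -/M.
  have frac (c r m x : R) : 0 < r -> 0 < m -> c * (x * ((m * r)^-2 * (m * M ^+ 2 * r ^+ 2))) = c * x * M ^+ 2 / m.
    by move=> r0 m0; field; rewrite !gt_eqF.
  rewrite frac // ler_pdivrMr // [eta * _]mulrC -ler_pdivrMr //.
  by apply: le_trans hN2 _; rewrite ler_nat.
have [g0 hg] := card_ge_entropy pv0 pv1 hb e1; split=> //.
exact: le_trans hh hg.
Qed.

Lemma limit_approx (del : R) : 0 < del -> exists n, exists G : graph n, exists n0 : 'I_n,
  exists g : {ffun 'I_n -> F}, regular d G /\ forall a, `|ball_freq R (covs n G) g a - nu a| <= del.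
Proof.
move=> del0; have t0 : 0 < del / 3 by rewrite divr_gt0.
have h2 : (2^-1 : R) < 1 by rewrite invf_lt1 // ltr1n.
have [|n [_ n0 N0 [A [A1 A2 A3]]]] := many_good_colourings 0 t0 _ h2; first by rewrite invr_gt0.
have : (0 < #|A|)%N by move: A1 N0; move: #|A| => a; lia.
move=> /card_gt0P[G GA]; have [/card_gt0P[g gG] _] := A3 G GA.
exists n, G, (Ordinal n0), g; split; first exact: A2.
by move=> a; move: gG; rewrite inE => /asboolP/(_ a); rewrite mulrC divfK // gt_eqF.
Qed.

Lemma core_inequality : h <= edge_vertex_entropy (star_law f0 nu).
Proof.
apply/ler_addgt0Pr => eps4 e4.
(* Four losses of at most [eps]: the upper bound on pairs, the tolerance [t], the bad colourings
   through [eta], and the constant factors. *)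
pose eps := eps4 / 4; have eps0 : 0 < eps by rewrite divr_gt0.
have [del d0 [N HN]] := near_pairs_upper d1 (star_law f0 nu) eps0.
pose t := Num.min eps (del / (3 * #|{: ballcol}|.+1%:R)).
have c3 : 0 < 3 * #|{: ballcol}|.+1%:R :> R by rewrite mulr_gt0 // ltr0n.
have t0 : 0 < t by rewrite lt_min eps0 divr_gt0.
have F0 : (0 < #|F|)%N by apply/card_gt0P; exists f0.
have lF : 0 <= ln #|F|%:R :> R by rewrite ln_ge0 // ler1n.
pose eta := Num.min (2^-1) (eps / (1 + ln #|F|%:R)).
have lF1 : 0 < 1 + ln #|F|%:R :> R by rewrite ltr_pwDl.
have eta0 : 0 < eta by rewrite lt_min invr_gt0 ltr0n divr_gt0.
have eta1 : eta < 1 by rewrite gt_min invf_lt1 ?ltr1n.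
have etaF : eta * ln #|F|%:R <= eps.
  apply: le_trans (_ : eps / (1 + ln #|F|%:R) * ln #|F|%:R <= _).
    by rewrite ler_wpM2r // ge_min lexx orbT.
  by rewrite mulrAC ler_pdivrMr // ler_pM2l //; lra.
(* The 8 is the 2 from Gibbs' inequality times the 4 from the proportion of graphs in [A]. *)
have [N2 hN2] := ex_nat_ge (ln 8 / eps).
have [n [nN n0 N0 [A [A1 A2 A3]]]] := many_good_colourings (maxn N N2) t0 eta0 eta1.
move: nN; rewrite geq_max => /andP[nN nN2].
have n0' : 0 < n%:R :> R by rewrite ltr0n.
have i0 : 'I_n := Ordinal n0.
have : (0 < #|A|)%N by move: A1 N0; move: #|A| => a; lia.
move=> /card_gt0P[G0 GA0].
(* A regular graph in [A] shows that [d * n] is even and supplies the number of edges. *)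
have EM := double_fwd_edges (A2 G0 GA0).
have up := HN n _ nN EM.
pose L : R := expR (n%:R * (h - t) - ln 2 - eta * (n%:R * ln #|F|%:R)).
have lo : #|A|%:R * L <= #|near_pairs n (star_law f0 nu) del|%:R.
  apply: le_trans (_ : (\sum_(G in A) #|good_colourings (covs n G) nu (3 * t)|)%:R <= _).
    rewrite mulr_natl -sumr_const natr_sum; apply: ler_sum => G GA; have [g0 hg] := A3 G GA.
    rewrite -[leRHS]lnK ?posrE ?ltr0n // ler_expR; lra.
  rewrite ler_nat.
  rewrite (eq_bigr (fun G => \sum_(g in good_colourings (covs n G) nu (3 * t)) 1)%N) => [|G _]; last by rewrite sum1_card.
  rewrite (pair_big_dep (fun G => G \in A) (fun G g => g \in good_colourings (covs n G) nu (3 * t)) (fun _ _ => 1%N)) /=.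
  rewrite sum1_card; apply/subset_leq_card/fintype.subsetP => -[G g] /andP[/= GA gG].
  rewrite inE /= A2 //=; apply/asboolP => y.
  apply: le_trans (good_near i0 (A2 G GA) gG y) _.
  apply: le_trans (_ : #|{: ballcol}|.+1%:R * (3 * t) <= _).
    by rewrite ler_wpM2r ?mulr_ge0 ?(ltW t0) // ler_nat.
  rewrite mulrCA mulrA -ler_pdivlMl // mulrC.
  by rewrite ge_min lexx orbT.
have A1' : (num_regular d n)%:R <= 4 * #|A|%:R :> R by rewrite -natrM ler_nat.
have L0 : 0 < L by exact: expR_gt0.
have N0' : 0 < (num_regular d n)%:R :> R by rewrite ltr0n.
have : L <= 4 * expR (n%:R * (edge_vertex_entropy (star_law f0 nu) + eps)).
  rewrite -(ler_pM2l N0'); apply: le_trans (_ : 4 * #|A|%:R * L <= _); first by rewrite ler_wpM2r // ltW.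
  by rewrite -mulrA [leRHS]mulrCA ler_pM2l //; exact: le_trans lo up.
have e44 : (4 : R) = expR (ln 4) by rewrite lnK // posrE.
rewrite [in X in _ <= X]e44 -expRD ler_expR => fin.
have l8 : ln 8 <= eps * n%:R.
  rewrite mulrC -ler_pdivrMr //; apply: le_trans hN2 _; by rewrite ler_nat.
have l24 : ln 8 = ln 2 + ln 4 :> R by rewrite -lnM ?posrE // -natrM.
have tE : t <= eps by rewrite ge_min lexx.
have : n%:R * h <= n%:R * (edge_vertex_entropy (star_law f0 nu) + eps4).
  have h1 : n%:R * t <= n%:R * eps by rewrite ler_pM2l.
  have h2 : eta * (n%:R * ln #|F|%:R) <= n%:R * eps by rewrite mulrCA ler_pM2l.
  have h3 : n%:R * eps4 = 4 * (n%:R * eps) by rewrite /eps; field.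
  move: fin; rewrite !mulrDr mulrN; move: l8; rewrite l24 [eps * _]mulrC; lra.
by rewrite ler_pM2l.
Qed.

End Core.

(** * Integrals against the law of a random covering *)

Section Bounded.
Context dT (T : measurableType dT) (R : realType) (m : probability T R).

Lemma bounded_integrable (h : T -> R) (M : R) : measurable_fun setT h -> (forall x, `|h x| <= M) ->
  m.-integrable setT (EFin \o h).
Proof.
move=> mh hM; apply: measurable_bounded_integrable => //.
  by apply: fin_num_fun_lty => //; exact: fin_num_measure.
by exists M; split; [exact: num_real|move=> N MN x _ /=; apply: le_trans (hM x) (ltW MN)].
Qed.

Lemma Rintegral_bigsum (I : Type) (s : seq I) (P : pred I) (h : I -> T -> R) :
  (forall i, m.-integrable setT (EFin \o h i)) ->
  Rintegral m setT (fun x => \sum_(i <- s | P i) h i x) = \sum_(i <- s | P i) Rintegral m setT (h i).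
Proof.
move=> hi; rewrite /Rintegral.
under eq_integral do rewrite -sumEFin.
rewrite (integral_sum _ hi) // -sum_fine // => i _; exact: integrable_fin_num.
Qed.

Lemma Rintegral_indicator (A : set T) : measurable A -> Rintegral m setT (\1_A) = fine (m A).
Proof. by move=> mA; rewrite /Rintegral integral_indic // setIT. Qed.

End Bounded.

Section Conf.
Variables (R : realType) (d : nat) (X : ptopologicalType).

Lemma measurable_coord (q : Vd d) (A : set X) : borel_sets A ->
  measurable ([set x | A (x q)] : set (conf d X)).
Proof. by move=> bA; apply: sub_sigma_algebra; exists q, A. Qed.

Lemma borel_open (A : set X) : open A -> borel_sets A.
Proof. by move=> oA; exact: sub_sigma_algebra. Qed.

Lemma borel_closed (A : set X) : closed A -> borel_sets A.
Proof.
move=> cA; rewrite /borel_sets -[A]setCK; apply: sigma_algebraC.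
by apply: sub_sigma_algebra; exact: closed_openC.
Qed.

Lemma measurable_coord_fun (q : Vd d) (u : X -> R) : continuous u ->
  measurable_fun setT (fun x : conf d X => u (x q)).
Proof.
move=> cu; apply: (measurability _ (measurable_realfun.RGenOpens.measurableE R)) => _ [_ [a [b ->] <-]].
rewrite setTI; apply: (@measurable_coord q (u @^-1` `]a, b[)); apply: borel_open.
move/continuousP: cu; apply; exact: interval_open.
Qed.

Lemma continuous_coord (q : Vd d) (u : X -> R) : continuous u ->
  continuous ((fun x => u (x q)) : {ptws Vd d -> X} -> R).
Proof.
move=> cu x; have := @continuous_comp {ptws Vd d -> X} X R (@proj (Vd d) (fun=> X) q) u x.
apply; last exact: cu.
exact: (@proj_continuous (Vd d) (fun=> X)).
Qed.

End Conf.

Section CoverIntegral.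
Variables (R : realType) (d n : nat) (X : pseudoPMetricType R) (f : 'I_n -> X) (G : graph n).
Variable m : probability (conf d X) R.
Hypotheses (hX : hausdorff_space X) (hm : is_distr_star f G m).
Variable r : nat.
Notation B := (ball_root d r).
Notation J := 'I_(size B).
Notation coord j x := ((x : conf d X) (nth (root_ d) B j)).

Let rectangle (A : J -> set X) : set (conf d X) := [set x | forall j, A j (coord j x)].

Let measurable_rectangle A : (forall j, borel_sets (A j)) -> measurable (rectangle A).
Proof.
move=> bA; have -> : rectangle A = \bigcap_(j in setT) [set x | A j (coord j x)].
  by apply/seteqP; split=> x /= hx j => [_|]; [exact: hx|exact: (hx j)].
by apply: fin_bigcap_measurable => // j _; exact: measurable_coord.
Qed.

Let borel_finite (A : set X) : finite_set A -> borel_sets A.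
Proof. by move=> fA; apply: borel_closed; exact: (accessible_finite_set_closed.1 (hausdorff_accessible hX)). Qed.

Let full_measure : m (rectangle (fun=> range f)) = 1%E.
Proof.
have b1 : borel_sets (range f) by apply: borel_finite; apply: finite_image.
have b2 : borel_sets [set: X] by apply: borel_open; exact: openT.
rewrite hm // -[RHS](probability_setT m).
have -> : [set: conf d X] = rectangle (fun=> setT) by apply/seteqP; split.
rewrite hm //; congr (_ * _)%:E; apply: eq_bigr => psi _; apply: eq_bigr => j _.
by rewrite !indicE !mem_set //; exists (psi j).
Qed.

Let multiplicity v : R := \sum_w (f w == f v)%:R.

(* Weighting the atoms by their multiplicity avoids choosing representatives when f is not injective. *)
Let atoms (u : X -> R) w : \sum_v (f w == f v)%:R * (u (f v) / multiplicity v) = u (f w).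
Proof.
have mw : 0 < multiplicity w.
  by rewrite /multiplicity (bigD1 w) //= eqxx ltr_pwDl // sumr_ge0.
rewrite (eq_bigr (fun v => (f v == f w)%:R * (u (f w) / multiplicity w))) => [|v _].
  by rewrite -big_distrl /= -/(multiplicity w) mulrCA mulfV ?mulr1 // gt_eqF.
rewrite [f v == _]eq_sym; have [e|] := eqVneq (f w) (f v); last by rewrite !mul0r.
by rewrite /multiplicity e.
Qed.

(** On the coordinates of a ball [m] is concentrated on values in the finite set [range f], so
    almost everywhere the integrand is a finite combination of indicators of rectangles, whose
    measures [is_distr_star] prescribes. Finite sets are Borel because [X] is Hausdorff. *)
Lemma cover_integral (u : J -> X -> R) : (forall j, continuous (u j)) ->
  Rintegral m setT (fun x => \prod_j u j (coord j x)) =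
  #|@covers d r n G|%:R^-1 * \sum_(psi in @covers d r n G) \prod_j u j (f (psi j)).
Proof.
move=> cu.
pose E (c : {ffun J -> 'I_n}) := rectangle (fun j => [set f (c j)]).
pose K (c : {ffun J -> 'I_n}) := \prod_j (u j (f (c j)) / multiplicity (c j)).
have bE c : forall j, borel_sets [set f ((c : {ffun J -> 'I_n}) j)].
  by move=> j; exact: borel_finite (finite_set1 _).
have mE c : measurable (E c) by exact: measurable_rectangle.
have iE c : m.-integrable setT (EFin \o (\1_(E c))) by exact: integrable_indic.
transitivity (Rintegral m setT (fun x => \sum_c K c * \1_(E c) x)).
  rewrite /Rintegral; congr fine; apply: ae_eq_integral => //.
  - apply/measurable_realfun.measurable_EFinP; apply: measurable_prod => j _; exact: measurable_coord_fun.
  - apply/measurable_realfun.measurable_EFinP; apply: measurable_sum => c; apply: measurable_realfun.measurable_funM.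
      exact: measurable_cst.
    exact: measurable_realfun.measurable_indic.
  have mN : measurable (rectangle (fun=> range f)).
    by apply: measurable_rectangle => j; apply: borel_finite; exact: finite_image.
  have N0 : m (~` rectangle (fun=> range f)) = 0%E by rewrite probability_setC // full_measure subee.
  exists (~` rectangle (fun=> range f)); split; [exact: measurableC|exact: N0|].
  apply: subsetC => x /= hx _; congr EFin.
  have [w hw] : exists w : {ffun J -> 'I_n}, forall j : J, coord j x = f (w j).
    have /fin_all_exists[w hw] : forall j : J, exists v : 'I_n, coord j x = f v.
      by move=> j; have [v _ <-] := hx j; exists v.
    by exists (finfun w) => j; rewrite ffunE.
  transitivity (\prod_j \sum_v (f (w j) == f v)%:R * (u j (f v) / multiplicity v)).
    by apply: eq_bigr => j _; rewrite atoms hw.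
  rewrite bigA_distr_bigA /=; apply: eq_bigr => c _; rewrite big_split /= mulrC; congr (_ * _).
  rewrite indicE; case: (boolP (x \in E c)) => [/set_mem xE|/negP xE].
    by rewrite big1 // => j _; rewrite -hw (xE j) eqxx.
  have : ~ forall j, f (w j) == f (c j).
    by move=> h; apply: xE; apply: mem_set => j /=; rewrite hw; exact/eqP.
  move=> /forallP; rewrite negb_forall => /existsP[j /negbTE e].
  by rewrite (bigD1 j) //= e mul0r.
rewrite Rintegral_bigsum => [|c]; last exact: (integrableZl _ _ (iE c)).
transitivity (\sum_c K c * (#|@covers d r n G|%:R^-1 * \sum_(psi in @covers d r n G) \prod_j (f (psi j) == f (c j))%:R)).
  apply: eq_bigr => c _; rewrite RintegralZl // Rintegral_indicator // hm //=; congr (_ * (_ * _)).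
  by apply: eq_bigr => psi _; apply: eq_bigr => j _; rewrite indicE; congr (nat_of_bool _)%:R; apply/idP/eqP => [/set_mem//|->]; exact: mem_set.
under eq_bigr do rewrite mulrCA.
rewrite -big_distrr /=; congr (_ * _).
under eq_bigr do rewrite big_distrr /=.
rewrite exchange_big /=; apply: eq_bigr => psi _.
rewrite (eq_bigr (fun c : {ffun J -> 'I_n} => \prod_j ((f (psi j) == f (c j))%:R * (u j (f (c j)) / multiplicity (c j))))) => [|c _].
  rewrite -(bigA_distr_bigA (fun j v => (f (psi j) == f v)%:R * (u j (f v) / multiplicity v))) /=.
  by apply: eq_bigr => j _; rewrite atoms.
by rewrite big_split /= mulrC.
Qed.

End CoverIntegral.

(** * Continuity and boundedness of the discretization *)

Section Discretization.
Variables (R : realType) (X : pseudoPMetricType R) (F : finType) (phi : X -> {ffun F -> R}).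
Hypothesis dphi : continuous_discretization phi.

Lemma discretization_ge0 x a : 0 <= phi x a.
Proof. by have [/(_ x)[]] := dphi. Qed.

Lemma discretization_sum x : \sum_a phi x a = 1.
Proof. by have [/(_ x)[]] := dphi. Qed.

Lemma discretization_le1 x a : phi x a <= 1.
Proof.
rewrite -(discretization_sum x) (bigD1 a) //= lerDl; apply: sumr_ge0 => b _; exact: discretization_ge0.
Qed.

Lemma discretization_inhabited : F.
Proof.
have [a _|F0] := pickP (predT : pred F); first exact: a.
exfalso; have /eqP := discretization_sum point.
by rewrite big_pred0 // eq_sym oner_eq0.
Qed.

Lemma discretization_near x (eps : R) : 0 < eps -> \forall y \near x, forall a, `|phi y a - phi x a| < eps.
Proof.
move=> e0; have [_ /(_ x (eps / 2))[|del d0 hd]] := dphi; first by rewrite divr_gt0.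
near=> y => a; apply: le_lt_trans (_ : 2 * tv_dist (phi x) (phi y) < _).
  rewrite /tv_dist mulVKf // (bigD1 a) //= distrC lerDl; exact: sumr_ge0.
rewrite -ltr_pdivlMl // mulrC; apply: hd.
by near: y; exact: nbhsx_ballx.
Unshelve. all: by end_near. Qed.

Lemma discretization_continuous a : continuous (fun x => phi x a).
Proof.
move=> x; apply/cvgrPdist_lt => eps e0; near=> y.
by rewrite distrC; move: a; near: y; exact: discretization_near.
Unshelve. all: by end_near. Qed.

Lemma shannon_continuous : continuous (fun x => shannon (phi x)).
Proof.
move=> x; apply/cvgrPdist_le => eps e0.
have [del d0 hdel] := entropy_cont (phi x) e0.
near=> y; rewrite distrC; apply: (hdel (phi y)) => a; apply: ltW; move: a.
by near: y; exact: discretization_near.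
Unshelve. all: by end_near. Qed.

(** Makes the entropy an admissible test function for [weak_conv]. *)
Lemma shannon_bounded x : `|shannon (phi x)| <= #|F|%:R * 2.
Proof.
rewrite /shannon normrN; apply: le_trans (ler_norm_sum _ _ _) _.
rewrite mulr_natl -sumr_const; apply: ler_sum => a _.
have := discretization_ge0 x a; rewrite le_eqVlt => /predU1P[<-|p0]; first by rewrite mul0r normr0.
have := discretization_le1 x a; rewrite le_eqVlt => /predU1P[->|p1]; first by rewrite ln1 mulr0 normr0.
apply: le_trans (xlnx_small p0 p1) _; rewrite ler_piMr // -[leRHS]sqrtr1; exact/ler_wsqrtr/ltW.
Qed.

End Discretization.

(** * From typicality to a proportion of the regular graphs *)

Section Typical.
Variables (R : realType) (d k : nat) (X : pseudoPMetricType R) (F : finType) (phi : X -> {ffun F -> R}).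
Variable mu : probability (conf d X) R.
Hypotheses (hX : hausdorff_space X) (dphi : continuous_discretization phi).

Notation B := (ball_root d k.+1).
Notation h := (Rintegral mu setT (fun x : conf d X => shannon (phi (x (root_ d))))).

Lemma marginal_integral n (f : 'I_n -> X) (G : graph n) (m : probability (conf d X) R)
  (a : {ffun 'I_(size B) -> F}) : is_distr_star f G m ->
  phistar_marg phi m a = ball_mean (fun v => phi (f v)) [pred psi | psi \in @covers d k.+1 n G] a.
Proof.
move=> hm; rewrite /phistar_marg /ball_mean.
rewrite (@cover_integral R d n X f G m hX hm k.+1 (fun j x => phi x (a j))); first by congr (_ * _).
by move=> j; exact: discretization_continuous.
Qed.

Lemma root_integral n (f : 'I_n -> X) (G : graph n) (m : probability (conf d X) R) : is_distr_star f G m ->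
  Rintegral m setT (fun x : conf d X => shannon (phi (x (root_ d)))) = n%:R^-1 * \sum_v shannon (phi (f v)).
Proof.
move=> hm; have := @cover_integral R d n X f G m hX hm 0 (fun _ x => shannon (phi x)) (fun=> shannon_continuous dphi).
have s1 : size (ball_root d 0) = 1%N by rewrite ball_root0.
have -> : (fun x : conf d X => \prod_(j < size (ball_root d 0)) shannon (phi (x (nth (root_ d) (ball_root d 0) j)))) =
   (fun x : conf d X => shannon (phi (x (root_ d)))).
  apply/funext => x; rewrite -(big_mkord xpredT (fun j => shannon (phi (x (nth (root_ d) (ball_root d 0) j))))).
  by rewrite -(big_nth (root_ d) xpredT (fun q => shannon (phi (x q)))) ball_root0 big_seq1.
move=> ->.
have all0 psi : psi \in @covers d 0 n G by rewrite inE; apply/asboolP.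
rewrite (eq_bigl xpredT) => [|psi]; last by rewrite all0.
rewrite -(bigA_distr_bigA (fun _ v => shannon (phi (f v)))) prodr_const card_ord [X in _ ^+ X]s1 expr1.
congr (_%:R^-1 * _); rewrite (eq_card (B := predT)) => [|psi]; last by rewrite all0.
by rewrite card_ffun !card_ord [X in (_ ^ X)%N]s1 expn1.
Qed.

Lemma product_bounded (s : seq (Vd d)) (a : 'I_(size s) -> F) (x : conf d X) :
  `|\prod_(i < size s) phi (x (nth (root_ d) s i)) (a i)| <= 1.
Proof.
rewrite ger0_norm; last by apply: prodr_ge0 => i _; exact: discretization_ge0.
by apply: prodr_ile1 => i _; rewrite discretization_ge0 // discretization_le1.
Qed.

Lemma product_continuous (s : seq (Vd d)) (a : 'I_(size s) -> F) :
  continuous ((fun x => \prod_(i < size s) phi (x (nth (root_ d) s i)) (a i)) : {ptws Vd d -> X} -> R).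
Proof.
apply: (continuous_big (@mul_continuous R)) => i _.
exact: (continuous_coord (q := nth (root_ d) s i) (discretization_continuous dphi (a := a i))).
Qed.

(** Finitely many bounded continuous test functions suffice: the probabilities of the coloured balls
    of radius [k+1] and the entropy at the root. *)
Lemma admits_eventually (ns : nat -> nat) (f : forall i, 'I_(ns i) -> X) (G : forall i, graph (ns i))
  (m : nat -> probability (conf d X) R) (t : R) : 0 < t ->
  (forall i, is_distr_star (f i) (G i) (m i)) -> weak_conv m mu ->
  \forall i \near \oo, admits (k := k) (fun a => phistar_marg phi mu a) h t (G i).
Proof.
move=> t0 hm wc.
have ch : Rintegral (m i) setT (fun x : conf d X => shannon (phi (x (root_ d)))) @[i --> \oo] --> h.
  apply: wc; last exact: (continuous_coord (q := root_ d) (shannon_continuous dphi)).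
  by exists (#|F|%:R * 2) => x; exact: shannon_bounded.
have ca (a : {ffun 'I_(size B) -> F}) : phistar_marg phi (m i) a @[i --> \oo] --> phistar_marg phi mu a.
  by apply: wc; [exists 1 => x; exact: product_bounded|exact: product_continuous].
have nh : \forall i \near \oo, h - t <= Rintegral (m i) setT (fun x : conf d X => shannon (phi (x (root_ d)))).
  move/cvgrPdist_le: ch => /(_ t t0); apply: filterS => i hi.
  by move: hi; rewrite ler_norml => /andP[_]; lra.
have na : \forall i \near \oo, forall a : {ffun 'I_(size B) -> F}, `|phistar_marg phi (m i) a - phistar_marg phi mu a| <= t.
  apply: filter_forall => a; move/cvgrPdist_le: (ca a) => /(_ t t0); apply: filterS => i.
  by rewrite distrC.
near=> i; exists (fun v => phi (f i v)); split.
- by move=> v; exact: discretization_ge0.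
- by move=> v; exact: discretization_sum.
- move=> a; rewrite -(marginal_integral a (hm i)); move: a; near: i; exact: na.
(* Without vertices both sides are 0. *)
have [n0|n0] := posnP (ns i).
  by rewrite [X in X%:R * _]n0 mul0r; apply: sumr_ge0 => v; have := ltn_ord v; rewrite [X in (_ < X)%N]n0.
rewrite -ler_pdivlMl ?ltr0n // -(root_integral (hm i)); near: i; exact: nh.
Unshelve. all: by end_near. Qed.

Lemma typical_admits (t : R) (N : nat) : typical mu -> 0 < t -> exists n, [/\ (N <= n)%N, (0 < num_regular d n)%N &
  (num_regular d n <= 2 * #|[set G : graph n | regular d G &
     `[< admits (k := k) (fun a => phistar_marg phi mu a) h t G >]]%SET|)%N].
Proof.
case=> ns [ns_inc [dO [T [P [G [mG [PG [_ aeG]]]]]]]] t0.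
pose Q i (g : graph (ns i)) := `[< admits (k := k) (fun a => phistar_marg phi mu a) h t g >].
pose V i := [set w | Q i (G i w)].
have VE i : V i = \big[setU/set0]_(g | Q i g) [set w | G i w = g].
  rewrite -bigcup_seq_cond; apply/seteqP; split=> [w Vw|w [g /= /andP[_ Qg] e]]; last by rewrite /V /= e.
  by exists (G i w) => //=; rewrite mem_index_enum.
have mV i : measurable (V i) by rewrite VE; apply: bigsetU_measurable => g _; exact: mG.
have PV i : (P (V i) <= (#|[set g : graph (ns i) | regular d g & Q i g]%SET|%:R / (num_regular d (ns i))%:R)%:E)%E.
  apply: le_trans (_ : (\sum_(g | Q i g) P [set w | G i w = g] <= _)%E).
    rewrite VE; elim: (index_enum _) => [|g s IH]; first by rewrite !big_nil measure0.
    rewrite !big_cons; case: ifP => // _; apply: le_trans (measureU2 _ _ _) _; first exact: mG.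
      by apply: bigsetU_measurable => g' _; exact: mG.
    exact: leeD2l.
  rewrite (eq_bigr (fun g => ((regular d g)%:R / (num_regular d (ns i))%:R)%:E)) => [|g _]; last first.
    rewrite PG; congr (_ / _%:R)%:E; apply: eq_card => g'; apply/idP/idP => [/set_mem//|?]; exact/mem_set.
  rewrite sumEFin lee_fin -big_distrl /= ler_wpM2r ?invr_ge0 //.
  rewrite -natr_sum -sum1_card ler_nat big_mkcond [leqRHS]big_mkcond /=; apply: leq_sum => g _.
  by rewrite finset.inE; case: (Q i g); case: (regular d g).
pose W j := \bigcap_(i in [set i | (j <= i)%N]) V i.
have mW j : measurable (W j) by apply: bigcap_measurableType => i _; exact: mV.
have WU : P (\bigcup_j W j) = 1%E.
  have mU : measurable (\bigcup_j W j) by exact: bigcupT_measurable.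
  have : P (~` \bigcup_j W j) = 0%E.
    apply: measure_negligible; first exact: measurableC.
    apply: negligibleS aeG; apply: subsetC => w [f [m [hm wc]]].
    have [j _ hj] := admits_eventually t0 hm wc.
    by exists j => // i /= ji; apply/asboolP; exact: hj.
  rewrite probability_setC // => e.
  have := fin_num_measure P _ mU; move: e; case: (P _) => [r||] //=.
  by case=> e _; congr EFin; move/eqP: e; rewrite subr_eq0 => /eqP.
have cW : P (W j) @[j --> \oo] --> 1%E.
  rewrite -WU; apply: nondecreasing_cvg_mu => //; first exact: bigcupT_measurable.
  move=> i j ij; apply/subsetPset => w Ww l /= jl; apply: Ww; exact: leq_trans jl.
have [j _ hj] : \forall j \near \oo, (2^-1%:E < P (W j))%E.
  apply: (cW [set x | (2^-1%:E < x)%E]); apply: open_nbhs_nbhs; split; first exact: open_ereal_gt_ereal.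
  by rewrite /= lte_fin invf_lt1 // ltr1n.
pose i := maxn j N; exists (ns i).
have PVi : (2^-1%:E < P (V i))%E.
  apply: lt_le_trans (hj j (leqnn j)) _; apply: le_measure; [exact/mem_set|exact/mem_set|].
  by move=> w; apply; exact: leq_maxl.
have := lt_le_trans PVi (PV i); rewrite lte_fin => lo.
(* If there were no regular graph, the quotient would be 0 by the convention for division. *)
have reg0 : (0 < num_regular d (ns i))%N.
  by case: posnP lo => // ->; rewrite invr0 mulr0 ltNge invr_ge0 ler0n.
split=> //.
  have nsle l : (l <= ns l)%N by elim: l => // l IH; exact: leq_ltn_trans IH (ns_inc l).
  exact: leq_trans (leq_maxr j N) (nsle i).
move: lo; rewrite ltr_pdivlMr ?ltr0n // mulrC ltr_pdivrMr // -natrM ltr_nat mulnC => /ltnW; exact.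
Qed.

End Typical.

(** * Translations of the tree and marginals of invariant processes *)

Section Translations.
Variable d : nat.

Definition walk (p : Vd d) (s : seq 'I_d) : Vd d := foldl (@step d) p s.

(** Left multiplication by [w]; it commutes with [step], which is right multiplication, and is
    therefore an automorphism. *)
Definition translation (w q : Vd d) : Vd d := walk w (val q).

Lemma walk_rev p s : walk (walk p s) (rev s) = p.
Proof.
elim/last_ind: s p => [//|s c IH] p.
by rewrite rev_rcons /walk -cats1 foldl_cat /= stepK; exact: IH.
Qed.

Lemma translation_step w q c : translation w (step q c) = step (translation w q) c.
Proof.
rewrite /translation val_step /step_word; case: q => s rs /=; case/lastP: s rs => [|s x] rs.
  by rewrite /= /walk.
rewrite -size_eq0 size_rcons last_rcons /= parent_word_rcons; case: (x =P c) => [->|_].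
  by rewrite /walk -cats1 foldl_cat /= stepK.
by rewrite /walk -[rcons (rcons _ _) _]cats1 foldl_cat.
Qed.

Lemma translation_walk w p s : translation w (walk p s) = walk (translation w p) s.
Proof. by elim: s p => //= c s IH p; rewrite IH translation_step. Qed.

Lemma walk_root q : walk (root_ d) (val q) = q.
Proof.
case: q => s rs; apply: val_inj; rewrite /=.
elim/last_ind: s rs => [//|s c IH] rs.
have := rs; rewrite reduced_rcons => /andP[rs' lc].
rewrite /walk -cats1 foldl_cat /= /step_word.
move: (IH rs'); rewrite /walk => ->.
by move: lc; case: (s == [::]) => [_|/= /negbTE->] /=; rewrite ?cats1.
Qed.

Lemma translation_root w : translation w (root_ d) = w. Proof. by []. Qed.

Lemma translation_automorphism w : tree_automorphism (translation w).
Proof.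
pose w' := walk (root_ d) (rev (val w)).
have K1 : cancel (translation w) (translation w').
  have e : walk w' (val w) = root_ d by rewrite /w' -{2}[val w]revK walk_rev.
  by move=> q; rewrite {2}/translation translation_walk /translation e walk_root.
have K2 : cancel (translation w') (translation w).
  have e : walk w (rev (val w)) = root_ d by rewrite -{1}[w]walk_root walk_rev.
  by move=> q; rewrite {2}/translation translation_walk translation_walk translation_root e walk_root.
have tadj v : forall p q, adj p q -> adj (translation v p) (translation v q).
  by move=> p q /adjP[c ->]; rewrite translation_step adj_step.
split; first by exists (translation w').
by move=> p q; apply/idP/idP => [/(tadj w')|/tadj //]; rewrite !K1.
Qed.

Lemma automorphism_within (g : Vd d -> Vd d) k (S : seq (Vd d)) q : tree_automorphism g ->
  Defs.within k S q -> Defs.within k (map g S) (g q).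
Proof.
move=> [_ ga] [s sS [p [pk sp <-]]]; exists (g s); first exact: map_f.
exists (map g p); split; [by rewrite size_map| |by rewrite last_map].
by rewrite path_map; apply: sub_path sp => a b; rewrite /= ga.
Qed.

Lemma automorphism_inv (g : Vd d -> Vd d) : tree_automorphism g ->
  exists g', [/\ tree_automorphism g', cancel g g' & cancel g' g].
Proof.
move=> [[g' K K'] ga]; exists g'; split=> //; split; first by exists g.
by move=> p q; rewrite -ga !K'.
Qed.

Lemma automorphism_tball (g : Vd d -> Vd d) k (S : seq (Vd d)) : tree_automorphism g ->
  map g (tball k S) =i tball k (map g S).
Proof.
move=> ga; have [g' [ga' K K']] := automorphism_inv ga.
move=> q; apply/mapP/idP => [[p pS ->]|].
  by move: pS; rewrite !mem_tball => /asboolP wp; apply/asboolP; exact: automorphism_within.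
rewrite mem_tball => /asboolP/(automorphism_within ga'); rewrite -map_comp map_id_in => [wq|p _]; last exact: K.
by exists (g' q); rewrite ?K' // mem_tball; apply/asboolP.
Qed.

Lemma tball_ball_root k : tball k (tball 1 [:: root_ d]) =i ball_root d k.+1.
Proof.
move=> q; rewrite !mem_tball; apply/asboolP/asboolP => [[s sS [p [pk sp <-]]]|[s]].
  move: sS; rewrite mem_tball => /asboolP[r]; rewrite inE => /eqP -> [p0 [p1 rp e]].
  exists (root_ d); first by rewrite inE.
  by exists (p0 ++ p); rewrite size_cat cat_path rp last_cat e; split=> //; rewrite -add1n leq_add.
rewrite inE => /eqP -> [[|x p] [pk sp <-]].
  exists (root_ d); last by exists [::].
  by rewrite mem_tball; apply/asboolP; exists (root_ d); [rewrite inE|exists [::]].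
move: sp => /= /andP[rx xp]; exists x; last by exists p.
by rewrite mem_tball; apply/asboolP; exists (root_ d); [rewrite inE|exists [:: x]; rewrite /= rx].
Qed.

End Translations.

(** * Marginals and entropies of the discretized process *)

Section Marginals.
Variables (R : realType) (d : nat) (X : pseudoPMetricType R) (F : finType) (phi : X -> {ffun F -> R}).
Variable mu : probability (conf d X) R.
Hypothesis dphi : continuous_discretization phi.
Implicit Types S : seq (Vd d).

Lemma product_measurable S (a : 'I_(size S) -> F) :
  measurable_fun setT (fun x : conf d X => \prod_(i < size S) phi (x (nth (root_ d) S i)) (a i)).
Proof. by apply: measurable_prod => i _; exact: (measurable_coord_fun (nth (root_ d) S i) (discretization_continuous dphi (a := a i))). Qed.

Lemma product_integrable S (a : 'I_(size S) -> F) :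
  mu.-integrable setT (EFin \o (fun x : conf d X => \prod_(i < size S) phi (x (nth (root_ d) S i)) (a i))).
Proof. by apply: (@bounded_integrable _ _ R mu _ 1); [exact: (@product_measurable S a)|move=> x; exact: (product_bounded dphi)]. Qed.

Lemma phistar_marg_ge0 S (a : {ffun 'I_(size S) -> F}) : 0 <= phistar_marg phi mu a.
Proof. by apply: Rintegral_ge0 => x _; apply: prodr_ge0 => i _; exact: discretization_ge0. Qed.

Lemma product_look (f0 : F) S (a : {ffun 'I_(size S) -> F}) (x : conf d X) : uniq S ->
  \prod_(i < size S) phi (x (nth (root_ d) S i)) (a i) = \prod_(q <- S) phi (x q) (look f0 a q).
Proof. by move=> uS; rewrite -big_look; apply: eq_bigr => i _; rewrite look_nth. Qed.

(** Pointwise in [x], the colours outside [S'] are summed out because each [phi (x q)] has total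
    mass 1. *)
Lemma phistar_marg_sub (f0 : F) S S' (z : {ffun 'I_(size S') -> F}) : uniq S -> uniq S' -> {subset S' <= S} ->
  phistar_marg phi mu z =
  \sum_(a : {ffun 'I_(size S) -> F} | rst S' (look f0 a) == z) phistar_marg phi mu a.
Proof.
move=> uS uS' sS; rewrite /phistar_marg -Rintegral_bigsum => [|a]; last exact: product_integrable.
congr (Rintegral _ _ _); apply/funext => x.
pose w q c : R := phi (x q) c * (if q \in S' then (c == look f0 z q)%:R else 1).
transitivity (\sum_(a : {ffun 'I_(size S) -> F}) \prod_(i < size S) w (nth (root_ d) S i) (a i)).
  rewrite -(bigA_distr_bigA (fun (i : 'I_(size S)) c => w (nth (root_ d) S i) c)).
  rewrite (big_look S _ (fun q => \sum_c w q c)) (product_look f0) //.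
  rewrite [RHS](eq_bigr (fun q => if q \in S' then phi (x q) (look f0 z q) else 1)) => [|q _]; last first.
    rewrite /w /=; case: (q \in S'); last first.
      by rewrite -[RHS](discretization_sum dphi (x q)); apply: eq_bigr => c _; rewrite mulr1.
    rewrite (bigD1 (look f0 z q)) //= eqxx mulr1 big1 ?addr0 // => c /negbTE ->; exact: mulr0.
  rewrite -big_mkcond -[RHS]big_filter; apply: perm_big; apply: uniq_perm; [done|exact: filter_uniq|].
  by move=> q; rewrite mem_filter; case: (boolP (q \in S')) => // /sS ->.
rewrite [RHS]big_mkcond; apply: eq_bigr => a _; rewrite /w big_split /=.
case: eqP => [e|ne].
  rewrite [X in _ * X]big1 ?mulr1 // => i _; case: ifP => // iS'.
  by rewrite -e look_rst // look_nth // eqxx.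
have : ~ forall j : 'I_(size S'), look f0 a (nth (root_ d) S' j) == z j.
  by move=> e; apply: ne; apply/ffunP => j; rewrite ffunE; exact/eqP.
move=> /forallP; rewrite negb_forall => /existsP[j jz].
have jS' : nth (root_ d) S' j \in S' by rewrite mem_nth.
have iS : (index (nth (root_ d) S' j) S < size S)%N by rewrite index_mem sS.
rewrite [X in _ * X](bigD1 (Ordinal iS)) //= nth_index ?sS // jS' look_nth //.
suff -> : (a (Ordinal iS) == z j) = false by rewrite mul0r mulr0.
apply: contraNF jz => /eqP <-; rewrite -(look_nth f0 a (Ordinal iS)) //= nth_index ?sS //.
Qed.

Lemma measurable_relabel (g : Vd d -> Vd d) :
  measurable_fun setT (fun x : conf d X => (x \o g : conf d X)).
Proof.
apply: (@measurability _ _ (conf d X) (conf d X) setT _ (@cyl_gen (Vd d) X)) => // _ [_ [v [A [bA ->]] <-]].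
by rewrite setTI; exact: (measurable_coord (g v) bA).
Qed.

Lemma Rintegral_relabel (g : Vd d -> Vd d) (h : conf d X -> R) : invariant_process mu -> tree_automorphism g ->
  measurable_fun setT h -> (forall x, 0 <= h x) ->
  Rintegral mu setT (fun x => h (x \o g)) = Rintegral mu setT h.
Proof.
move=> inv ga mh h0; rewrite /Rintegral; congr fine.
have mg := measurable_relabel g.
rewrite -[LHS](ge0_integral_pushforward mg mu (D := setT) (f := EFin \o h)) //.
- by apply: eq_measure_integral => A mA _; exact: inv.
- exact/measurable_realfun.measurable_EFinP.
by move=> x _; rewrite lee_fin.
Qed.

Lemma phistar_marg_automorphism (f0 : F) (g : Vd d -> Vd d) S S' (a : {ffun 'I_(size S') -> F}) :
  invariant_process mu -> tree_automorphism g -> uniq S -> uniq S' -> map g S =i S' ->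
  phistar_marg phi mu a = phistar_marg phi mu (rst S (look f0 a \o g)).
Proof.
move=> inv ga uS uS' gS; rewrite /phistar_marg.
rewrite -[RHS](Rintegral_relabel inv ga); [|exact: product_measurable|]; last first.
  by move=> x; apply: prodr_ge0 => i _; exact: discretization_ge0.
congr (Rintegral _ _ _); apply/funext => x; rewrite !(product_look f0) //.
rewrite [LHS](perm_big (map g S)) /=; last first.
  rewrite perm_sym; apply: uniq_perm => //; rewrite map_inj_uniq //; exact: bij_inj ga.1.
by rewrite big_map [LHS]big_seq [RHS]big_seq; apply: eq_bigr => q qS; rewrite look_rst.
Qed.

(** With [g] the identity it says that the entropy does not depend on the order in which the
    vertices are listed. *)
Lemma entropy_phistar_automorphism (f0 : F) (g : Vd d -> Vd d) S S' :
  invariant_process mu -> tree_automorphism g -> uniq S -> uniq S' -> map g S =i S' ->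
  entropy_phistar phi mu S' = entropy_phistar phi mu S.
Proof.
move=> inv ga uS uS' gS; have [g' [ga' K K']] := automorphism_inv ga.
rewrite /entropy_phistar; congr (- _).
rewrite [RHS](reindex (fun a : {ffun 'I_(size S') -> F} => rst S (look f0 a \o g))) /=.
  by apply: eq_bigr => a _; rewrite (phistar_marg_automorphism f0 a inv ga uS uS' gS).
exists (fun b => rst S' (look f0 b \o g')) => a _; apply/ffunP => j; rewrite ffunE /= look_rst /=.
- by rewrite K' look_nth.
- have : nth (root_ d) S' j \in map g S by rewrite gS mem_nth.
  by case/mapP => p pS ->; rewrite K.
- by rewrite K look_nth.
by rewrite -gS map_f // mem_nth.
Qed.

End Marginals.

Theorem mainTheorem10 (R : realType) (d : nat) (X : pseudoPMetricType R)
  (F : finType) (phi : X -> {ffun F -> R}) (mu : probability (conf d X) R) :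
  (3 <= d)%N ->
  hausdorff_space X ->
  (exists D : set X, countable D /\ dense D) ->
  continuous_discretization phi ->
  invariant_process mu ->
  typical mu ->
  forall (k : nat) (u v : Vd d), adj u v ->
    entropy_phistar phi mu (tball k (tball 1 [:: root_ d]))
      - (d%:R / 2) * entropy_phistar phi mu (tball k [:: u; v])
    >= Rintegral mu setT (fun x : conf d X => shannon (phi (x (root_ d)))).
Proof.
move=> d3 hX _ dphi inv typ k u v /adjP[e ->].
have d1 : (1 < d)%N by exact: leq_trans d3.
have f0 := discretization_inhabited dphi.
have id_aut : tree_automorphism (@idfun (Vd d)) by split; first by exists idfun.
pose nu (a : {ffun 'I_(size (ball_root d k.+1)) -> F}) := phistar_marg phi mu a.
have hC : entropy_phistar phi mu (tball k (tball 1 [:: root_ d])) = entropy nu.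
  rewrite (@entropy_phistar_automorphism _ _ _ _ _ mu dphi f0 idfun (ball_root d k.+1)) ?uniq_tball //.
  by move=> q; rewrite map_id tball_ball_root.
have hE : entropy_phistar phi mu (tball k [:: u; step u e]) = entropy (nu_edge (e := e) f0 nu).
  (* Translation by [u] carries the edge at the root in direction [e] to the given edge. *)
  rewrite (@entropy_phistar_automorphism _ _ _ _ _ mu dphi f0 (translation u) (edge_ball k e)) ?uniq_tball //.
  - rewrite /entropy_phistar /entropy; congr (- _); apply: eq_bigr => z _.
    suff -> : phistar_marg phi mu z = nu_edge f0 nu z by [].
    by apply: phistar_marg_sub; [|exact: uniq_tball|exact: uniq_tball|exact: edge_ball_sub].
  - exact: translation_automorphism.
  move=> q; rewrite (automorphism_tball _ _ (translation_automorphism u)) /= translation_step.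
  by rewrite translation_root.
have tp := fun (t : R) (N : nat) => @typical_admits R d k X F phi mu hX dphi t N typ.
rewrite hC hE (entropy_identity f0 d1); first exact: (core_inequality f0 d1 tp).
- by move=> a; exact: phistar_marg_ge0.
exact: (limit_approx d1 tp).
Qed.
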